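(* Consider the $\mathcal{S}$-$\mathcal{AB}$ iteration and the distributed plug-in method (producing $\mathbf{H}_{i,k},\mathbf{S}_{i,k}$) described in the context. Suppose that (a) Assumptions 1 (objective function) and 2 (weight matrices and networks), as written out in the context, hold, and the step-size is $\alpha_k=a/(k+b)^{\alpha}$ with $\alpha\in(1/2,1)$ and positive scalars $a,b$ satisfying $\frac{a}{b^\alpha}\le\min\{1,\frac{n}{u^\intercal vL}\}$, where $L:=\max_{1\le i\le n}\sqrt{\mathbb{E}[L_i^2(\zeta_i)]}$; (b) the graph $\mathcal{G}_A$ is strongly connected, $\mathbf{A}$ is row stochastic and $a_{ii}>0$ for every $i\in\mathcal{V}$; (c) $\mathrm{Cov}\left(\sum_{j=1}^n\nabla g_j(x^*;\zeta_j)\right)=\sum_{j=1}^n\mathrm{Cov}\left(\nabla g_j(x^*;\zeta_j)\right)$; (d) there exist positive scalars $L_1,L_2$ such that for every $i\in\mathcal{V}$ and every $x\in\mathbb{R}^d$, $$\mathbb{E}\left[\left\|\nabla^2 g_i(x;\zeta_i)-\nabla^2 g_i(x^*;\zeta_i)\right\|\right]\le L_1\|x-x^*\|,\qquad \mathbb{E}\left[\left\|\nabla^2 g_i(x^*;\zeta_i)\right\|^2\right]\le L_2 .$$ Then, for every $i\in\mathcal{V}$, as $k\to\infty$, $$\mathbf{H}_{i,k}^{-1}\mathbf{S}_{i,k}\mathbf{H}_{i,k}^{-1}\longrightarrow\mathbf{H}^{-1}\mathbf{S}\mathbf{H}^{-1}\quad\text{in probability},$$ where $\mathbf{H}:=\nabla^2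 f(x^* )$ and $\mathbf{S}:=\mathrm{Cov}\left(\sum_{j=1}^n\nabla g_j(x^*;\zeta_j)\right)$.
   Context: Notation. $\|\cdot\|$ is the Euclidean norm (and the induced matrix norm), $\mathbf{1}$ the all-ones vector, $\mathrm{Cov}(\xi)$ the covariance matrix of a random vector $\xi$. Problem. Let $\mathcal{V}=\{1,\dots,n\}$ be a set of agents. Agent $j$ has the cost $f_j(x)=\mathbb{E}[g_j(x;\zeta_j)]$, $x\in\mathbb{R}^d$, where $\zeta_j$ is a random variable on a probability space $(\Omega,\mathcal{F},\mathrm{P})$. The problem is to minimize $f(x)=\sum_{j=1}^n f_j(x)$ over $\mathbb{R}^d$; $x^*$ denotes its optimal solution. Derivatives $\nabla g_i$, $\nabla^2 g_i$ are with respect to $x$ (in this statement $g_i(\cdot;\zeta_i)$ is twice differentiable). $\mathcal{S}$-$\mathcal{AB}$ iteration. Given weight matrices $\mathbf{A}=(a_{ij}),\mathbf{B}=(b_{ij})\in\mathbb{R}^{n\times n}$, step-sizes $\alpha_k>0$, and initial values $x_{i,0}\in\mathbb{R}^d$, set $y_{i,0}=\nabla g_i(x_{i,0};\zeta_{i,0})$ and, for $k\ge0$ and $i\in\mathcal{V}$, $$x_{i,k+1}=\sum_{j=1}^n a_{ij}x_{j,k}-\alpha_k y_{i,k},$$ $$y_{i,k+1}=\sum_{j=1}^n b_{ij}y_{j,k}+\nabla g_i(x_{i,k+1};\zeta_{i,k+1})-\nabla g_i(x_{i,k};\zeta_{i,k}),$$ where the vectors $(\zeta_{1,k},\dots,\zeta_{n,k})$,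 $k\ge0$, are i.i.d. copies of $(\zeta_1,\dots,\zeta_n)$. Distributed plug-in method. For $i\in\mathcal{V}$ let $u_{i,0}\in\mathbb{R}^n$ be the $i$-th standard basis vector and $\mathbf{H}_{i,0}=\mathbf{S}_{i,0}=\mathbf{0}\in\mathbb{R}^{d\times d}$. Write $\nabla g_{i,k}=\nabla g_i(x_{i,k};\zeta_{i,k})$ and $\nabla^2 g_{i,k}=\nabla^2 g_i(x_{i,k};\zeta_{i,k})$. For $k=1,2,\dots$ set $u_{i,k}=\sum_{j=1}^n a_{ij}u_{j,k-1}$ and, with $u_{i,k}(i)$ the $i$-th component of $u_{i,k}$, $$\mathbf{S}_{i,k}=\frac{k}{k+1}\sum_{j=1}^n a_{ij}\mathbf{S}_{j,k-1}+\frac{\nabla g_{i,k}(\nabla g_{i,k}-\nabla g_{i,k-1})^\intercal+(\nabla g_{i,k}-\nabla g_{i,k-1})\nabla g_{i,k}^\intercal}{2(k+1)\,u_{i,k}(i)},$$ $$\mathbf{H}_{i,k}=\frac{k}{k+1}\sum_{j=1}^n a_{ij}\mathbf{H}_{j,k-1}+\frac{\nabla^2 g_{i,k}}{(k+1)\,u_{i,k}(i)}.$$ On the event that $\mathbf{H}_{i,k}$ is singular, $\mathbf{H}_{i,k}^{-1}$ may be defined arbitrarily. Assumption 1 (objective function). (i) $f$ is differentiable and $\mu$-strongly convex ($\mu>0$): $f(y)\ge f(x)+\langle\nabla f(x),y-x\rangle+\frac{\mu}{2}\|x-y\|^2$ for all $x,y\in\mathbb{R}^d$. (ii) There is $c>0$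 with $\|\nabla f(x)-\nabla^2 f(x^* )(x-x^* )\|\le c\|x-x^*\|^2$ for all $x\in\mathbb{R}^d$. (iii) For each $i\in\mathcal{V}$, $g_i(\cdot;\zeta_i)$ is differentiable and there are constants $p>2$, $U_1>0$ such that for all $x,y\in\mathbb{R}^d$: $\mathbb{E}[\|\nabla g_i(x;\zeta_i)-\nabla f_i(x)\|^p]\le U_1^{p/2}$ and $\|\nabla g_i(x;\zeta_i)-\nabla g_i(y;\zeta_i)\|\le L_i(\zeta_i)\|x-y\|$, where $L_i(\zeta_i)$ is a positive random variable with $\mathbb{E}[L_i^p(\zeta_i)]<\infty$. Assumption 2 (weight matrices and networks). For a nonnegative matrix $\mathbf{M}\in\mathbb{R}^{n\times n}$, the directed graph induced by $\mathbf{M}$ has node set $\mathcal{V}$ and an edge $(j,i)$ (from $j$ to $i$) iff $\mathbf{M}_{ij}>0$. Let $\mathcal{G}_A$ and $\mathcal{G}_{B^\intercal}$ be the graphs induced by $\mathbf{A}$ and $\mathbf{B}^\intercal$. (i) $\mathbf{A}$ is nonnegative and row stochastic ($\mathbf{A}\mathbf{1}=\mathbf{1}$), $\mathbf{B}$ is nonnegative and column stochastic ($\mathbf{1}^\intercal\mathbf{B}=\mathbf{1}^\intercal$), and $\mathbf{A}_{ii}>0$, $\mathbf{B}_{ii}>0$ for all $i$. (ii) $\mathcal{G}_A$ and $\mathcal{G}_{B^\intercal}$ each contain at least one (directed) spanning tree, and at least one node is a root of spanning trees of both, i.e. $\mathcal{R}_A\cap\mathcal{R}_{B^\intercal}\neq\emptyset$,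 where $\mathcal{R}_A$ (resp. $\mathcal{R}_{B^\intercal}$) is the set of roots of all spanning trees of $\mathcal{G}_A$ (resp. $\mathcal{G}_{B^\intercal}$). Under Assumption 2, $u^\intercal$ denotes the nonnegative left eigenvector of $\mathbf{A}$ for eigenvalue $1$ with $u^\intercal\mathbf{1}=n$, and $v$ the nonnegative right eigenvector of $\mathbf{B}$ for eigenvalue $1$ with $\mathbf{1}^\intercal v=n$; one has $u^\intercal v>0$. *)

(* Defs.v *)
(* R^d is 'cV[R]_d, so transposes, outer products and Hessian-vector products
   are literal matrix formulas. *)
From HB Require Import structures.
From mathcomp Require Export all_boot all_order all_algebra.
From mathcomp Require Export all_classical all_reals all_analysis.
Export Order.TTheory GRing.Theory Num.Theory.
Export numFieldNormedType.Exports.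

Set Implicit Arguments.
Unset Strict Implicit.
Unset Printing Implicit Defensive.

Local Open Scope classical_set_scope.
Local Open Scope ring_scope.

(* The library norm on matrices is the max-norm; it is used only for the
   topology (differentiability). All quantitative statements use the Euclidean
   norm and the matrix norm it induces. *)
Definition enorm (R : realType) (d : nat) (v : 'cV[R]_d) : R :=
  Num.sqrt (\sum_(i < d) v i 0 ^+ 2).

Definition opnorm (R : realType) (m d : nat) (M : 'M[R]_(m, d)) : R :=
  sup [set enorm (M *m v) | v in [set v : 'cV[R]_d | enorm v <= 1]].

Definition dot (R : realType) (d : nat) (v w : 'cV[R]_d) : R :=
  (v^T *m w) 0 0.

(* As with the library's 'd, the values are meaningful only where the function
   is differentiable. *)
Definition grad (R : realType) (d : nat) (f : 'cV[R]_d -> R) (x : 'cV[R]_d) :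
    'cV[R]_d :=
  \col_j 'd (f : 'cV[R]_d -> R^o) x (delta_mx j 0).

Definition jac (R : realType) (d m : nat) (F : 'cV[R]_d -> 'cV[R]_m)
    (x : 'cV[R]_d) : 'M[R]_(m, d) :=
  \matrix_(i, j) 'd F x (delta_mx j 0) i 0.

Definition hess (R : realType) (d : nat) (f : 'cV[R]_d -> R) (x : 'cV[R]_d) :
    'M[R]_d :=
  jac (grad f) x.

Definition twice_differentiable (R : realType) (d : nat)
    (f : 'cV[R]_d -> R) : Prop :=
  (forall x, differentiable (f : 'cV[R]_d -> R^o) x) /\
  (forall x, differentiable (grad f) x).

Definition covmx (R : realType) (dO : measure_display)
    (Omega : measurableType dO) (P : probability Omega R) (d : nat)
    (xi : Omega -> 'cV[R]_d) : 'M[R]_d :=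
  \matrix_(a, b) fine (covariance P (fun w => xi w a 0) (fun w => xi w b 0)).

Definition random_matrix (R : realType) (dO : measure_display)
    (Omega : measurableType dO) (m d : nat) (X : Omega -> 'M[R]_(m, d)) : Prop :=
  forall a b, measurable_fun [set: Omega] (fun w => X w a b).

Definition cvg_in_probability (R : realType) (dO : measure_display)
    (Omega : measurableType dO) (P : probability Omega R) (m d : nat)
    (X : nat -> Omega -> 'M[R]_(m, d)) (X0 : 'M[R]_(m, d)) : Prop :=
  forall eps : R, 0 < eps ->
    (fun k => P [set w | eps <= opnorm (X k w - X0)]) @ \oo --> 0%E.

(* Product sigma-algebra on the space of joint data vectors; the agents'
   data spaces may differ. *)
Definition product_measurable (n : nat) (dZ : 'I_n -> measure_display)
    (Z : forall i, measurableType (dZ i)) : set (set (forall i, Z i)) :=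
  <<s [set E | exists i (A : set (Z i)),
         measurable A /\ E = [set z : forall i, Z i | A (z i)]] >>.

(* The vectors (zetas k i)_i, k = 0, 1, ..., are i.i.d. with the joint law of
   (zeta i)_i. Nothing is assumed on the dependence across i. *)
Definition iid_copies (R : realType) (dO : measure_display)
    (Omega : measurableType dO) (P : probability Omega R) (n : nat)
    (dZ : 'I_n -> measure_display) (Z : forall i, measurableType (dZ i))
    (zeta : forall i, Omega -> Z i) (zetas : nat -> forall i, Omega -> Z i) :
    Prop :=
  (forall (k : nat) (E : set (forall i, Z i)), product_measurable E ->
     P [set w | E (fun i => zetas k i w)] = P [set w | E (fun i => zeta i w)]) /\
  (forall (K : seq nat) (E : nat -> set (forall i, Z i)),
     uniq K -> (forall k, product_measurable (E k)) ->
     P (\bigcap_(k in [set` K]) [set w | E k (fun i => zetas k i w)]) =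
     (\prod_(k <- K) P [set w | E k (fun i => zetas k i w)])%E).

(* Expected cost of each agent and of the network. The expectation is finite by
   the integrability clause of [cost_setting]. *)
Definition local_cost (R : realType) (dO : measure_display)
    (Omega : measurableType dO) (P : probability Omega R) (n d : nat)
    (dZ : 'I_n -> measure_display) (Z : forall i, measurableType (dZ i))
    (g : forall i, 'cV[R]_d -> Z i -> R) (zeta : forall i, Omega -> Z i)
    (i : 'I_n) (x : 'cV[R]_d) : R :=
  fine 'E_P[fun w => g i x (zeta i w)].

Definition total_cost (R : realType) (dO : measure_display)
    (Omega : measurableType dO) (P : probability Omega R) (n d : nat)
    (dZ : 'I_n -> measure_display) (Z : forall i, measurableType (dZ i))
    (g : forall i, 'cV[R]_d -> Z i -> R) (zeta : forall i, Omega -> Z i)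
    (x : 'cV[R]_d) : R :=
  \sum_(i < n) local_cost P g zeta i x.

Definition sgrad (R : realType) (n d : nat) (dZ : 'I_n -> measure_display)
    (Z : forall i, measurableType (dZ i)) (g : forall i, 'cV[R]_d -> Z i -> R)
    (i : 'I_n) (x : 'cV[R]_d) (z : Z i) : 'cV[R]_d :=
  grad (fun y => g i y z) x.

Definition shess (R : realType) (n d : nat) (dZ : 'I_n -> measure_display)
    (Z : forall i, measurableType (dZ i)) (g : forall i, 'cV[R]_d -> Z i -> R)
    (i : 'I_n) (x : 'cV[R]_d) (z : Z i) : 'M[R]_d :=
  hess (fun y => g i y z) x.

(* What is implicit in writing f_i(x) = E[g_i(x; zeta_i)] and in the use of
   second derivatives of g_i(. ; zeta_i). *)
Record cost_setting (R : realType) (dO : measure_display)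
    (Omega : measurableType dO) (P : probability Omega R) (n d : nat)
    (dZ : 'I_n -> measure_display) (Z : forall i, measurableType (dZ i))
    (g : forall i, 'cV[R]_d -> Z i -> R) (zeta : forall i, Omega -> Z i) :
    Prop := CostSetting {
  cost_measurable : forall i (x : 'cV[R]_d), measurable_fun [set: Z i] (g i x) ;
  cost_integrable : forall i (x : 'cV[R]_d),
    P.-integrable [set: Omega] (EFin \o (fun w => g i x (zeta i w))) ;
  cost_twice_differentiable : forall i (z : Z i),
    twice_differentiable (fun x => g i x z)
}.

Record objective_assumption (R : realType) (dO : measure_display)
    (Omega : measurableType dO) (P : probability Omega R) (n d : nat)
    (dZ : 'I_n -> measure_display) (Z : forall i, measurableType (dZ i))
    (g : forall i, 'cV[R]_d -> Z i -> R) (zeta : forall i, Omega -> Z i)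
    (xstar : 'cV[R]_d) (mu c p U1 : R) (Lip : forall i, Z i -> R) :
    Prop := ObjectiveAssumption {
  obj_mu_gt0 : 0 < mu ;
  obj_differentiable : forall x : 'cV[R]_d,
    differentiable (total_cost P g zeta : 'cV[R]_d -> R^o) x ;
  obj_strongly_convex : forall x y : 'cV[R]_d,
    total_cost P g zeta x + dot (grad (total_cost P g zeta) x) (y - x)
      + mu / 2 * enorm (x - y) ^+ 2 <= total_cost P g zeta y ;
  obj_c_gt0 : 0 < c ;
  obj_hess_approx : forall x : 'cV[R]_d,
    enorm (grad (total_cost P g zeta) x
           - hess (total_cost P g zeta) xstar *m (x - xstar))
      <= c * enorm (x - xstar) ^+ 2 ;
  obj_p_gt2 : 2 < p ;
  obj_U1_gt0 : 0 < U1 ;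
  obj_noise_moment : forall i (x : 'cV[R]_d),
    ('E_P[fun w => (enorm (sgrad g x (zeta i w)
                           - grad (local_cost P g zeta i) x) `^ p)%R]
       <= (U1 `^ (p / 2))%:E)%E ;
  obj_Lip_measurable : forall i, measurable_fun [set: Z i] (Lip i) ;
  obj_Lip_gt0 : forall i (z : Z i), 0 < Lip i z ;
  obj_lipschitz : forall i (x y : 'cV[R]_d),
    {ae P, forall w, enorm (sgrad g x (zeta i w) - sgrad g y (zeta i w))
                       <= Lip i (zeta i w) * enorm (x - y)} ;
  obj_Lip_moment : forall i, ('E_P[fun w => (Lip i (zeta i w) `^ p)%R] < +oo)%E
}.

Definition lip_const (R : realType) (dO : measure_display)
    (Omega : measurableType dO) (P : probability Omega R) (n : nat)
    (dZ : 'I_n -> measure_display) (Z : forall i, measurableType (dZ i))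
    (zeta : forall i, Omega -> Z i) (Lip : forall i, Z i -> R) : R :=
  \big[Num.max/0]_(i < n)
    Num.sqrt (fine 'E_P[fun w => (Lip i (zeta i w) ^+ 2)%R]).

(* [induced_graph M j i] is the edge from j to i. *)
Definition induced_graph (R : realType) (n : nat) (M : 'M[R]_n) : rel 'I_n :=
  fun j i => 0 < M i j.

(* t is a spanning arborescence of e, directed away from its root r. *)
Definition spanning_tree (n : nat) (e t : rel 'I_n) (r : 'I_n) : Prop :=
  [/\ subrel t e,
      forall j, ~~ t j r,
      forall i, i != r -> exists! j, t j i
    & forall i, connect t r i].

Definition is_root (n : nat) (e : rel 'I_n) (r : 'I_n) : Prop :=
  exists t, spanning_tree e t r.

Definition strongly_connected (n : nat) (e : rel 'I_n) : Prop :=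
  forall i j, connect e i j.

Definition row_stochastic (R : realType) (n : nat) (M : 'M[R]_n) : Prop :=
  (forall i j, 0 <= M i j) /\ M *m const_mx 1 = const_mx 1 :> 'cV[R]_n.

Definition col_stochastic (R : realType) (n : nat) (M : 'M[R]_n) : Prop :=
  (forall i j, 0 <= M i j) /\ const_mx 1 *m M = const_mx 1 :> 'rV[R]_n.

Record network_assumption (R : realType) (n : nat) (A B : 'M[R]_n) :
    Prop := NetworkAssumption {
  net_A_stochastic : row_stochastic A ;
  net_B_stochastic : col_stochastic B ;
  net_A_diag : forall i, 0 < A i i ;
  net_B_diag : forall i, 0 < B i i ;
  net_A_tree : exists r, is_root (induced_graph A) r ;
  net_B_tree : exists r, is_root (induced_graph B^T) r ;
  net_common_root : exists r,
    is_root (induced_graph A) r /\ is_root (induced_graph B^T) r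
}.

Definition left_perron (R : realType) (n : nat) (A : 'M[R]_n)
    (u : 'cV[R]_n) : Prop :=
  [/\ forall i, 0 <= u i 0, u^T *m A = u^T & dot u (const_mx 1) = n%:R].

Definition right_perron (R : realType) (n : nat) (B : 'M[R]_n)
    (v : 'cV[R]_n) : Prop :=
  [/\ forall i, 0 <= v i 0, B *m v = v & dot (const_mx 1) v = n%:R].

Record SAB_iteration (R : realType) (Omega : Type) (n d : nat)
    (dZ : 'I_n -> measure_display) (Z : forall i, measurableType (dZ i))
    (g : forall i, 'cV[R]_d -> Z i -> R) (zetas : nat -> forall i, Omega -> Z i)
    (A B : 'M[R]_n) (alpha : nat -> R) (x0 : 'I_n -> 'cV[R]_d)
    (x y : 'I_n -> nat -> Omega -> 'cV[R]_d) : Prop := SABIteration {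
  SAB_x0 : forall i w, x i 0%N w = x0 i ;
  SAB_y0 : forall i w, y i 0%N w = sgrad g (x i 0%N w) (zetas 0%N i w) ;
  SAB_x : forall i k w,
    x i k.+1 w = \sum_(j < n) A i j *: x j k w - alpha k *: y i k w ;
  SAB_y : forall i k w,
    y i k.+1 w = \sum_(j < n) B i j *: y j k w
                 + sgrad g (x i k.+1 w) (zetas k.+1 i w)
                 - sgrad g (x i k w) (zetas k i w)
}.

Record plug_in_method (R : realType) (Omega : Type) (n d : nat)
    (dZ : 'I_n -> measure_display) (Z : forall i, measurableType (dZ i))
    (g : forall i, 'cV[R]_d -> Z i -> R) (zetas : nat -> forall i, Omega -> Z i)
    (A : 'M[R]_n) (x : 'I_n -> nat -> Omega -> 'cV[R]_d)
    (uk : 'I_n -> nat -> 'cV[R]_n) (H S : 'I_n -> nat -> Omega -> 'M[R]_d) :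
    Prop := PlugInMethod {
  plug_u0 : forall i, uk i 0%N = delta_mx i 0 ;
  plug_H0 : forall i w, H i 0%N w = 0 ;
  plug_S0 : forall i w, S i 0%N w = 0 ;
  plug_u : forall i k, (0 < k)%N ->
    uk i k = \sum_(j < n) A i j *: uk j k.-1 ;
  plug_S : forall i k w, (0 < k)%N ->
    let G l := sgrad g (x i l w) (zetas l i w) in
    S i k w = (k%:R / k.+1%:R) *: (\sum_(j < n) A i j *: S j k.-1 w)
      + (2 * k.+1%:R * uk i k i 0)^-1 *:
          (G k *m (G k - G k.-1)^T + (G k - G k.-1) *m (G k)^T) ;
  plug_H : forall i k w, (0 < k)%N ->
    H i k w = (k%:R / k.+1%:R) *: (\sum_(j < n) A i j *: H j k.-1 w)
      + (k.+1%:R * uk i k i 0)^-1 *: shess g (x i k w) (zetas k i w)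
}.

(* Main.v *)
(* Write [pi = u / n].  By Doeblin's argument [A^k -> 1 pi^T] and
   [B^k -> v 1^T / n] geometrically.  The tracker is
   [y_k = v Gbar_k + p_{k+1} - p_k], where [p_k] is a geometrically fading memory
   of the gradient samples and [Gbar_k] their average, so
   [z_k = pi^T x_k + alpha_k pi^T p_k] performs a stochastic gradient step of
   size [alpha_k pi^T v], up to consensus errors and terms of order [alpha_k^2].
   Conditionally on the past, strong monotonicity gives coupled recursions for
   [E|z - x*|^2], the consensus error and [E|p|^2]; a Lyapunov function drives
   them to 0, so [x_{i,k} -> x*] in mean square.

   In the Cesaro averages defining [H] and [S] the samples may therefore be
   replaced, in L1, by samples at [x*], for which laws of large numbers hold; the
   lagged product [grad g_k (grad g_{k-1})^T] averages to [m m^T] with [m] the mean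
   gradient, which turns the second moment into a covariance.  The weight
   [(A^{k-1-l})_ij / (A^{l+1})_jj] of a sample is [1 + O(rho^l + rho^{k-l})], so
   [H_{i,k}] and [S_{i,k}] converge in mean to the sums over all agents, and
   [(H, S) |-> H^-1 S H^-1] is continuous at an invertible [H]. *)

(* The gradient noise does not vanish, so the tracker never settles and its fluctuation enters the
   iterates at order alpha_k. Adding alpha_k pi^T p_k removes it by summation by parts: what is left
   of the memory carries the factor alpha_k - alpha_{k+1} = O(alpha_k^2). Since p_k involves only
   samples before time k, z_k is still a function of the past, and the fresh samples average against
   z_k - x* without bias.

   The obstacle is circularity: second moments of the samples are controlled only through the
   distance of the iterates to x*, which is what has to be shown small, and the memory carries these
   moments forward. Hence a joint recursion instead of successive bounds. The pathwise part is
   deterministic, with scalar majorants that obey exact one-step recursions; expectations are taken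
   afterwards.

   Conditional expectations are replaced by Fubini on the product of the past sigma-algebra with the
   law of one sample. As the samples are evaluated at random points, almost sure properties of g
   must hold at all points simultaneously and maps must be jointly measurable; approximation of
   points by countable lattices provides both. *)
From HB Require Import structures.
Require Import Defs.
From mathcomp Require Import perm measurable_realfun ring lra.

Set Implicit Arguments.
Unset Strict Implicit.
Unset Printing Implicit Defensive.

Local Open Scope classical_set_scope.
Local Open Scope ring_scope.

(** * Geometric ergodicity of stochastic matrices *)

Lemma row_stochastic_sum (R : realType) (n : nat) (W : 'M[R]_n) :
  row_stochastic W -> forall i, \sum_j W i j = 1.
Proof.
move=> [_ /matrixP W1] i; have := W1 i 0; rewrite !mxE.
by move=> W1i; rewrite -[RHS]W1i; apply: eq_bigr => j _; rewrite mxE mulr1.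
Qed.

Lemma row_stochasticP (R : realType) (n : nat) (W : 'M[R]_n) :
  (forall i j, 0 <= W i j) -> (forall i, \sum_j W i j = 1) -> row_stochastic W.
Proof.
move=> W0 W1; split => //; apply/matrixP => i j; rewrite !mxE.
by rewrite -[RHS](W1 i); apply: eq_bigr => l _; rewrite mxE mulr1.
Qed.

Lemma row_stochasticM (R : realType) (n : nat) (V W : 'M[R]_n) :
  row_stochastic V -> row_stochastic W -> row_stochastic (V *m W).
Proof.
move=> [V0 V1] [W0 W1]; split; last by rewrite -mulmxA W1.
by move=> i j; rewrite mxE sumr_ge0// => l _; rewrite mulr_ge0.
Qed.

Lemma row_stochasticX (R : realType) (n : nat) (W : 'M[R]_n) k :
  row_stochastic W -> row_stochastic (W ^+ k).
Proof.
move=> sW; elim: k => [|k IH]; last by rewrite exprS; apply: row_stochasticM.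
split; last by rewrite expr0 mul1mx.
by move=> i j; rewrite expr0 mxE; case: (_ == _) => /=; rewrite ?mulr1n ?mulr0n.
Qed.

Lemma row_stochastic_le1 (R : realType) (n : nat) (W : 'M[R]_n) i j :
  row_stochastic W -> W i j <= 1.
Proof.
move=> sW; rewrite -(row_stochastic_sum sW i) (bigD1 j)//= lerDl sumr_ge0//.
by move=> l _; case: sW.
Qed.

(* Doeblin minorization: [W = eps 1 e_r^T + (1 - eps) W'] with [W'] row
   stochastic, and a matrix [J] killing the vector 1 only sees [W']. *)
Lemma doeblin_power (R : realType) (n : nat) (W J : 'M[R]_n) (eps : R) r t :
  row_stochastic W -> 0 < eps < 1 -> (forall i, eps <= W i r) ->
  (forall i, \sum_j J i j = 0) ->
  exists2 W' : 'M[R]_n, row_stochastic W' & J *m W ^+ t = (1 - eps) ^+ t *: (J *m W').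
Proof.
move=> sW /andP[e0 e1] Wr J0.
have [W' [W'0 W'1 WE]] : exists W' : 'M[R]_n, [/\ forall i j, 0 <= W' i j,
    forall i, \sum_j W' i j = 1 &
    forall i j, W i j = eps * (j == r)%:R + (1 - eps) * W' i j].
  have e1' : 1 - eps != 0 by rewrite subr_eq0 gt_eqF.
  exists (\matrix_(i, j) ((W i j - eps * (j == r)%:R) / (1 - eps))); split.
  - move=> i j; rewrite mxE divr_ge0// ?subr_ge0 ?(ltW e1)//.
    have [->|_] := eqVneq j r; first by rewrite mulr1.
    by rewrite mulr0; case: sW.
  - move=> i; under eq_bigr do rewrite mxE.
    rewrite -mulr_suml sumrB row_stochastic_sum// -mulr_sumr.
    by rewrite (bigD1 r)//= eqxx big1 ?addr0 ?mulr1 ?divff// => j /negbTE ->.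
  - by move=> i j; rewrite mxE [(1 - eps) * _]mulrC divfK// addrC subrK.
have sW' : row_stochastic W' by exact: row_stochasticP.
have WmE : W = eps *: (\matrix_(i, j) (j == r)%:R) + (1 - eps) *: W'.
  by apply/matrixP => i j; rewrite !mxE WE.
exists (W' ^+ t); first exact: row_stochasticX.
elim: t => [|t IH]; first by rewrite !expr0 scale1r.
have Kill : J *m W' ^+ t *m (\matrix_(i, j) (j == r)%:R : 'M[R]_n) = 0.
  apply/matrixP => i j; rewrite mxE [RHS]mxE.
  under eq_bigr do rewrite [X in _ * X]mxE.
  rewrite -mulr_suml [X in X * _](_ : _ = 0) ?mul0r//.
  under eq_bigr do rewrite mxE.
  rewrite exchange_big/=; under eq_bigr do rewrite -mulr_sumr.
  by under eq_bigr do rewrite (row_stochastic_sum (row_stochasticX t sW')) mulr1.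
rewrite [W ^+ _]exprSr -[W ^+ t * W]/(W ^+ t *m W) mulmxA IH -scalemxAl.
rewrite [in X in _ *: (_ *m X)]WmE mulmxDr -!scalemxAr Kill scaler0 add0r.
by rewrite scalerA -exprSr -mulmxA -[W' ^+ t *m W']/(W' ^+ t * W') -exprSr.
Qed.

(** Starting the minimum at 1/2 keeps the bound below 1, as a Doeblin constant must be, and gives a
    value even when [n = 0]. *)
Lemma fin_pos_lbound (R : realType) (n : nat) (f : 'I_n -> R) :
  (forall i, 0 < f i) -> exists2 e : R, 0 < e < 1 & forall i, e <= f i.
Proof.
move=> f0; exists (\big[Num.min/2^-1]_i f i).
  apply/andP; split; first by apply: lt_bigmin; rewrite ?invr_gt0// => i _.
  by rewrite (@le_lt_trans _ _ 2^-1) ?bigmin_le_id// invf_lt1 ?ltr1n.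
by move=> i; apply: bigmin_le.
Qed.

Lemma bernoulli_ineq (R : realType) (x : R) m :
  0 <= x <= 1 -> 1 - m%:R * x <= (1 - x) ^+ m.
Proof.
move=> /andP[x0 x1]; elim: m => [|m IH]; first by rewrite mul0r subr0 expr0.
rewrite exprSr; apply: le_trans (ler_wpM2r _ IH); last by rewrite subr_ge0.
rewrite -[m.+1]addn1 natrD -subr_ge0.
rewrite (_ : _ - _ = m%:R * x ^+ 2); last by ring.
by rewrite mulr_ge0// sqr_ge0.
Qed.

(** [J = I - 1 pi^T] has zero row sums and [J W^k = W^k - 1 pi^T], so by [doeblin_power] the
    distance to the limit shrinks by [1 - eps] every [m] steps. One positive column [r] of [W^m] is
    enough, which is what a root of the graph provides. *)
Lemma row_stochastic_geometric (R : realType) (n : nat) (W : 'M[R]_n)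
    (pi : 'I_n -> R) m r :
  row_stochastic W -> (forall j, \sum_i pi i * W i j = pi j) ->
  \sum_i pi i = 1 -> (0 < m)%N -> (forall i, 0 < (W ^+ m) i r) ->
  exists C rho : R, [/\ 0 < C, 0 < rho, rho < 1 &
    forall k i j, `|(W ^+ k) i j - pi j| <= C * rho ^+ k].
Proof.
move=> sW piW pi1 m0 Wr.
have piWk k j : \sum_i pi i * (W ^+ k) i j = pi j.
  elim: k j => [|k IH] j.
    rewrite expr0 (bigD1 j)//= mxE eqxx mulr1 big1 ?addr0// => i ij.
    by rewrite mxE (negbTE ij) mulr0.
  under eq_bigr do rewrite exprSr mxE mulr_sumr.
  rewrite exchange_big/= -[RHS]piW; apply: eq_bigr => l _.
  by rewrite -[in RHS]IH mulr_suml; apply: eq_bigr => i _; rewrite mulrA.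
have [eps /[dup] eps01 /andP[e0 e1] Weps] := fin_pos_lbound Wr.
pose J : 'M[R]_n := \matrix_(i, j) ((i == j)%:R - pi j).
have JE k i j : (J *m W ^+ k) i j = (W ^+ k) i j - pi j.
  rewrite mxE; under eq_bigr do rewrite mxE mulrBl.
  rewrite sumrB piWk (bigD1 i)//= eqxx mul1r big1 ?addr0// => l.
  by rewrite eq_sym => /negbTE ->; rewrite mul0r.
have J0 i : \sum_j J i j = 0.
  under eq_bigr do rewrite mxE.
  rewrite sumrB pi1 (bigD1 i)//= eqxx big1 ?addr0 ?subrr// => l.
  by rewrite eq_sym => /negbTE ->.
(* An explicit rate instead of the [m]-th root of [1 - eps]: Bernoulli's inequality gives
   [1 - eps <= rho ^+ m]. The remainder [k %% m] is paid for by the divisor [rho ^+ m] in the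
   constant. *)
pose rho : R := 1 - eps / m%:R.
have m0' : 0 < m%:R :> R by rewrite ltr0n.
have em : eps / m%:R < 1.
  by rewrite ltr_pdivrMr// mul1r (lt_le_trans e1)// ler1n.
have rho0 : 0 < rho by rewrite subr_gt0.
have rho1 : rho < 1 by rewrite gtrBl divr_gt0.
have rhom : 1 - eps <= rho ^+ m.
  have h01 : 0 <= eps / m%:R <= 1 by rewrite divr_ge0 ?(ltW e0)// ltW.
  by have := bernoulli_ineq m h01; rewrite mulrC divfK// gt_eqF.
(* Bounds the absolute row sums of [J], hence the entries of [J V] for stochastic [V]. *)
pose C0 := 1 + \sum_l `|pi l|.
have C01 : 1 <= C0 by rewrite lerDl sumr_ge0.
exists (C0 / rho ^+ m), rho; split => //.
  by rewrite divr_gt0 ?exprn_gt0// (lt_le_trans ltr01).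
move=> k i j; rewrite -JE.
have kE : k = (m * (k %/ m) + k %% m)%N by rewrite mulnC -divn_eq.
rewrite {1}kE exprD exprM -[_ ^+ _ * _]/(_ *m _) mulmxA.
have [W' sW' ->] := doeblin_power (k %/ m) (row_stochasticX m sW) eps01 Weps J0.
rewrite -scalemxAl -mulmxA mxE normrM.
have sV := row_stochasticM sW' (row_stochasticX (k %% m) sW).
set V := W' *m _ in sV *.
have JV : `|(J *m V) i j| <= C0.
  rewrite mxE (le_trans (ler_norm_sum _ _ _))//.
  apply: (@le_trans _ _ (\sum_l ((i == l)%:R + `|pi l|))).
    apply: ler_sum => l _; rewrite normrM mxE.
    apply: le_trans (_ : `|(i == l)%:R - pi l| * 1 <= _).
      apply: ler_wpM2l => //; rewrite ger0_norm ?row_stochastic_le1//.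
      by case: sV.
    by rewrite mulr1 (le_trans (ler_normB _ _))// normr_nat.
  rewrite big_split/= (bigD1 i)//= eqxx big1 ?addr0// => l.
  by rewrite eq_sym => /negbTE ->.
have e1' : 0 <= 1 - eps by rewrite subr_ge0 ltW.
apply: (@le_trans _ _ (C0 * (1 - eps) ^+ (k %/ m))).
  rewrite mulrC; apply: ler_pM => //.
  by rewrite ger0_norm// exprn_ge0.
rewrite -mulrA; apply: ler_wpM2l; first by rewrite (le_trans ler01).
rewrite mulrC ler_pdivlMr ?exprn_gt0//.
have rX0 l : 0 <= rho ^+ l by rewrite exprn_ge0// ltW.
have le1 : (1 - eps) ^+ (k %/ m) <= (rho ^+ m) ^+ (k %/ m) by rewrite lerXn2r ?nnegrE ?rX0.
have le2 : rho ^+ m <= rho ^+ (k %% m).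
  by apply: ler_wiXn2l; rewrite ?(ltW rho0) ?(ltW rho1)// ltnW// ltn_mod.
rewrite [X in _ <= rho ^+ X]kE exprD exprM.
by apply: ler_pM => //; rewrite exprn_ge0.
Qed.

(** The edge from [j] to [i] is the entry [W i j]: each edge appended to a path multiplies on the
    left, so the end point is the row index. *)
Lemma connect_pow_gt0 (R : realType) (n : nat) (W : 'M[R]_n) r i :
  (forall i j, 0 <= W i j) -> connect (induced_graph W) r i ->
  exists k, 0 < (W ^+ k) i r.
Proof.
move=> W0 /connectP[p]; elim/last_ind: p i => [|p l IH] i.
  by move=> _ ->; exists 0%N; rewrite expr0 mxE eqxx.
rewrite rcons_path last_rcons => /andP[pp el] ->.
have [k k0] := IH _ pp erefl; exists k.+1.
rewrite exprS mxE (bigD1 (last r p))//= ltr_wpDr ?mulr_gt0//.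
rewrite sumr_ge0// => j _; rewrite mulr_ge0//.
elim: k {k0} j => [|k IHk] j; first by rewrite expr0 mxE; case: (_ == _).
by rewrite exprS mxE sumr_ge0// => s _; rewrite mulr_ge0.
Qed.

(** A positive diagonal lets a path wait at its end point, so a positive entry stays positive in all
    later powers. This is how one exponent comes to serve all nodes. *)
Lemma diag_pow_gt0 (R : realType) (n : nat) (W : 'M[R]_n) r i k l :
  (forall i j, 0 <= W i j) -> (forall i, 0 < W i i) ->
  (k <= l)%N -> 0 < (W ^+ k) i r -> 0 < (W ^+ l) i r.
Proof.
move=> W0 Wd /subnKC <-; elim: (l - k)%N => [|s IH] h; first by rewrite addn0.
rewrite addnS exprS mxE (bigD1 i)//= ltr_wpDr ?mulr_gt0 ?IH//.
rewrite sumr_ge0// => j _; rewrite mulr_ge0//.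
elim: (k + s)%N j => [|t IHt] j; first by rewrite expr0 mxE; case: (_ == _).
by rewrite exprS mxE sumr_ge0// => u _; rewrite mulr_ge0.
Qed.

Lemma rooted_pow_gt0 (R : realType) (n : nat) (W : 'M[R]_n) r :
  (forall i j, 0 <= W i j) -> (forall i, 0 < W i i) ->
  (forall i, connect (induced_graph W) r i) ->
  exists2 m, (0 < m)%N & forall i, 0 < (W ^+ m) i r.
Proof.
move=> W0 Wd Wr; have [k kP] := choice (fun i => connect_pow_gt0 W0 (Wr i)).
exists (\max_i k i).+1 => // i; apply: diag_pow_gt0 (kP i) => //.
by rewrite ltnW// ltnS; apply: leq_bigmax.
Qed.

(** * Scalar recursions and step sizes *)

Lemma sqr_sum_le (R : realType) (I : finType) (x : I -> R) :
  (\sum_i x i) ^+ 2 <= #|I|%:R * \sum_i x i ^+ 2.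
Proof.
rewrite expr2 mulr_suml.
under eq_bigr do rewrite mulr_sumr.
apply: (@le_trans _ _ (\sum_i \sum_j (x i ^+ 2 + x j ^+ 2) / 2)).
  apply: ler_sum => i _; apply: ler_sum => j _.
  have := sqr_ge0 (x i - x j); rewrite sqrrB -subr_ge0; nra.
under eq_bigr do rewrite -mulr_suml big_split/= sumr_const.
rewrite -mulr_suml big_split/= sumr_const -sumrMnl -[_ *+ _]mulr_natl.
have -> : \sum_i x i ^+ 2 *+ #|I| = #|I|%:R * \sum_i x i ^+ 2.
  by rewrite mulr_sumr; apply: eq_bigr => i _; rewrite mulr_natl.
by rewrite le_eqVlt; apply/orP; left; apply/eqP; field.
Qed.

(** Replaces a convolution with the whole past by a scalar [q] with a one-step recursion, of which
    expectations can be taken. The convolution [r] of [rho] with [s l], the sum of the [|h l j|],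
    satisfies [r' = rho r + s], and its square obeys the recursion of [q] up to the factor
    [n / (1 - rho)]. *)
Lemma geometric_convolution (R : realType) (n : nat) (K : nat -> 'M[R]_n)
    (h : nat -> 'I_n -> R) (C rho : R) (q : nat -> R) :
  0 <= C -> 0 < rho -> rho < 1 ->
  (forall k i j, `|K k i j| <= C * rho ^+ k) -> 0 <= q 0%N ->
  (forall k, rho * q k + \sum_j h k j ^+ 2 <= q k.+1) ->
  forall k i, (\sum_(l < k) \sum_j K (k.-1 - l)%N i j * h l j) ^+ 2 <=
    C ^+ 2 * (n%:R / (1 - rho)) * q k.
Proof.
move=> C0 r0 r1 KC q0 qS k i.
pose s l := \sum_j `|h l j|.
pose r k := \sum_(l < k) rho ^+ (k.-1 - l)%N * s l.
have s0 l : 0 <= s l by exact: sumr_ge0.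
have rk0 m : 0 <= r m.
  by apply: sumr_ge0 => l _; rewrite mulr_ge0// exprn_ge0// ltW.
have r1' : 0 < 1 - rho by rewrite subr_gt0.
have rS m : r m.+1 = rho * r m + s m.
  rewrite /r big_ord_recr/= subnn expr0 mul1r; congr (_ + _).
  rewrite mulr_sumr; apply: eq_bigr => l _; rewrite mulrA -exprS.
  by case: m l => [[]//|m] l; rewrite /= subSn// -ltnS.
have rq m : r m ^+ 2 <= n%:R / (1 - rho) * q m.
  elim: m => [|m IH].
    by rewrite /r big_ord0 expr0n/= mulr_ge0// divr_ge0// ltW.
  (* Convexity of the square at [r m] and [s m / (1 - rho)], with weights [rho] and [1 - rho]. *)
  apply: (@le_trans _ _ (rho * r m ^+ 2 + s m ^+ 2 / (1 - rho))).
    rewrite rS -subr_ge0.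
    rewrite (_ : _ - _ = rho / (1 - rho) * ((1 - rho) * r m - s m) ^+ 2).
      by rewrite mulr_ge0 ?sqr_ge0// divr_ge0 ?ltW.
    by field; rewrite gt_eqF.
  have sm : s m ^+ 2 <= n%:R * \sum_j h m j ^+ 2.
    rewrite (le_trans (sqr_sum_le _))// card_ord ler_wpM2l//.
    by apply: ler_sum => j _; rewrite real_normK// num_real.
  apply: le_trans (ler_wpM2l _ (qS m)); last by rewrite divr_ge0// ltW.
  rewrite mulrDr lerD//.
    by rewrite [leRHS]mulrCA ler_wpM2l// ltW.
  by rewrite [leRHS]mulrAC ler_wpM2r// invr_ge0 ltW.
apply: (@le_trans _ _ ((C * r k) ^+ 2)); last first.
  by rewrite exprMn -mulrA ler_wpM2l// sqr_ge0.
rewrite -real_normK ?num_real// lerXn2r ?nnegrE ?mulr_ge0//.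
rewrite (le_trans (ler_norm_sum _ _ _))// mulr_sumr ler_sum// => l _.
rewrite (le_trans (ler_norm_sum _ _ _))// mulrA mulr_sumr ler_sum// => j _.
by rewrite normrM ler_wpM2r.
Qed.

(** Once [e k <= c * (eps / 2)], the excess [M] of [V] over [eps / 2] satisfies the unperturbed
    recursion, and the divergence of the sum of the [a k] drives it to 0. *)
Lemma contraction_cvg0 (R : realType) (V a e : nat -> R) (c : R) :
  0 < c -> (forall k, 0 <= V k) -> (forall k, 0 < a k) ->
  a @ \oo --> 0 -> (\sum_(l < k) a l) @[k --> \oo] --> +oo ->
  e @ \oo --> 0 ->
  (\forall k \near \oo, V k.+1 <= (1 - c * a k) * V k + a k * e k) ->
  V @ \oo --> 0.
Proof.
move=> c0 V0 a0 acv asum ecv Vrec.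
apply/cvgrPdist_le => eps eps0.
have eps2 : 0 < eps / 2 by rewrite divr_gt0.
have : \forall k \near \oo, [/\ V k.+1 <= (1 - c * a k) * V k + a k * e k,
    e k <= c * (eps / 2) & c * a k <= 1].
  near=> k; split.
  - by near: k.
  - near: k; move/cvgrPdist_le : ecv => /(_ (c * (eps / 2))).
    rewrite mulr_gt0// => /(_ isT); apply: filterS => k.
    by rewrite sub0r normrN; apply: le_trans; exact: ler_norm.
  - near: k; move/cvgrPdist_le : acv => /(_ c^-1).
    rewrite invr_gt0 => /(_ c0); apply: filterS => k.
    rewrite sub0r normrN (ger0_norm (ltW (a0 k))) => akc.
    by rewrite mulrC -ler_pdivlMr// div1r.
move=> [N _ PN].
pose M k := Num.max (V k - eps / 2) 0.
have M0 k : 0 <= M k by rewrite le_max lexx orbT.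
have MS k : (N <= k)%N -> M k.+1 <= (1 - c * a k) * M k.
  move=> /PN[h1 h2 h3]; have ak := a0 k.
  rewrite ge_max mulr_ge0 ?subr_ge0// andbT.
  apply: (@le_trans _ _ ((1 - c * a k) * (V k - eps / 2))); last first.
    by rewrite ler_wpM2l ?subr_ge0// le_max lexx.
  have := ler_wpM2l (ltW ak) h2; nra.
(* Since [(1 - t)(1 + u + t) <= 1 + u] for nonnegative [t] and [u], the product of the contraction
   factors is handled through a partial sum of the step sizes, without exponentials. *)
have MT m : M (N + m)%N * (1 + c * \sum_(l < m) a (N + l)%N) <= M N.
  elim: m => [|m IH]; first by rewrite addn0 big_ord0 mulr0 addr0 mulr1.
  apply: le_trans IH; rewrite addnS big_ord_recr/=.
  set S := \sum_(_ < _) _.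
  have S0 : 0 <= S by rewrite sumr_ge0// => l _; rewrite ltW.
  have [_ _ h3] := PN _ (leq_addr m N).
  have ak := a0 (N + m)%N.
  have cS : 0 <= c * S by rewrite mulr_ge0// ltW.
  have ca : 0 <= c * a (N + m)%N by rewrite mulr_ge0 // ltW.
  apply: (@le_trans _ _ ((1 - c * a (N + m)%N) * M (N + m)%N * (1 + c * (S + a (N + m)%N)))).
    apply: ler_wpM2r; last exact: (MS _ (leq_addr m N)).
    by rewrite addr_ge0// mulrDr addr_ge0.
  rewrite [leLHS]mulrAC [leLHS]mulrC ler_wpM2l// [c * (_ + _)]mulrDr.
  by set t := c * a _ in ca h3 *; set u := c * S in cS *; nra.
have [L _ LP] : \forall k \near \oo, M N / c / (eps / 2) + \sum_(l < N) a l <= \sum_(l < k) a l.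
  by move/cvgryPge : asum; apply.
exists (N + L)%N => // k /=; rewrite sub0r normrN ger0_norm// => Nk.
have kE : k = (N + (k - N))%N by rewrite subnKC// (leq_trans _ Nk)// leq_addr.
have sumE : \sum_(l < k) a l =
    \sum_(l < N) a l + \sum_(l < k - N) a (N + l)%N by rewrite [in LHS]kE big_split_ord.
have := LP k (leq_trans (leq_addl _ _) Nk).
rewrite /= sumE addrC lerD2l => hS.
have := MT (k - N)%N; rewrite -kE.
set S := \sum_(_ < _) _ in hS *.
have hS' : M N <= (eps / 2) * (c * S).
  move: hS; rewrite ler_pdivrMr// ler_pdivrMr//.
  by have -> : eps / 2 * (c * S) = S * (eps / 2) * c by ring.
move=> hM.
have S0 : 0 <= c * S by rewrite mulr_ge0 ?(ltW c0)// sumr_ge0// => l _; rewrite ltW.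
have Mk : M k <= eps / 2.
  rewrite -(@ler_pM2r _ (1 + c * S)); last by rewrite ltr_wpDr.
  by rewrite (le_trans hM)// (le_trans hS')// ler_wpM2l ?(ltW eps2)// lerDr.
have : V k - eps / 2 <= M k by rewrite le_max lexx.
by move/le_trans => /(_ _ Mk); lra.
Unshelve. all: by end_near. Qed.

(** Here [s] is the square root of the step size, so that the weight [a^(3/2)] of [q] is the
    polynomial [s ^+ 3]. The two smallness conditions serve different terms: [c / 2] bounds the
    perturbation of the contraction of [D], while [1 - rho] leaves room in the geometric
    contractions of [w] and [q]. *)
Lemma lyapunov_step (R : realType) (c C rho s s' D w q G D' w' q' : R) :
  0 < c -> 0 <= C -> 0 <= s -> 0 <= s' -> s' <= s -> s <= 1 ->
  (4 * C + 2 * C ^+ 2 + c) * s <= c / 2 ->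
  (4 * C + 2 * C ^+ 2 + c) * s <= 1 - rho ->
  0 <= D -> 0 <= w -> 0 <= q -> 0 <= q' ->
  G <= C * (1 + w + D + (s ^+ 2) ^+ 2 * q) ->
  q' <= rho * q + G ->
  w' <= rho * w + C * (s ^+ 2) ^+ 2 * (G + q) ->
  D' <= (1 - c * s ^+ 2 + C * (s ^+ 2) ^+ 2) * D
     + C * s ^+ 2 * (w + (s ^+ 2) ^+ 2 * q) + C * (s ^+ 2) ^+ 2 * (G + q) ->
  D' + w' + s' ^+ 3 * q' <=
    (1 - c / 2 * s ^+ 2) * (D + w + s ^+ 3 * q) + s ^+ 2 * ((2 * C + 1) * C * s).
Proof.
move=> c0 C0 s0 s0' ss s1 sc sr D0' w0' q0' q0S GS' qS' wS' DS'.
have s30 : s' ^+ 3 * q' <= s ^+ 3 * q' by apply: ler_wpM2r => //; rewrite lerXn2r.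
have s2s : s ^+ 2 <= s by rewrite expr2 ler_piMl.
have s3s : s ^+ 3 <= s by rewrite exprS ler_piMr ?(le_trans s2s).
have s4s : s ^+ 4 <= s by rewrite exprS ler_piMr// (le_trans s3s).
have s5s : s ^+ 5 <= s by rewrite exprS ler_piMr// (le_trans s4s).
have sX m : 0 <= s ^+ m by rewrite exprn_ge0.
(* The total weight with which [G] enters: [C s^4] from [D'], [C s^4] from [w'] and [s^3] from
   [q']. *)
have B0 : 0 <= 2 * C * s ^+ 4 + s ^+ 3.
  by rewrite addr_ge0// !mulr_ge0.
have hG := ler_wpM2l B0 GS'.
have hq := ler_wpM2l (sX 3%N) qS'.
have cD : (1 - c * s ^+ 2 + C * s ^+ 4 + (2 * C * s ^+ 4 + s ^+ 3) * C) * D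
    <= (1 - c / 2 * s ^+ 2) * D.
  apply: ler_wpM2r => //.
  have := ler_wpM2l (sX 2%N) sc; have := sX 2%N; have := C0.
  have : C * s ^+ 2 <= C * s by rewrite ler_wpM2l.
  have : C ^+ 2 * s ^+ 2 <= C ^+ 2 * s by rewrite ler_wpM2l// sqr_ge0.
  move=> h1 h2 _ s20 h3.
  have h4 := ler_wpM2l s20 h1; have h5 := ler_wpM2l s20 h2.
  have h6 : 0 <= s ^+ 2 * (C * s) by rewrite !mulr_ge0.
  have h7 : 0 <= s ^+ 2 * (c * s) by rewrite !mulr_ge0 ?(ltW c0).
  nra.
have cw : (rho + C * s ^+ 2 + (2 * C * s ^+ 4 + s ^+ 3) * C) * w
    <= (1 - c / 2 * s ^+ 2) * w.
  apply: ler_wpM2r => //; move: sr.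
  have : C * s ^+ 2 <= C * s by rewrite ler_wpM2l.
  have : C * s ^+ 3 <= C * s by rewrite ler_wpM2l.
  have : C ^+ 2 * s ^+ 4 <= C ^+ 2 * s by rewrite ler_wpM2l// sqr_ge0.
  have : c * s ^+ 2 <= c * s by rewrite ler_wpM2l// ltW.
  have : 0 <= c * s by rewrite mulr_ge0 // ltW.
  have : 0 <= C * s by rewrite mulr_ge0.
  nra.
have cq : (s ^+ 3 * rho + C * s ^+ 6 + 2 * C * s ^+ 4 + (2 * C * s ^+ 4 + s ^+ 3) * C * s ^+ 4) * q
    <= (1 - c / 2 * s ^+ 2) * (s ^+ 3 * q).
  rewrite [leRHS]mulrA; apply: ler_wpM2r => //.
  have : C * s ^+ 3 <= C * s by rewrite ler_wpM2l.
  have : C * s ^+ 4 <= C * s by rewrite ler_wpM2l.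
  have : C ^+ 2 * s ^+ 5 <= C ^+ 2 * s by rewrite ler_wpM2l// sqr_ge0.
  have : c * s ^+ 2 <= c * s by rewrite ler_wpM2l// ltW.
  have : 0 <= c * s by rewrite mulr_ge0 // ltW.
  move=> h1 h2 h3 h4 h5; move: sr=> sr.
  have : C * s ^+ 3 + 2 * C * s + 2 * C ^+ 2 * s ^+ 5 + C * s ^+ 4 + c / 2 * s ^+ 2 <= 1 - rho by nra.
  move/(ler_wpM2l (sX 3%N)); nra.
have -> : (1 - c / 2 * s ^+ 2) * (D + w + s ^+ 3 * q) + s ^+ 2 * ((2 * C + 1) * C * s)
   = (1 - c / 2 * s ^+ 2) * D + (1 - c / 2 * s ^+ 2) * w +
     (1 - c / 2 * s ^+ 2) * (s ^+ 3 * q) + s ^+ 2 * ((2 * C + 1) * C * s) by ring.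
have cst : 2 * C ^+ 2 * s ^+ 4 <= 2 * C ^+ 2 * s ^+ 3.
  by rewrite ler_wpM2l ?mulr_ge0 ?sqr_ge0// exprS ler_piMl.
nra.
Qed.

(* Lyapunov function [D + w + a^(3/2) q]: the weight of [q] must be negligible
   with respect to [a], and [a^2] negligible with respect to it. *)
Lemma coupled_recursions_cvg0 (R : realType) (D w q G a : nat -> R) (c C rho : R) :
  0 < c -> 0 <= C -> 0 < rho -> rho < 1 ->
  (forall k, 0 <= D k) -> (forall k, 0 <= w k) -> (forall k, 0 <= q k) ->
  (forall k, 0 < a k) -> (forall k, a k.+1 <= a k) ->
  a @ \oo --> 0 -> (\sum_(l < k) a l) @[k --> \oo] --> +oo ->
  (forall k, D k.+1 <= (1 - c * a k + C * a k ^+ 2) * D k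
     + C * a k * (w k + a k ^+ 2 * q k) + C * a k ^+ 2 * (G k + q k)) ->
  (forall k, w k.+1 <= rho * w k + C * a k ^+ 2 * (G k + q k)) ->
  (forall k, q k.+1 <= rho * q k + G k) ->
  (forall k, G k <= C * (1 + w k + D k + a k ^+ 2 * q k)) ->
  (fun k => D k + w k + a k ^+ 2 * q k) @ \oo --> 0.
Proof.
move=> c0 C0 r0 r1 D0 w0 q0 a0 aN acv asum DS wS qS GS.
pose s k := Num.sqrt (a k).
have s0 k : 0 < s k by rewrite sqrtr_gt0.
have sE k : a k = s k ^+ 2 by rewrite sqr_sqrtr// ltW.
have scv : s @ \oo --> 0.
  rewrite -(@sqrtr0 R); apply: (cvg_comp a (@Num.sqrt R) acv).
  exact: sqrt_continuous.
pose V k := D k + w k + s k ^+ 3 * q k.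
pose K := 4 * C + 2 * C ^+ 2 + c.
have K0 : 0 < K by rewrite ltr_wpDl// addr_ge0 ?mulr_ge0 ?sqr_ge0.
have small : \forall k \near \oo, [/\ s k <= 1, K * s k <= c / 2 & K * s k <= 1 - rho].
  near=> k; split.
  - near: k; move/cvgrPdist_le : scv => /(_ 1 ltr01); apply: filterS => k.
    by rewrite sub0r normrN ger0_norm // ltW.
  - near: k; move/cvgrPdist_le : scv => /(_ (c / 2 / K)).
    rewrite !divr_gt0// => /(_ isT); apply: filterS => k.
    by rewrite sub0r normrN ger0_norm ?(ltW (s0 _))// ler_pdivlMr// mulrC.
  - near: k; move/cvgrPdist_le : scv => /(_ ((1 - rho) / K)).
    rewrite divr_gt0 ?subr_gt0// => /(_ isT); apply: filterS => k.
    by rewrite sub0r normrN ger0_norm ?(ltW (s0 _))// ler_pdivlMr// mulrC.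
have Vcv : V @ \oo --> 0.
  apply: (@contraction_cvg0 _ V a (fun k => (2 * C + 1) * C * s k) (c / 2)) => //.
  - by rewrite divr_gt0.
  - by move=> k; rewrite /V !addr_ge0// mulr_ge0 // exprn_ge0// ltW.
  - by rewrite -(mulr0 ((2 * C + 1) * C)); apply: cvgMr.
  near=> k.
  have [s1 sc sr] : [/\ s k <= 1, K * s k <= c / 2 & K * s k <= 1 - rho] by near: k.
  have ss : s k.+1 <= s k by rewrite ler_wsqrtr.
  have := DS k; have := wS k; have := qS k; have := GS k.
  rewrite /V !sE => h1 h2 h3 h4.
  by apply: lyapunov_step sc sr _ _ _ _ h1 h2 h3 h4 => //; exact: ltW.
apply: (@squeeze_cvgr _ _ _ _ (fun=> 0) V) => //; last exact: cvg_cst.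
near=> k.
have [s1 _ _] : [/\ s k <= 1, K * s k <= c / 2 & K * s k <= 1 - rho] by near: k.
apply/andP; split; first by apply: addr_ge0; [exact: addr_ge0|apply: mulr_ge0 => //; exact: sqr_ge0].
rewrite /V; apply: lerD => //; apply: ler_wpM2r => //; rewrite sE.
have -> : (s k ^+ 2) ^+ 2 = s k * s k ^+ 3 by ring.
by rewrite ler_piMl// exprn_ge0// ltW.
Unshelve. all: by end_near. Qed.

Section step_size.
Context (R : realType) (a b alpha : R).
Hypotheses (a0 : 0 < a) (b0 : 0 < b) (al0 : 0 < alpha) (al1 : alpha < 1).
Let t (k : nat) : R := k%:R + b.
Let s (k : nat) : R := a / t k `^ alpha.

Let t0 k : 0 < t k. Proof. by rewrite ltr_wpDl. Qed.
Let p0 k : 0 < t k `^ alpha. Proof. exact: powR_gt0. Qed.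

(** The summand 1 covers [t k < 1], where the power may exceed [t k]. *)
Let powR_le k : t k `^ alpha <= t k + 1.
Proof.
have [t1|t1] := leP 1 (t k).
  by rewrite (le_trans (ler1_powR _ (ltW al1)))// lerDl.
apply: (@le_trans _ _ 1); last by rewrite lerDr ltW.
rewrite -[leRHS](powRr0 (t k)); apply: ger_powR => //; last exact: ltW.
by rewrite t0 ltW.
Qed.

Lemma step_size_gt0 k : 0 < s k. Proof. by rewrite divr_gt0. Qed.

Lemma step_size_nonincreasing k : s k.+1 <= s k.
Proof.
rewrite ler_pM2l// lef_pV2 ?posrE//; apply: ge0_ler_powR; rewrite ?nnegrE ?(ltW (t0 _)) ?(ltW al0)//.
by rewrite /t lerD2r ler_nat.
Qed.

(** As [alpha <= 1], the relative decrease [1 - (t / (t + 1))^alpha] is at most [1 / (t + 1)], hence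
    at most [t^-alpha], which is [s k / a]. This makes the variation of the step sizes a
    second-order quantity. *)
Lemma step_size_diff k : s k - s k.+1 <= a^-1 * s k ^+ 2.
Proof.
have tS : t k.+1 = t k + 1 by rewrite /t -natr1 addrAC.
have tk1 : 0 < t k + 1 by rewrite addr_gt0.
have h : t k / (t k + 1) <= (t k / (t k + 1)) `^ alpha.
  apply: ger1_powR; last exact: ltW.
  by rewrite divr_gt0//= ler_pdivrMr// mul1r lerDl.
have h2 : (t k / (t k + 1)) `^ alpha = t k `^ alpha / t k.+1 `^ alpha.
  rewrite tS powRM ?invr_ge0 ?(ltW tk1) ?(ltW (t0 k))//; congr (_ * _).
  by rewrite -powR_inv1 ?(ltW tk1)// powRAC powR_inv1// powR_ge0.
have h3 : 1 - t k `^ alpha / t k.+1 `^ alpha <= (t k `^ alpha)^-1.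
  rewrite -h2; apply: (@le_trans _ _ (t k + 1)^-1); last first.
    by rewrite lef_pV2 ?posrE.
  rewrite lerBlDr -lerBlDl (le_trans _ h)// le_eqVlt; apply/orP; left; apply/eqP.
  by field; rewrite gt_eqF.
have -> : s k - s k.+1 = s k * (1 - t k `^ alpha / t k.+1 `^ alpha).
  by rewrite /s; field; rewrite !gt_eqF.
have -> : a^-1 * s k ^+ 2 = s k * (t k `^ alpha)^-1.
  by rewrite /s; field; rewrite !gt_eqF.
by apply: ler_wpM2l h3; exact/ltW/step_size_gt0.
Qed.

Lemma step_size_cvg0 : s @ \oo --> 0.
Proof.
apply/cvgrPdist_le => e e0; near=> k.
rewrite sub0r normrN ger0_norm ?(ltW (step_size_gt0 _))//.
rewrite /s ler_pdivrMr// mulrC -ler_pdivrMr//.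
have -> : a / e = ((a / e) `^ alpha^-1) `^ alpha.
  by rewrite -powRrM mulVf ?gt_eqF// powRr1// divr_ge0// ltW.
apply: ge0_ler_powR; rewrite ?nnegrE ?(ltW (t0 _)) ?(ltW al0) ?powR_ge0//.
rewrite /t (@le_trans _ _ k%:R) ?lerDl ?(ltW b0)//.
by near: k; exact: nbhs_infty_ger.
Unshelve. all: by end_near. Qed.

Lemma step_size_dvg : (\sum_(l < k) s l) @[k --> \oo] --> +oo.
Proof.
(* Comparison with the harmonic series: [t^alpha <= t + 1 = l + b + 1 <= (2 + b)(l + 1)]. *)
pose kap := a / (2 + b).
have kap0 : 0 < kap by rewrite divr_gt0// addr_gt0.
have lb l : kap * harmonic l <= s l.
  rewrite /kap /s -mulrA ler_pM2l// /harmonic -invfM lef_pV2 ?posrE//; last first.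
    by rewrite mulr_gt0// addr_gt0.
  rewrite (le_trans (powR_le _))// /t -natr1.
  by have : 0 <= l%:R :> R by []; have := b0; nra.
have hdiv : series (@harmonic R) @ \oo --> +oo.
  apply: nondecreasing_dvgn_lt; last exact: dvg_harmonic.
  by apply: nondecreasing_series => n *; rewrite /harmonic/= invr_ge0.
apply/cvgryPge => A; move/cvgryPge : hdiv => /(_ (A / kap)).
apply: filterS => k; rewrite ler_pdivrMr// => /le_trans; apply.
rewrite /series/= big_mkord mulr_suml; apply: ler_sum => l _.
by rewrite mulrC lb.
Qed.

End step_size.

(** * Expectations *)

Section expectation.
Context (R : realType) (d : measure_display) (T : measurableType d)
  (P : probability T R).
Implicit Types (X Y : T -> R).

Definition itg X : Prop := P.-integrable [set: T] (EFin \o X).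
(** Real valued through [fine], so an infinite integral would read as 0; for this reason [itg]
    travels along with it. *)
Definition Ex X : R := \int[P]_w X w.
Definition sqitg X : Prop :=
  measurable_fun [set: T] X /\ itg (fun w => X w ^+ 2).

Lemma itg_measurable X : itg X -> measurable_fun [set: T] X.
Proof. by move=> /integrableP[/measurable_EFinP]. Qed.

Lemma itg_cst c : itg (fun=> c).
Proof. exact: finite_measure_integrable_cst. Qed.

Lemma itgD X Y : itg X -> itg Y -> itg (fun w => X w + Y w).
Proof. by move=> iX iY; have := integrableD measurableT iX iY. Qed.

Lemma itgB X Y : itg X -> itg Y -> itg (fun w => X w - Y w).
Proof. by move=> iX iY; have := integrableB measurableT iX iY. Qed.

Lemma itgZ c X : itg X -> itg (fun w => c * X w).
Proof. by move=> iX; have := integrableZl measurableT c iX. Qed.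

Lemma itg_sum (I : Type) (s : seq I) (p : pred I) (X : I -> T -> R) :
  (forall i, itg (X i)) -> itg (fun w => \sum_(i <- s | p i) X i w).
Proof.
move=> iX; rewrite (_ : (fun w => _) = (\sum_(i <- s | p i) X i)); last first.
  by apply/funext => w; rewrite fct_sumE.
elim/big_ind : _ => [|f g hf hg|//]; first exact: itg_cst.
exact: itgD.
Qed.

Lemma itg_abs X : itg X -> itg (fun w => `|X w|).
Proof. by move=> iX; exact: integrable_norm. Qed.

Lemma itg_le X Y : measurable_fun [set: T] X -> itg Y ->
  (forall w, `|X w| <= Y w) -> itg X.
Proof.
move=> mX iY XY; apply: (le_integrable measurableT _ _ iY).
  exact/measurable_EFinP.
by move=> w _ /=; rewrite lee_fin (le_trans (XY w))// ler_norm.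
Qed.

Lemma itg_le_ae X Y : measurable_fun [set: T] X -> itg Y ->
  {ae P, forall w, `|X w| <= Y w} -> itg X.
Proof.
move=> mX /integrableP[mY iY] XY; apply/integrableP; split.
  exact/measurable_EFinP.
apply: le_lt_trans iY; apply: ae_ge0_le_integral => //=.
- by apply/measurable_EFinP; exact: measurableT_comp.
- by apply/measurable_EFinP/measurableT_comp => //; exact/measurable_EFinP.
- by apply: filterS XY => w h _ /=; rewrite lee_fin (le_trans h)// ler_norm.
Qed.

Lemma ExE X : itg X -> (Ex X)%:E = (\int[P]_w (X w)%:E)%E.
Proof. by move=> iX; rewrite fineK//; exact: integrable_fin_num. Qed.

Lemma Ex_cst c : Ex (fun=> c) = c.
Proof. transitivity (c * fine (P [set: T])); first exact: Rintegral_cst.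
by rewrite probability_setT mulr1. Qed.

Lemma ExD X Y : itg X -> itg Y -> Ex (fun w => X w + Y w) = Ex X + Ex Y.
Proof. by move=> iX iY; exact: RintegralD. Qed.

Lemma ExB X Y : itg X -> itg Y -> Ex (fun w => X w - Y w) = Ex X - Ex Y.
Proof. by move=> iX iY; exact: RintegralB. Qed.

Lemma ExZ c X : itg X -> Ex (fun w => c * X w) = c * Ex X.
Proof. by move=> iX; exact: RintegralZl. Qed.

Lemma Ex_sum (I : Type) (s : seq I) (p : pred I) (X : I -> T -> R) :
  (forall i, itg (X i)) ->
  Ex (fun w => \sum_(i <- s | p i) X i w) = \sum_(i <- s | p i) Ex (X i).
Proof.
move=> iX; elim: s => [|i s IH].
  by rewrite big_nil -[RHS](Ex_cst 0); congr Ex; apply/funext => w; rewrite big_nil.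
rewrite big_cons -IH; case: ifPn => pi; last first.
  by congr Ex; apply/funext => w; rewrite big_cons (negbTE pi).
rewrite -ExD//; last exact: itg_sum.
by congr Ex; apply/funext => w; rewrite big_cons pi.
Qed.

Lemma Ex_ge0 X : (forall w, 0 <= X w) -> 0 <= Ex X.
Proof. by move=> X0; exact: Rintegral_ge0. Qed.

Lemma Ex_le X Y : itg X -> itg Y -> (forall w, X w <= Y w) -> Ex X <= Ex Y.
Proof. by move=> iX iY XY; apply: le_Rintegral. Qed.

Lemma Ex_abs X : itg X -> `|Ex X| <= Ex (fun w => `|X w|).
Proof. by move=> iX; exact: le_normr_Rintegral. Qed.

Lemma Ex_le_ae X Y : itg X -> itg Y -> (forall w, 0 <= X w) -> (forall w, 0 <= Y w) ->
  {ae P, forall w, X w <= Y w} -> Ex X <= Ex Y.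
Proof.
move=> iX iY X0 Y0 XY; rewrite -lee_fin !ExE//; apply: ae_ge0_le_integral => //=.
- by move=> w _; rewrite lee_fin.
- by case/integrableP : iX.
- by move=> w _; rewrite lee_fin.
- by case/integrableP : iY.
- by apply: filterS XY => w h _; rewrite lee_fin.
Qed.

Lemma sqitg_cst c : sqitg (fun=> c).
Proof. by split; [exact: measurable_cst|exact: itg_cst]. Qed.

Lemma sqitg_mul X Y : sqitg X -> sqitg Y -> itg (fun w => X w * Y w).
Proof.
move=> [mX iX] [mY iY]; apply: itg_le (itgD iX iY) _.
  exact: measurable_funM.
move=> w; rewrite normrM -[X w ^+ 2]real_normK ?num_real//.
rewrite -[Y w ^+ 2]real_normK ?num_real//.
have := normr_ge0 (X w); have := normr_ge0 (Y w); nra.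
Qed.

Lemma sqitg_itg X : sqitg X -> itg X.
Proof.
move=> sX; have := sqitg_mul sX (sqitg_cst 1).
by congr itg; apply/funext => w; rewrite mulr1.
Qed.

Lemma sqitgD X Y : sqitg X -> sqitg Y -> sqitg (fun w => X w + Y w).
Proof.
move=> sX sY; split; first by apply: measurable_funD; [case: sX|case: sY].
have := itgD (itgD sX.2 sY.2) (itgZ 2 (sqitg_mul sX sY)).
by congr itg; apply/funext => w; ring.
Qed.

Lemma sqitgZ c X : sqitg X -> sqitg (fun w => c * X w).
Proof.
move=> [mX iX]; split; first exact: measurable_funM.
have := itgZ (c ^+ 2) iX.
by congr itg; apply/funext => w; ring.
Qed.

Lemma sqitgB X Y : sqitg X -> sqitg Y -> sqitg (fun w => X w - Y w).
Proof.
move=> sX sY; have := sqitgD sX (sqitgZ (-1) sY).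
by congr sqitg; apply/funext => w; rewrite mulN1r.
Qed.

Lemma sqitg_sum (I : Type) (s : seq I) (p : pred I) (X : I -> T -> R) :
  (forall i, sqitg (X i)) -> sqitg (fun w => \sum_(i <- s | p i) X i w).
Proof.
move=> iX; rewrite (_ : (fun w => _) = (\sum_(i <- s | p i) X i)); last first.
  by apply/funext => w; rewrite fct_sumE.
elim/big_ind : _ => [|f g hf hg|//]; first exact: sqitg_cst.
exact: sqitgD.
Qed.

Lemma sqitg_le X Y : measurable_fun [set: T] X -> itg Y ->
  (forall w, X w ^+ 2 <= Y w) -> sqitg X.
Proof.
move=> mX iY XY; split => //; apply: itg_le iY _; first exact: measurable_funX.
by move=> w; rewrite ger0_norm ?sqr_ge0.
Qed.

Lemma sqitg_le_ae X Y : measurable_fun [set: T] X -> itg Y ->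
  {ae P, forall w, X w ^+ 2 <= Y w} -> sqitg X.
Proof.
move=> mX iY XY; split => //; apply: itg_le_ae iY _; first exact: measurable_funX.
by apply: filterS XY => w; rewrite ger0_norm ?sqr_ge0.
Qed.

Lemma Ex_sqr_abs X : sqitg X -> Ex (fun w => `|X w|) ^+ 2 <= Ex (fun w => X w ^+ 2).
Proof.
move=> sX; set m := Ex (fun w => `|X w|).
have iX := itg_abs (sqitg_itg sX).
have : 0 <= Ex (fun w => (`|X w| - m) ^+ 2) by apply: Ex_ge0 => w; exact: sqr_ge0.
rewrite (_ : (fun w => _) = (fun w => (X w ^+ 2 - 2 * m * `|X w|) + m ^+ 2)); last first.
  by apply/funext => w; rewrite -[X w ^+ 2]real_normK ?num_real//; ring.
rewrite ExD ?ExB ?Ex_cst ?ExZ//; [rewrite -/m; nra|exact: sX.2|exact: itgZ| |exact: itg_cst].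
by apply: itgB; [exact: sX.2|exact: itgZ].
Qed.

(** No measurability is asked for: the integral of a nonnegative function is a supremum over the
    simple functions below it. This allows moment bounds on norms and inner integrals to be used
    without proving them measurable. *)
Lemma ge0_le_integral_upper (f g : T -> \bar R) :
  (forall w, 0 <= f w)%E -> (forall w, f w <= g w)%E ->
  (\int[P]_w f w <= \int[P]_w g w)%E.
Proof.
move=> f0 fg; have g0 w : (0 <= g w)%E by exact: le_trans (f0 w) (fg w).
rewrite !ge0_integralTE//; apply: le_ereal_sup => _ [h hf <-].
by exists h => // w; exact: le_trans (hf w) (fg w).
Qed.

Lemma Ex_markov X (eps : R) : itg X -> (forall w, 0 <= X w) -> 0 < eps ->
  (P [set w | (eps <= X w)%R] <= (Ex X / eps)%R%:E)%E.
Proof.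
move=> iX X0 e0.
have mX : measurable_fun [set: T] (EFin \o X) by case/integrableP: iX.
have := le_integral_abse P measurableT mX e0.
under eq_integral do rewrite /= ger0_norm//.
rewrite -ExE// setTI => h.
have sE : [set x | (eps%:E <= `|(EFin \o X) x|)%E] = [set w | eps <= X w].
  by apply/seteqP; split => w /=; rewrite lee_fin ger0_norm.
rewrite sE in h; rewrite EFinM muleC.
rewrite -lee_pdivlMl// in h.
Qed.

End expectation.

(** * Freezing and the filtration of the data *)

Lemma cvg_matrix (R : realType) (m n : nat) (X : nat -> 'M[R]_(m, n)) (M : 'M[R]_(m, n)) :
  (forall a b, (fun k => X k a b) @ \oo --> M a b) -> X @ \oo --> M.
Proof.
move=> Xcv A [/= B BM BA].
have : \forall k \near \oo, forall a b, B a b (X k a b).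
  have := @filter_forall _ _ (fun (a : 'I_m) k => forall b, B a b (X k a b)) \oo _.
  apply => a.
  have := @filter_forall _ _ (fun (b : 'I_n) k => B a b (X k a b)) \oo _.
  by apply => b; apply: Xcv; exact: BM.
by apply: filterS => k; exact: BA.
Qed.

(** Rounding to the lattice of mesh [1 / (N + 1)], kept as an integer: integer matrices form a
    countable type, so events about a rounded state split into countably many pieces. *)
Definition grid (R : realType) (N : nat) (x : R) : int := Num.floor (x * N.+1%:R).

Lemma grid_cvg (R : realType) (x : R) : (fun N => (grid N x)%:~R / N.+1%:R) @ \oo --> x.
Proof.
apply/cvgrPdist_le => e e0; near=> N.
have N0 : 0 < N.+1%:R :> R by [].
have := Num.Theory.floor_itv (x * N.+1%:R); rewrite -/(grid N x).
move=> /andP[h1 h2].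
have h3 : (grid N x)%:~R / N.+1%:R <= x by rewrite ler_pdivrMr.
rewrite ger0_norm ?subr_ge0//.
apply: (@le_trans _ _ (N.+1%:R^-1)); last first.
  near: N; have := @cvg_harmonic R; move/cvgrPdist_le => /(_ e e0).
  by apply: filterS => N; rewrite sub0r normrN ger0_norm ?harmonic_ge0.
rewrite -(ler_pM2r N0) mulrBl divfK ?gt_eqF// mulVf ?gt_eqF//.
by move: h2; rewrite intrD => h2; rewrite lerBlDl ltW.
Unshelve. all: by end_near. Qed.

Definition ungrid (R : realType) (m n : nat) (N : nat) (q : 'M[int]_(m, n)) : 'M[R]_(m, n) :=
  map_mx (fun z => z%:~R / N.+1%:R) q.

Lemma ungrid_cvg (R : realType) (m n : nat) (x : 'M[R]_(m, n)) :
  (fun N => ungrid R N (map_mx (grid N) x)) @ \oo --> x.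
Proof. by apply: cvg_matrix => a b; under eq_fun do rewrite !mxE; exact: grid_cvg. Qed.

Section caratheodory.
Context (R : realType) (d : measure_display) (T : measurableType d) (m n : nat).

(** With [X] rounded to a lattice the map is measurable piece by piece; continuity in the state
    carries this to the limit of vanishing mesh. *)
Lemma measurable_caratheodory (F : 'M[R]_(m, n) -> T -> R) (X : T -> 'M[R]_(m, n)) :
  (forall x, measurable_fun [set: T] (F x)) ->
  (forall t, continuous (F^~ t)) ->
  (forall a b, measurable_fun [set: T] (fun t => X t a b)) ->
  measurable_fun [set: T] (fun t => F (X t) t).
Proof.
move=> mF cF mX.
pose Q N t : 'M[int]_(m, n) := map_mx (grid N) (X t).
pose val N (q : 'M[int]_(m, n)) : 'M[R]_(m, n) := ungrid R N q.
apply: (@measurable_fun_cvg _ _ _ _ (fun N t => F (val N (Q N t)) t)); last first.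
  move=> t _; apply: (cvg_comp (fun N => val N (Q N t)) (F^~ t)); last exact: cF.
  exact: ungrid_cvg.
move=> N _ B mB; rewrite setTI.
have -> : (fun t => F (val N (Q N t)) t) @^-1` B =
    \bigcup_(q in [set: 'M[int]_(m, n)])
      ([set t | Q N t = q] `&` (F (val N q) @^-1` B)).
  apply/seteqP; split => [t /= h|t [q _ [/= <-]]//]; by exists (Q N t).
apply: countable_bigcupT_measurable => [|q]; first exact: countableP.
apply: measurableI; last by rewrite -[X in measurable X]setTI; exact: mF.
have -> : [set t | Q N t = q] = ~` \bigcup_(ab in [set: 'I_m * 'I_n])
    ~` [set t | grid N (X t ab.1 ab.2) = q ab.1 ab.2].
  rewrite setC_bigcup; under eq_bigcapr do rewrite setCK.
  apply/seteqP; split => t /=.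
    by move=> <- [a b] _ /=; rewrite mxE.
  by move=> h; apply/matrixP => a b; rewrite mxE; exact: (h (a, b) I).
apply: measurableC; apply: countable_bigcupT_measurable => [|[a b]].
  exact: countableP.
apply: measurableC => /=.
have -> : [set t | grid N (X t a b) = q a b] =
    (fun t => X t a b * N.+1%:R) @^-1` `[(q a b)%:~R, (q a b + 1)%:~R[%classic.
  apply/seteqP; split => t /=; rewrite in_itv/=.
    by move=> <-; exact: Num.Theory.floor_itv _.
  by move=> h; apply: Num.Theory.floor_def.
rewrite -[X in measurable X]setTI.
by apply: measurable_funM => //; exact: measurable_itv.
Qed.

End caratheodory.

Section freezing.
Context (R : realType) (d : measure_display) (T : measurableType d)
  (P : probability T R) (G : set (set T)) (dZ : measure_display)
  (Z : measurableType dZ) (V V' : {mfun T >-> Z}).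
Hypothesis Gm : <<s G >> `<=` measurable.
Hypothesis indep : forall A B, <<s G >> A -> measurable B ->
  P (A `&` V @^-1` B) = (P A * P (V' @^-1` B))%E.

(** The same set [T] with only the events generated by [G]. Seen through the identity into [F],
    conditioning on [G] becomes a Fubini integral. *)
Let F := g_sigma_algebraType G.

Let idF : T -> F := id.
Let mid : measurable_fun [set: T] idF.
Proof. by move=> _ B mB; rewrite setTI; exact: Gm. Qed.
HB.instance Definition _ := isMeasurableFun.Build _ _ _ _ idF mid.

Let W (w : T) : F * Z := (idF w, V w).
Let mW : measurable_fun [set: T] W.
Proof. by apply/measurable_fun_pairP; split => //; exact: measurable_funP. Qed.
HB.instance Definition _ := isMeasurableFun.Build _ _ _ _ W mW.

Let m1 : probability F R := distribution P (idF : {mfun T >-> F}).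
Let m2 : probability Z R := distribution P V'.

Let joint_law X : measurable X -> (m1 \x m2)%E X = distribution P (W : {mfun T >-> (F * Z)%type}) X.
Proof.
apply: product_measure_unique => A B mA mB.
exact: indep.
Qed.

(** By the independence hypothesis the pair of the identity into [F] and [V] has a product law,
    whose second factor is the law of [V']. Tonelli then integrates the sample out with the
    [G]-measurable argument held fixed. *)
Lemma freezing_ge0 (Psi : F * Z -> \bar R) :
  measurable_fun [set: F * Z] Psi -> (forall x, 0 <= Psi x)%E ->
  (\int[P]_w Psi (w, V w) = \int[P]_w \int[P]_w' Psi (w, V' w'))%E.
Proof.
move=> mPsi Psi0.
transitivity (\int[distribution P (W : {mfun T >-> (F * Z)%type})]_x Psi x)%E.
  by rewrite ge0_integral_distribution.
transitivity (\int[m1 \x m2]_x Psi x)%E.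
  by apply: eq_measure_integral => X mX _; exact/esym/joint_law.
rewrite fubini_tonelli1// ge0_integral_distribution//; last 2 first.
- exact: measurable_fun_fubini_tonelli_F.
- by move=> x; exact: integral_ge0.
apply: eq_integral => w _; rewrite /= /fubini_F ge0_integral_distribution//.
exact: measurableT_comp.
Qed.

(** The signed version. [psi] comes with its defining equation, so that a closed form of the inner
    expectation can be supplied; its integrability is a result of Fubini. *)
Lemma freezing (Psi : F * Z -> R) (psi : F -> R) :
  measurable_fun [set: F * Z] Psi ->
  itg P (fun w => Psi (w, V w)) ->
  (forall w, Ex P (fun w' => Psi (w, V' w')) = psi w) ->
  (forall w, itg P (fun w' => Psi (w, V' w'))) ->
  itg P psi /\ Ex P (fun w => Psi (w, V w)) = Ex P psi.
Proof.
move=> mPsi iPsi psiE iw.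
have mPsi' : measurable_fun [set: F * Z] (EFin \o Psi) by exact/measurable_EFinP.
have i1 : (distribution P (W : {mfun T >-> (F * Z)%type})).-integrable setT (EFin \o Psi).
  by apply: integrable_pushforward.
have i2 : (m1 \x m2)%E.-integrable setT (EFin \o Psi).
  apply/integrableP; split => //; case/integrableP : i1 => _.
  rewrite (eq_measure_integral (m1 \x m2)%E)// => X mX _.
  exact/esym/joint_law.
have iF := integrable_fubini_F i2.
have FE : fubini_F m2 (EFin \o Psi) = EFin \o psi.
  apply/funext => w; rewrite /fubini_F /= integral_distribution//.
  - by rewrite -psiE ExE.
  - by apply: (measurableT_comp mPsi'); exact: pair1_measurable.
  - exact: iw.
rewrite FE in iF.
have ipsi : itg P psi.
  case/integrableP : iF => mpsi; rewrite ge0_integral_distribution//.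
    by move=> h; apply/integrableP; split; [exact: (measurableT_comp mpsi mid)|exact: h].
  exact: measurableT_comp.
split => //; apply: EFin_inj; rewrite !ExE//.
transitivity (\int[distribution P (W : {mfun T >-> (F * Z)%type})]_x (EFin \o Psi) x)%E.
  by rewrite integral_distribution.
transitivity (\int[m1 \x m2]_x (EFin \o Psi) x)%E.
  by apply: eq_measure_integral => X mX _; exact/esym/joint_law.
rewrite -integral12_prod_meas1// FE integral_distribution//.
by case/integrableP : iF.
Qed.

End freezing.

(** * Independence of each sample from its past *)

Section filtration.
Context (R : realType) (dO : measure_display) (Omega : measurableType dO)
  (P : probability Omega R) (n : nat) (dZ : 'I_n -> measure_display)
  (Z : forall i, measurableType (dZ i))
  (zeta : forall i, {RV P >-> Z i}) (zetas : nat -> forall i, {RV P >-> Z i}).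
Hypothesis iid : iid_copies P zeta zetas.

(** Strictly earlier samples only: the iterate of time [k] is measurable for [past k], the sample of
    time [k] is independent of it, and the gradient taken there belongs to [past k.+1]. *)
Definition past (k : nat) : set (set Omega) :=
  [set A | exists l i (B : set (Z i)),
     [/\ (l < k)%N, measurable B & A = zetas l i @^-1` B]].

Definition adapted (k : nat) (X : Omega -> R) : Prop :=
  measurable_fun [set: g_sigma_algebraType (past k)] X.

Lemma past_measurable k : <<s past k >> `<=` measurable.
Proof.
apply: smallest_sub; first exact: sigma_algebra_measurable.
by move=> _ [l [i [B [_ mB ->]]]]; rewrite -[X in measurable X]setTI; exact: measurable_funP.
Qed.

Lemma past_le k l : (k <= l)%N -> <<s past k >> `<=` <<s past l >>.
Proof.
move=> kl; apply: sub_smallest2r; first exact: smallest_sigma_algebra.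
move=> _ [m [i [B [mk mB ->]]]].
by exists m, i, B; split => //; exact: leq_trans kl.
Qed.

Lemma adapted_le k l X : (k <= l)%N -> adapted k X -> adapted l X.
Proof. by move=> kl aX mT B mB; apply: (past_le kl); exact: aX. Qed.

Lemma adapted_measurable k X : adapted k X -> measurable_fun [set: Omega] X.
Proof. by move=> aX mT B mB; apply: (@past_measurable k); exact: aX. Qed.

Lemma adapted_zetas k i (phi : Z i -> R) : measurable_fun [set: Z i] phi ->
  adapted k.+1 (fun w => phi (zetas k i w)).
Proof.
move=> mphi _ B mB; apply: sub_sigma_algebra.
exists k, i, (phi @^-1` B); split => //.
  by rewrite -[X in measurable X]setTI; exact: mphi.
by rewrite setTI.
Qed.

Let pairing k (w : Omega) : forall i, Z i := fun i => zetas k i w.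

Let pm_sigma : sigma_algebra [set: forall i, Z i] (@product_measurable n dZ Z).
Proof. exact: smallest_sigma_algebra. Qed.

Let pm_setT : product_measurable (Z := Z) setT.
Proof.
by have [_ hC _] := pm_sigma; rewrite -[setT]setD0; apply: hC; case: pm_sigma.
Qed.

Let pm_setI A B : product_measurable (Z := Z) A -> product_measurable (Z := Z) B ->
  product_measurable (Z := Z) (A `&` B).
Proof.
move=> mA mB; have [_ hC hU] := pm_sigma.
have -> : A `&` B = setT `\` \bigcup_j (bigcup2 (setT `\` A) (setT `\` B) j).
  by rewrite bigcup2E !setTD setCU !setCK.
apply: (hC); apply: hU => -[|[|j]] /=; [exact: hC|exact: hC|by case: pm_sigma].
Qed.

Let pm_coord i (B : set (Z i)) : measurable B ->
  product_measurable (Z := Z) [set z | B (z i)].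
Proof. by move=> mB; apply: sub_sigma_algebra; exists i, B. Qed.

Let pm_preimage k E : product_measurable (Z := Z) E -> measurable (pairing k @^-1` E).
Proof.
move: E; apply: smallest_sub => [|_ [i [B [mB ->]]]]; last first.
  rewrite (_ : _ @^-1` _ = zetas k i @^-1` B)//.
  by rewrite -[X in measurable X]setTI; exact: measurable_funP.
split => [|A /= mA|F /= mF].
- by rewrite /= preimage_set0; exact: measurable0.
- by rewrite setTD preimage_setC; exact: measurableC.
- by rewrite preimage_bigcup; exact: bigcup_measurable.
Qed.

(** Cylinders over the joint data vectors of times below [k]. They are closed under intersection,
    generate at least the past, and have the shape to which the product formula of [iid_copies]
    applies. *)
Let cyl k : set (set Omega) := [set A | exists E : nat -> set (forall i, Z i),
  (forall l, product_measurable (Z := Z) (E l)) /\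
  A = \bigcap_(l in [set` iota 0 k]) (pairing l @^-1` E l)].

Let cyl_measurable k : cyl k `<=` measurable.
Proof.
move=> _ [E [mE ->]]; rewrite -[X in measurable X]setCK setC_bigcap.
apply: measurableC; apply: bigcup_measurable => l _.
by apply: measurableC; exact: pm_preimage.
Qed.

Let past_cyl k : <<s past k >> `<=` <<s cyl k >>.
Proof.
apply: sub_smallest2r; first exact: smallest_sigma_algebra.
move=> _ [l [i [B [lk mB ->]]]].
exists (fun m => if m == l then [set z | B (z i)] else setT); split.
  by move=> m; case: ifP => _; [exact: pm_coord|exact: pm_setT].
apply/seteqP; split => w /= h.
  by move=> m _; case: ifPn => // /eqP ->.
by have := h l; rewrite /= mem_iota /= eqxx => /(_ lk).
Qed.

Lemma zetas_law k i (B : set (Z i)) : measurable B ->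
  P (zetas k i @^-1` B) = P (zeta i @^-1` B).
Proof. by move=> mB; apply: (iid.1 k [set z | B (z i)]); exact: pm_coord. Qed.

Let indepC (S B : set Omega) : measurable S -> measurable B ->
  P (S `&` B) = (P S * P B)%E -> P (~` S `&` B) = (P (~` S) * P B)%E.
Proof.
move=> mS mB hS; have -> : ~` S `&` B = B `\` (S `&` B).
  by rewrite setDIr setDv setU0 setDE setIC.
have -> : P (B `\` (S `&` B)) = (P B - P (B `&` (S `&` B)))%E.
  apply: measureD => //; first exact: measurableI.
  by rewrite (le_lt_trans (probability_le1 _ _))// ltry.
rewrite setICA setIid hS probability_setC//.
have := fin_num_measure P _ mS; have := fin_num_measure P _ mB.
move=> /fineK <- /fineK <-; rewrite -EFinM -!EFinB -EFinM; congr EFin; ring.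
Qed.

Let indepU (F : (set Omega)^nat) (B : set Omega) :
  (forall j, measurable (F j)) -> measurable B -> trivIset setT F ->
  (forall j, P (F j `&` B) = (P (F j) * P B)%E) ->
  P (\bigcup_j F j `&` B) = (P (\bigcup_j F j) * P B)%E.
Proof.
move=> mF mB tF hF; have mFB j : measurable (F j `&` B) by exact: measurableI.
have -> : P (\bigcup_j F j) = (\sum_(j <oo) P (F j))%E.
  by rewrite measure_bigcup//; apply: eq_eseriesl => j; rewrite in_setT.
have -> : P (\bigcup_j F j `&` B) = (\sum_(j <oo) P (F j `&` B))%E.
  rewrite setI_bigcupl measure_bigcup//.
    by apply: eq_eseriesl => j; rewrite in_setT.
  apply/trivIsetP => j1 j2 _ _ j12; rewrite setIACA setIid.
  by move/trivIsetP : tF => /(_ j1 j2 I I j12) ->; rewrite set0I.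
rewrite muleC.
rewrite -(fineK (fin_num_measure P _ mB)) -nneseriesZl//.
by apply: eq_eseriesr => j _; rewrite fineK ?fin_num_measure// muleC hF.
Qed.

(** Dynkin induction from the cylinders. Intersecting a cylinder with an event on agent [i] at time
    [k] gives a cylinder over the duplicate-free list [k :: iota 0 k]; other agents at time [k] are
    left unconstrained, so their dependence does not matter. *)
Lemma past_indep k i (A : set Omega) (B : set (Z i)) : <<s past k >> A -> measurable B ->
  P (A `&` zetas k i @^-1` B) = (P A * P (zeta i @^-1` B))%E.
Proof.
move=> /past_cyl pA mB; rewrite -(zetas_law k mB).
set B' := zetas k i @^-1` B.
have mB' : measurable B' by apply: (pm_preimage k (pm_coord mB)).
have cylm : <<s cyl k >> `<=` measurable.
  by apply: smallest_sub; [exact: sigma_algebra_measurable|exact: cyl_measurable].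
move: A pA; apply: (@dynkin_induction _ (g_sigma_algebraType (cyl k)) (cyl k)).
- by [].
- move=> _ _ [E [mE ->]] [E' [mE' ->]]; exists (fun l => E l `&` E' l); split.
    by move=> l; exact: pm_setI.
  apply/seteqP; split => w /=.
    by move=> [h h'] l lk; split; [exact: h|exact: h'].
  by move=> h; split => l lk; have [] := h l lk.
- by rewrite setTI probability_setT mul1e.
- move=> _ [E [mE ->]].
  pose E' l := if l == k then [set z : forall i, Z i | B (z i)] else E l.
  have mE'' l : product_measurable (Z := Z) (E' l).
    by rewrite /E'; case: ifP => _ //; exact: pm_coord.
  have -> : \bigcap_(l in [set` iota 0 k]) (pairing l @^-1` E l) `&` B' =
     \bigcap_(l in [set` k :: iota 0 k]) (pairing l @^-1` E' l).
    apply/seteqP; split => w /=.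
      move=> [h Bw] l /=; rewrite in_cons => /orP[/eqP ->|lk].
        by rewrite /E' eqxx.
      have : (l < k)%N by move: lk; rewrite mem_iota.
      by rewrite /E' ltn_neqAle => /andP[/negbTE -> _]; exact: h.
    move=> h; split; last by have := h k; rewrite /= in_cons eqxx /E' eqxx => /(_ isT).
    move=> l /= lk; have := h l; rewrite /= in_cons lk orbT => /(_ isT).
    have : (l < k)%N by move: lk; rewrite mem_iota.
    by rewrite /E' ltn_neqAle => /andP[/negbTE -> _].
  rewrite [LHS](iid.2 (k :: iota 0 k) E')//; last first.
    by rewrite /= iota_uniq mem_iota ltnn andbF.
  rewrite [X in (X * _)%E](iid.2 (iota 0 k) E)//; last exact: iota_uniq.
  rewrite big_cons muleC; congr (_ * _)%E.
    rewrite big_seq [RHS]big_seq; apply: eq_bigr => l lk.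
    have : (l < k)%N by move: lk; rewrite mem_iota.
    by rewrite /E' ltn_neqAle => /andP[/negbTE -> _].
  by rewrite /E' eqxx.
- by move=> S mS hS; apply: indepC => //; exact: (cylm S mS).
- by move=> F mF tF hF; apply: indepU => // j; exact: (cylm _ (mF j)).
Qed.
End filtration.

(** * Convergence in mean and laws of large numbers *)

Section mean_convergence.
Context (R : realType) (d : measure_display) (T : measurableType d)
  (P : probability T R).

Lemma Ex_dominated (X : nat -> T -> R) (Y g : T -> R) :
  (forall k, measurable_fun [set: T] (X k)) -> measurable_fun [set: T] Y -> itg P g ->
  {ae P, forall w, X ^~ w @ \oo --> Y w} ->
  {ae P, forall w, forall k, `|X k w| <= g w} ->
  itg P Y /\ (fun k => Ex P (X k)) @ \oo --> Ex P Y.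
Proof.
move=> mX mY ig XY Xg.
have [|||||iY _ h] := @dominated_convergence _ T R P setT measurableT
   (fun k w => (X k w)%:E) (fun w => (Y w)%:E) (fun w => (g w)%:E).
- by move=> k; apply/measurable_EFinP.
- exact/measurable_EFinP.
- by apply: filterS XY => w h _; apply/fine_cvgP; split => //; exact: nearW.
- exact: ig.
- by apply: filterS Xg => w h k _; rewrite /= lee_fin.
split => //; apply: fine_cvg.
by rewrite -/(Ex P Y) (ExE iY).
Qed.

Lemma itgBc (X : T -> R) (c : R) : itg P X -> itg P (fun w => X w - c).
Proof. by move=> iX; apply: itgB => //; exact: itg_cst. Qed.

(** L1 convergence to a constant: stable under linear combinations, and sufficient for Markov's
    inequality at the end. *)
Definition cvg_mean1 (X : nat -> T -> R) (m : R) : Prop :=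
  (forall k, itg P (X k)) /\ (fun k => Ex P (fun w => `|X k w - m|)) @ \oo --> 0.

Lemma cvg_mean1_le (X Y : nat -> T -> R) (m l : R) (e : nat -> R) :
  (forall k, itg P (X k)) -> cvg_mean1 Y l -> e @ \oo --> 0 ->
  (\forall k \near \oo, Ex P (fun w => `|X k w - m|) <= Ex P (fun w => `|Y k w - l|) + e k) ->
  cvg_mean1 X m.
Proof.
move=> iX [iY Yl] e0 XY; split => //.
apply: (@squeeze_cvgr _ _ _ _ (fun=> 0) (fun k => Ex P (fun w => `|Y k w - l|) + e k)).
- by apply: filterS XY => k ->; rewrite andbT Ex_ge0.
- exact: cvg_cst.
- by rewrite -[0](addr0 0); apply: cvgD.
Qed.

Lemma cvg_mean1_cst (m : R) : cvg_mean1 (fun _ _ => m) m.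
Proof.
split => [k|]; first exact: itg_cst.
under eq_fun do rewrite subrr normr0 Ex_cst; exact: cvg_cst.
Qed.

Lemma cvg_mean1_dist (X : nat -> T -> R) (m : R) :
  cvg_mean1 X m -> cvg_mean1 (fun k w => `|X k w - m|) 0.
Proof.
move=> [iX Xm]; split => [k|]; first exact/itg_abs/itgBc.
by under eq_fun do under [X in Ex _ X]eq_fun do rewrite subr0 normr_id.
Qed.

Lemma cvg_mean1D (X Y : nat -> T -> R) (m l : R) :
  cvg_mean1 X m -> cvg_mean1 Y l -> cvg_mean1 (fun k w => X k w + Y k w) (m + l).
Proof.
move=> [iX hX] cY; have [iY hY] := cY.
apply: (cvg_mean1_le _ cY hX) => [k|]; first exact: itgD.
apply: nearW => k; rewrite -ExD.
- apply: Ex_le.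
  + by apply: itg_abs; apply: itgBc; exact: itgD.
  + by apply: itgD; apply: itg_abs; exact: itgBc.
  + by move=> w; rewrite [leRHS]addrC opprD addrACA ler_normD.
- by apply: itg_abs; exact: itgBc.
- by apply: itg_abs; exact: itgBc.
Qed.

Lemma cvg_mean1Z (c : R) (X : nat -> T -> R) (m : R) :
  cvg_mean1 X m -> cvg_mean1 (fun k w => c * X k w) (c * m).
Proof.
move=> [iX hX]; split => [k|]; first exact: itgZ.
have -> : (fun k => Ex P (fun w => `|c * X k w - c * m|)) =
    (fun k => `|c| * Ex P (fun w => `|X k w - m|)).
  apply/funext => k; rewrite -ExZ; last by apply: itg_abs; exact: itgBc.
  by congr Ex; apply/funext => w; rewrite -mulrBr normrM.
by rewrite -(mulr0 `|c|); apply: cvgMr.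
Qed.

Lemma cvg_mean1B (X Y : nat -> T -> R) (m l : R) :
  cvg_mean1 X m -> cvg_mean1 Y l -> cvg_mean1 (fun k w => X k w - Y k w) (m - l).
Proof.
move=> cX cY; have := cvg_mean1D cX (cvg_mean1Z (-1) cY).
by rewrite mulN1r; congr cvg_mean1; apply/funext => k; apply/funext => w; rewrite mulN1r.
Qed.

Lemma cvg_mean1_sum (I : Type) (s : seq I) (X : I -> nat -> T -> R) (m : I -> R) :
  (forall i, cvg_mean1 (X i) (m i)) ->
  cvg_mean1 (fun k w => \sum_(i <- s) X i k w) (\sum_(i <- s) m i).
Proof.
move=> cX; elim: s => [|i s IH].
  rewrite big_nil (_ : (fun _ _ => _) = (fun _ _ => 0)); first exact: cvg_mean1_cst.
  by apply/funext => k; apply/funext => w; rewrite big_nil.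
rewrite big_cons (_ : (fun _ _ => _) = (fun k w => X i k w + \sum_(i <- s) X i k w)).
  exact: cvg_mean1D.
by apply/funext => k; apply/funext => w; rewrite big_cons.
Qed.

(** There are [k] terms but the divisor is [k.+1], as in the plug-in recursions, which start from 0
    at time 0. *)
Definition avg (X : nat -> T -> R) (k : nat) (w : T) : R :=
  k.+1%:R^-1 * \sum_(l < k) X l w.

Lemma itg_avg X k : (forall l, itg P (X l)) -> itg P (avg X k).
Proof. by move=> iX; apply: itgZ; apply: itg_sum. Qed.

Lemma Ex_abs_avg_le X k (c : R) : 0 <= c -> (forall l, itg P (X l)) ->
  (forall l, Ex P (fun w => `|X l w|) <= c) -> Ex P (fun w => `|avg X k w|) <= c.
Proof.
move=> c0 iX Xc.
apply: (@le_trans _ _ (Ex P (fun w => k.+1%:R^-1 * \sum_(l < k) `|X l w|))).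
  apply: Ex_le.
  - exact/itg_abs/itg_avg.
  - by apply: itgZ; apply: itg_sum => l; exact: itg_abs.
  - move=> w; rewrite normrM ger0_norm ?invr_ge0// ler_wpM2l ?invr_ge0//.
    exact: ler_norm_sum.
rewrite ExZ; last by apply: itg_sum => l; exact: itg_abs.
rewrite Ex_sum; last by move=> l; exact: itg_abs.
rewrite ler_pdivrMl//; apply: (@le_trans _ _ (\sum_(l < k) c)).
  exact: ler_sum.
by rewrite sumr_const card_ord -[_ *+ _]mulr_natl ler_wpM2r// ler_nat.
Qed.

End mean_convergence.

(** * Limit theorems for the samples *)

Section iid_limits.
Context (R : realType) (dO : measure_display) (Omega : measurableType dO)
  (P : probability Omega R) (n : nat) (dZ : 'I_n -> measure_display)
  (Z : forall i, measurableType (dZ i))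
  (zeta : forall i, {RV P >-> Z i}) (zetas : nat -> forall i, {RV P >-> Z i}).
Hypothesis iid : iid_copies P zeta zetas.

Local Notation adapted := (adapted zetas).
Local Notation F k := (g_sigma_algebraType (past zetas k)).

Lemma adapted_cst k (c : R) : adapted k (fun=> c).
Proof. exact: measurable_cst. Qed.

Lemma adaptedD k X Y : adapted k X -> adapted k Y -> adapted k (fun w => X w + Y w).
Proof. exact: measurable_funD. Qed.

Lemma adaptedB k X Y : adapted k X -> adapted k Y -> adapted k (fun w => X w - Y w).
Proof. exact: measurable_funB. Qed.

Lemma adaptedM k X Y : adapted k X -> adapted k Y -> adapted k (fun w => X w * Y w).
Proof. exact: measurable_funM. Qed.

Lemma adapted_sum k (I : Type) (s : seq I) (p : pred I) (X : I -> Omega -> R) :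
  (forall i, adapted k (X i)) -> adapted k (fun w => \sum_(i <- s | p i) X i w).
Proof.
move=> iX; rewrite (_ : (fun w => _) = (\sum_(i <- s | p i) X i)); last first.
  by apply/funext => w; rewrite fct_sumE.
elim/big_ind : _ => [|f g hf hg|//]; first exact: adapted_cst.
exact: adaptedD.
Qed.

Let indep k i := @past_indep R dO Omega P n dZ Z zeta zetas iid k i.
Let pastm k := @past_measurable R dO Omega P n dZ Z zetas k.

(** Both factors are merely integrable, so the integrability of the product is itself a consequence
    of independence; it is obtained by freezing the absolute value. *)
Lemma indep_mul k i (U : Omega -> R) (phi : Z i -> R) :
  adapted k U -> itg P U -> measurable_fun [set: Z i] phi ->
  itg P (fun w => phi (zeta i w)) ->
  itg P (fun w => U w * phi (zetas k i w)) /\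
  Ex P (fun w => U w * phi (zetas k i w)) = Ex P U * Ex P (fun w => phi (zeta i w)).
Proof.
move=> aU iU mphi iphi.
pose Psi (x : F k * Z i) : R := U x.1 * phi x.2.
have mPsi : measurable_fun [set: F k * Z i] Psi.
  apply: measurable_funM.
    exact: (measurableT_comp aU measurable_fst).
  exact: (measurableT_comp mphi measurable_snd).
have iPsi : itg P (fun w => U w * phi (zetas k i w)).
  apply/integrableP; split.
    apply/measurable_EFinP/measurable_funM; first exact: adapted_measurable aU.
    exact: (measurableT_comp mphi).
  rewrite (_ : (fun x => _) = (fun w => (`|Psi (w, zetas k i w)|)%:E)); last first.
    by apply/funext => w.
  rewrite (freezing_ge0 (@pastm k) (@indep k i) (Psi := fun x => (`|Psi x|)%:E)); last 2 first.
  - by apply/measurable_EFinP; exact: measurableT_comp.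
  - by move=> x; rewrite lee_fin.
  under eq_integral => w _.
    under eq_integral do rewrite /Psi/= normrM EFinM.
    rewrite integralZl//; last exact: itg_abs.
    rewrite -ExE; last exact: itg_abs.
    rewrite -EFinM mulrC.
    over.
  by rewrite -(ExE (itgZ _ (itg_abs iU))) ltry.
split => //.
have [_ ->] := freezing (@pastm k) (@indep k i) mPsi iPsi
  (psi := fun w => Ex P (fun w' => phi (zeta i w')) * U w)
  (fun w => etrans (ExZ (U w) iphi) (mulrC _ _)) (fun w => itgZ (U w) iphi).
by rewrite ExZ// mulrC.
Qed.

Lemma zetas_Ex k i (phi : Z i -> R) : measurable_fun [set: Z i] phi ->
  itg P (fun w => phi (zeta i w)) ->
  itg P (fun w => phi (zetas k i w)) /\
  Ex P (fun w => phi (zetas k i w)) = Ex P (fun w => phi (zeta i w)).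
Proof.
move=> mphi iphi.
have [] := @indep_mul k i (fun=> 1) phi (adapted_cst (k:=k) 1) (itg_cst P 1) mphi iphi.
by rewrite Ex_cst mul1r; under eq_fun do rewrite mul1r.
Qed.

Lemma zetas_sqitg k i (phi : Z i -> R) : measurable_fun [set: Z i] phi ->
  sqitg P (fun w => phi (zeta i w)) ->
  sqitg P (fun w => phi (zetas k i w)) /\
  Ex P (fun w => phi (zetas k i w) ^+ 2) = Ex P (fun w => phi (zeta i w) ^+ 2).
Proof.
move=> mphi [_ iphi].
have [] := @zetas_Ex k i (fun z => phi z ^+ 2) (measurable_funX _ mphi) iphi.
by split => //; split => //; exact: (measurableT_comp mphi).
Qed.

(** Equality of laws transfers a null set only through a measurable event, hence the hypothesis on
    [B]. *)
Lemma zetas_ae k i (B : set (Z i)) : measurable B ->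
  {ae P, forall w, B (zeta i w)} -> {ae P, forall w, B (zetas k i w)}.
Proof.
move=> mB [N [mN PN BN]]; exists (zetas k i @^-1` (~` B)); split => //.
  by rewrite -[X in measurable X]setTI; apply: measurable_funP => //; exact: measurableC.
apply/eqP; rewrite eq_le measure_ge0 andbT -PN.
rewrite [leLHS](zetas_law iid k (measurableC mB)) le_measure// ?inE//.
by rewrite -[X in measurable X]setTI; apply: measurable_funP => //; exact: measurableC.
Qed.

Lemma measurable_frozen (m : nat) k i (Phi : 'cV[R]_m -> Z i -> R) (X : Omega -> 'cV[R]_m) :
  (forall x, measurable_fun [set: Z i] (Phi x)) ->
  (forall z, continuous (Phi^~ z)) ->
  (forall a, adapted k (fun w => X w a 0)) ->
  measurable_fun [set: F k * Z i] (fun x => Phi (X x.1) x.2).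
Proof.
move=> mPhi cPhi aX.
apply: (@measurable_caratheodory R _ (F k * Z i)%type m 1 (fun x p => Phi x p.2) (fun p => X p.1)).
- by move=> x; exact: (measurableT_comp (mPhi x) measurable_snd).
- by move=> p; exact: cPhi.
- by move=> a b; rewrite ord1; exact: (measurableT_comp (aX a) measurable_fst).
Qed.

(** States that the conditional mean of [Phi (X, zeta_k)] given the past is [m X], by testing it
    against a past-measurable [U]. *)
Lemma freezing_state (m : nat) k i (Phi : 'cV[R]_m -> Z i -> R) (X : Omega -> 'cV[R]_m)
    (U : Omega -> R) :
  measurable_fun [set: F k * Z i] (fun x => Phi (X x.1) x.2) ->
  adapted k U -> (forall x, itg P (fun w => Phi x (zeta i w))) ->
  itg P (fun w => U w * Phi (X w) (zetas k i w)) ->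
  let m x := Ex P (fun w' => Phi x (zeta i w')) in
  itg P (fun w => U w * m (X w)) /\
  Ex P (fun w => U w * Phi (X w) (zetas k i w)) = Ex P (fun w => U w * m (X w)).
Proof.
move=> mPhi aU iPhi iUPhi /=.
apply: (freezing (@pastm k) (@indep k i) (Psi := fun x : F k * Z i => U x.1 * Phi (X x.1) x.2)) => //.
- apply: measurable_funM => //.
  exact: (measurableT_comp aU measurable_fst).
- by move=> w /=; rewrite ExZ.
- by move=> w /=; exact: itgZ.
Qed.

(** A moment bound known at every deterministic point passes to a random point that is independent
    of the sample, together with integrability. *)
Lemma freezing_bound (m : nat) k i (Phi : 'cV[R]_m -> Z i -> R) (X : Omega -> 'cV[R]_m)
    (b : 'cV[R]_m -> R) :
  measurable_fun [set: F k * Z i] (fun x => Phi (X x.1) x.2) ->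
  measurable_fun [set: Omega] (fun w => Phi (X w) (zetas k i w)) ->
  (forall x, \int[P]_w (`|Phi x (zeta i w)|)%:E <= (b x)%:E)%E ->
  itg P (fun w => b (X w)) ->
  itg P (fun w => Phi (X w) (zetas k i w)) /\
  Ex P (fun w => `|Phi (X w) (zetas k i w)|) <= Ex P (fun w => b (X w)).
Proof.
move=> mPhi mPhi' hb ib.
have le : (\int[P]_w (`|Phi (X w) (zetas k i w)|)%:E <= (Ex P (fun w => b (X w)))%:E)%E.
  rewrite (freezing_ge0 (@pastm k) (@indep k i) (Psi := fun x : F k * Z i => (`|Phi (X x.1) x.2|)%:E)); last 2 first.
  - by apply/measurable_EFinP; exact: measurableT_comp.
  - by move=> x; rewrite lee_fin.
  rewrite ExE//; apply: ge0_le_integral_upper => w /=.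
    by apply: integral_ge0 => w' _; rewrite lee_fin.
  exact: hb.
have i1 : itg P (fun w => Phi (X w) (zetas k i w)).
  apply/integrableP; split; first exact/measurable_EFinP.
  by apply: le_lt_trans le (ltry _).
by split => //; rewrite -lee_fin ExE//; exact: itg_abs.
Qed.

(** The increments are martingale differences: [Y l] is known before the centred sample it
    multiplies, so cross terms vanish in mean. The offset [s] admits lagged products, since for
    [s = 1] the factor [Y l] may be built from sample [l]. *)
Lemma martingale_square s i (phi : Z i -> R) (Y : nat -> Omega -> R) (C : R) :
  measurable_fun [set: Z i] phi -> sqitg P (fun w => phi (zeta i w)) ->
  (forall l, adapted (l + s)%N (Y l)) -> (forall l, sqitg P (Y l)) ->
  (forall l, Ex P (fun w => Y l w ^+ 2) <= C) ->
  let m := Ex P (fun w => phi (zeta i w)) in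
  let V := Ex P (fun w => (phi (zeta i w) - m) ^+ 2) in
  let D l w := Y l w * (phi (zetas (l + s)%N i w) - m) in
  (forall l, sqitg P (D l)) /\
  forall k, Ex P (fun w => (\sum_(l < k) D l w) ^+ 2) <= k%:R * (C * V).
Proof.
move=> mphi sphi aY sY YC m V D.
pose psi z := phi z - m.
have mpsi : measurable_fun [set: Z i] psi by exact: measurable_funB.
have spsi : sqitg P (fun w => psi (zeta i w)) by apply: sqitgB => //; exact: sqitg_cst.
have Epsi : Ex P (fun w => psi (zeta i w)) = 0.
  by rewrite /psi ExB ?Ex_cst ?subrr//; [exact: sqitg_itg|exact: itg_cst].
have aD l : adapted (l + s)%N.+1 (D l).
  apply: adaptedM; first exact: (adapted_le (leqnSn _)) (aY l).
  exact: (adapted_zetas mpsi).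
have D2 l : itg P (fun w => D l w ^+ 2) /\ Ex P (fun w => D l w ^+ 2) <= C * V.
  have [] := @indep_mul (l + s)%N i (fun w => Y l w ^+ 2) (fun z => psi z ^+ 2).
  - exact: (measurable_funX 2 (aY l)).
  - exact: (sY l).2.
  - exact: (measurable_funX 2 mpsi).
  - exact: spsi.2.
  have -> : (fun w => Y l w ^+ 2 * psi (zetas (l + s)%N i w) ^+ 2) = (fun w => D l w ^+ 2).
    by apply/funext => w; rewrite /D exprMn.
  move=> h ->; split => //; apply: ler_wpM2r => //.
  by apply: Ex_ge0 => w; exact: sqr_ge0.
have sD l : sqitg P (D l).
  by split; [exact: adapted_measurable (aD l)|exact: (D2 l).1].
split => //; elim => [|k IH].
  rewrite mul0r (_ : (fun w => _) = (fun=> 0)) ?Ex_cst//.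
  by apply/funext => w; rewrite big_ord0 expr0n.
pose S w := \sum_(l < k) D l w.
have sS : sqitg P S by apply: sqitg_sum.
have aS : adapted (k + s)%N S.
  by apply: adapted_sum => l; apply: (adapted_le _ (aD l)); rewrite ltn_add2r.
have [iX EX] := @indep_mul (k + s)%N i (fun w => S w * Y k w) psi (adaptedM aS (aY k))
  (sqitg_mul sS (sY k)) mpsi (sqitg_itg spsi).
rewrite Epsi mulr0 in EX.
have -> : (fun w => (\sum_(l < k.+1) D l w) ^+ 2) =
    (fun w => S w ^+ 2 + 2 * (S w * Y k w * psi (zetas (k + s)%N i w)) + D k w ^+ 2).
  by apply/funext => w; rewrite big_ord_recr/= -/(S w) /D -/(psi _); ring.
rewrite ExD; [|by apply: itgD; [exact: sS.2|exact: itgZ]|exact: (D2 k).1].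
rewrite ExD; [|exact: sS.2|exact: itgZ].
by rewrite ExZ// EX mulr0 addr0 -natr1 mulrDl mul1r lerD// (D2 k).2.
Qed.

(** Orthogonality bounds the second moment of the average by [C V / (k + 1)], and the mean absolute
    value is at most its square root. *)
Lemma lln_martingale s i (phi : Z i -> R) (Y : nat -> Omega -> R) (C : R) :
  measurable_fun [set: Z i] phi -> sqitg P (fun w => phi (zeta i w)) ->
  (forall l, adapted (l + s)%N (Y l)) -> (forall l, sqitg P (Y l)) ->
  (forall l, Ex P (fun w => Y l w ^+ 2) <= C) ->
  cvg_mean1 P (avg (fun l w => Y l w * (phi (zetas (l + s)%N i w) -
     Ex P (fun w => phi (zeta i w))))) 0.
Proof.
move=> mphi sphi aY sY YC.
have [sD hS] := martingale_square mphi sphi aY sY YC.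
set m := Ex P (fun w => phi (zeta i w)) in sD hS *.
set V := Ex P (fun w => (phi (zeta i w) - m) ^+ 2) in hS.
pose D l w := Y l w * (phi (zetas (l + s)%N i w) - m).
rewrite -/D in hS *.
have iD l : itg P (D l) by exact: (sqitg_itg (sD l)).
split => [k|]; first exact: itg_avg.
pose e (k : nat) : R := Num.sqrt (C * V * k.+1%:R^-1).
have CV0 : 0 <= C * V.
  rewrite mulr_ge0//; last by apply: Ex_ge0 => w; exact: sqr_ge0.
  by apply: le_trans (YC 0%N); apply: Ex_ge0 => w; exact: sqr_ge0.
apply: (@squeeze_cvgr _ _ _ _ (fun=> 0) e); last 2 first.
- exact: cvg_cst.
- rewrite -(@sqrtr0 R); apply: (cvg_comp _ (@Num.sqrt R)); last exact: sqrt_continuous.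
  by rewrite -(mulr0 (C * V)); apply: cvgMr; exact: cvg_harmonic.
apply: nearW => k; rewrite Ex_ge0//=.
under eq_fun do rewrite subr0.
have sA : sqitg P (avg D k) by apply: sqitgZ; apply: sqitg_sum => l; exact: (sD l).
have k0 : 0 < k.+1%:R :> R by [].
have -> : Ex P (fun w => `|avg D k w|) = Num.sqrt (Ex P (fun w => `|avg D k w|) ^+ 2).
  by rewrite sqrtr_sqr ger0_norm// Ex_ge0.
rewrite /e ler_wsqrtr// (le_trans (Ex_sqr_abs sA))//.
have -> : (fun w => avg D k w ^+ 2) =
    (fun w => k.+1%:R^-1 ^+ 2 * (\sum_(l < k) D l w) ^+ 2).
  by apply/funext => w; rewrite /avg exprMn.
have sS : sqitg P (fun w => \sum_(l < k) D l w) by apply: sqitg_sum => l; exact: (sD l).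
rewrite ExZ; last exact: sS.2.
apply: le_trans (ler_wpM2l (sqr_ge0 _) (hS k)) _.
have -> : k.+1%:R^-1 ^+ 2 * (k%:R * (C * V)) = C * V * k.+1%:R^-1 * (k%:R / k.+1%:R).
  by ring.
apply: ler_piMr; first by rewrite mulr_ge0// invr_ge0.
by rewrite ler_pdivrMr// mul1r ler_nat.
Qed.

Lemma lln_sqitg s i (phi : Z i -> R) :
  measurable_fun [set: Z i] phi -> sqitg P (fun w => phi (zeta i w)) ->
  cvg_mean1 P (avg (fun l w => phi (zetas (l + s)%N i w)))
    (Ex P (fun w => phi (zeta i w))).
Proof.
move=> mphi sphi; set m := Ex _ _.
have := lln_martingale (s := s) (Y := fun _ _ => 1) (C := 1) mphi sphi
  (fun l => adapted_cst 1) (fun l => sqitg_cst P 1) _.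
rewrite expr1n Ex_cst => /(_ (fun=> lexx _)); rewrite -/m => h.
have [iX _] := h.
have iphi l : itg P (fun w => phi (zetas l i w)).
  by have [] := zetas_Ex l mphi (sqitg_itg sphi).
(* The bias [m / (k + 1)] of dividing [k] terms by [k.+1]. *)
apply: (cvg_mean1_le _ h (e := fun k => `|m| * k.+1%:R^-1)).
- by move=> k; apply: itg_avg.
- by rewrite -(mulr0 `|m|); apply: cvgMr; exact: cvg_harmonic.
apply: nearW => k; rewrite -[X in _ + X](Ex_cst P) -ExD; last 2 first.
- by apply/itg_abs/itgBc.
- exact: itg_cst.
apply: Ex_le.
- by apply/itg_abs/itgBc/itg_avg.
- by apply: itgD; [apply/itg_abs/itgBc|exact: itg_cst].
move=> w; rewrite subr0 /avg.
have -> : k.+1%:R^-1 * \sum_(l < k) phi (zetas (l + s)%N i w) - m =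
  k.+1%:R^-1 * \sum_(l < k) 1 * (phi (zetas (l + s)%N i w) - m) - m * k.+1%:R^-1.
  under [X in _ = _ * X - _]eq_bigr do rewrite mul1r.
  rewrite sumrB sumr_const card_ord -mulr_natl mulrBr -natr1.
  have k1 : k%:R + 1 != 0 :> R by rewrite natr1 pnatr_eq0.
  by field.
rewrite (le_trans (ler_normB _ _))// lerD2l normrM [`|k.+1%:R^-1|]ger0_norm ?invr_ge0//.
Qed.

Lemma cvg_trunc (phi : Omega -> R) : itg P phi ->
  (fun M : nat => Ex P (fun w => `|phi w - Num.max (- M%:R) (Num.min (phi w) M%:R)|))
    @ \oo --> 0.
Proof.
move=> iphi; pose t (M : nat) (w : Omega) : R := Num.max (- M%:R) (Num.min (phi w) M%:R).
have mphi := itg_measurable iphi.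
have mt M : measurable_fun [set: Omega] (t M).
  by apply: measurable_maxr => //; exact: measurable_minr.
have tE M w : `|phi w| <= M%:R -> t M w = phi w.
  rewrite ler_norml => /andP[h1 h2]; rewrite /t (min_idPl h2).
  by apply/max_idPr.
have tle M w : `|phi w - t M w| <= `|phi w|.
  have M0 : 0 <= M%:R :> R by [].
  rewrite /t; case: (leP (phi w) M%:R) => h1.
    case: (leP (- M%:R) (phi w)) => h2; first by rewrite subrr normr0.
    by rewrite !ler0_norm; lra.
  by rewrite max_r ?ger0_norm; lra.
rewrite -(Ex_cst P 0).
apply: (Ex_dominated (g := fun w => `|phi w|) _ _ (itg_abs iphi) _ _).2.
- by move=> M; apply: measurableT_comp => //; exact: (measurable_funB mphi (mt M)).
- exact: measurable_cst.
- apply: aeW => w; apply: cvg_near_cst; near=> M.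
  have := tE M w; rewrite /t => ->; rewrite ?subrr ?normr0//; near: M; exact: nbhs_infty_ger.
- by apply: aeW => w M; rewrite normr_id; exact: tle.
Unshelve. all: by end_near. Qed.

(* Truncation reduces the integrable case to [lln_sqitg]. *)
Lemma lln s i (phi : Z i -> R) :
  measurable_fun [set: Z i] phi -> itg P (fun w => phi (zeta i w)) ->
  cvg_mean1 P (avg (fun l w => phi (zetas (l + s)%N i w)))
    (Ex P (fun w => phi (zeta i w))).
Proof.
move=> mphi iphi; set m := Ex _ _.
pose t (M : nat) z : R := Num.max (- M%:R) (Num.min (phi z) M%:R).
have mt M : measurable_fun [set: Z i] (t M).
  by apply: measurable_maxr => //; exact: measurable_minr.
have tM M z : t M z ^+ 2 <= M%:R ^+ 2.
  have M0 : 0 <= M%:R :> R by [].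
  rewrite -[leLHS]real_normK ?num_real// lerXn2r ?nnegrE// ler_norml.
  by rewrite le_max lexx ge_max ge_min lexx orbT andbT/=; lra.
have st M : sqitg P (fun w => t M (zeta i w)).
  apply: (sqitg_le _ (itg_cst P (M%:R ^+ 2))) => //.
  exact: (measurableT_comp (mt M)).
have iz l : itg P (fun w => phi (zetas l i w)) by have [] := zetas_Ex l mphi iphi.
split => [k|]; first exact: itg_avg.
apply/cvgrPdist_le => eps eps0.
have eps3 : 0 < eps / 3 by rewrite divr_gt0.
have [M hM] : exists M : nat, Ex P (fun w => `|phi (zeta i w) - t M (zeta i w)|) <= eps / 3.
  have := cvg_trunc iphi; move/cvgrPdist_le => /(_ _ eps3) [N _ /(_ N (leqnn N))] /=.
  by rewrite sub0r normrN ger0_norm ?Ex_ge0// => h; exists N.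
set e := Ex P (fun w => `|phi (zeta i w) - t M (zeta i w)|) in hM.
have [iM cM] := lln_sqitg s (mt M) (st M).
have iT l : itg P (fun w => t M (zetas l i w)).
  by have [] := zetas_Ex l (mt M) (sqitg_itg (st M)).
move/cvgrPdist_le : cM => /(_ _ eps3); apply: filterS => k.
rewrite !sub0r !normrN (ger0_norm (Ex_ge0 _ _)) // => hk.
rewrite (ger0_norm (Ex_ge0 _ _))//.
set mM := Ex P (fun w => t M (zeta i w)) in hk.
have hm : `|m - mM| <= e.
  rewrite -ExB//; last exact: (sqitg_itg (st M)).
  by apply: Ex_abs; apply: itgB => //; exact: (sqitg_itg (st M)).
pose D l w := phi (zetas (l + s)%N i w) - t M (zetas (l + s)%N i w).
have iD l : itg P (D l) by exact: itgB.
have hD : Ex P (fun w => `|avg D k w|) <= e.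
  apply: Ex_abs_avg_le => // [|l]; first exact: Ex_ge0.
  have [] := @zetas_Ex (l + s)%N i (fun z => `|phi z - t M z|).
  - by apply: measurableT_comp => //; exact: measurable_funB.
  - by apply: itg_abs; apply: itgB => //; exact: (sqitg_itg (st M)).
  - by move=> _ ->.
apply: (@le_trans _ _ (Ex P (fun w => `|avg (fun l w => t M (zetas (l + s)%N i w)) k w - mM|
   + `|avg D k w| + e))).
  apply: Ex_le.
  - by apply/itg_abs/itgBc/itg_avg.
  - apply: itgD (itg_cst _ _); apply: itgD; apply: itg_abs; first exact: itgBc.
    exact: itg_avg.
  - move=> w.
    have -> : avg (fun l w => phi (zetas (l + s)%N i w)) k w =
       avg (fun l w => t M (zetas (l + s)%N i w)) k w + avg D k w.
      by rewrite /avg -mulrDr -big_split/=; congr (_ * _); apply: eq_bigr => l _; rewrite /D; ring.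
    set x := avg _ k w; set y := avg D k w.
    have -> : x + y - m = (x - mM) + y - (m - mM) by ring.
    by rewrite (le_trans (ler_normB _ _))// lerD// ler_normD.
rewrite ExD ?Ex_cst; last 2 first.
- by apply: itgD; apply: itg_abs; [exact: itgBc|exact: itg_avg].
- exact: itg_cst.
rewrite ExD; last 2 first.
- by apply: itg_abs; exact: itgBc.
- by apply: itg_abs; exact: itg_avg.
lra.
Qed.

End iid_limits.

(** * Norms and derivatives *)

Section euclidean_norm.
Context (R : realType).

Lemma enorm_ge0 (d : nat) (v : 'cV[R]_d) : 0 <= enorm v.
Proof. exact: sqrtr_ge0. Qed.

Lemma enorm_sqr (d : nat) (v : 'cV[R]_d) : enorm v ^+ 2 = \sum_a v a 0 ^+ 2.
Proof. by rewrite sqr_sqrtr// sumr_ge0// => a _; exact: sqr_ge0. Qed.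

Lemma enorm_le (d : nat) (v : 'cV[R]_d) (c : R) : 0 <= c ->
  \sum_a v a 0 ^+ 2 <= c ^+ 2 -> enorm v <= c.
Proof.
by move=> c0 h; rewrite -(@ler_pXn2r _ 2)// ?nnegrE ?enorm_ge0// enorm_sqr.
Qed.

Lemma coord_le_enorm (d : nat) (v : 'cV[R]_d) a : `|v a 0| <= enorm v.
Proof.
rewrite -sqrtr_sqr ler_wsqrtr// (bigD1 a)//= lerDl sumr_ge0// => b _.
exact: sqr_ge0.
Qed.

Lemma enorm_le_sum (d : nat) (v : 'cV[R]_d) : enorm v <= \sum_a `|v a 0|.
Proof.
have s0 : 0 <= \sum_a `|v a 0| by exact: sumr_ge0.
apply: enorm_le => //; rewrite expr2 mulr_suml ler_sum// => a _.
rewrite -real_normK ?num_real// expr2 ler_wpM2l//.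
by rewrite (bigD1 a)//= lerDl sumr_ge0.
Qed.

Lemma cauchy_schwarz (I : finType) (x y : I -> R) :
  (\sum_i x i * y i) ^+ 2 <= (\sum_i x i ^+ 2) * (\sum_i y i ^+ 2).
Proof.
have h : 0 <= \sum_i \sum_j (x i * y j - x j * y i) ^+ 2.
  by apply: sumr_ge0 => i _; apply: sumr_ge0 => j _; exact: sqr_ge0.
have hE : \sum_i \sum_j (x i * y j - x j * y i) ^+ 2 =
   2 * ((\sum_i x i ^+ 2) * (\sum_i y i ^+ 2) - (\sum_i x i * y i) ^+ 2).
  transitivity (\sum_i \sum_j (x i ^+ 2 * y j ^+ 2) + \sum_i \sum_j (x j ^+ 2 * y i ^+ 2)
     - 2 * \sum_i \sum_j ((x i * y i) * (x j * y j))).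
    rewrite mulr_sumr -big_split/= -sumrB; apply: eq_bigr => i _.
    rewrite mulr_sumr -big_split/= -sumrB; apply: eq_bigr => j _; ring.
  rewrite [X in _ + X - _]exchange_big/= expr2.
  have -> : \sum_i \sum_j (x i ^+ 2 * y j ^+ 2) = (\sum_i x i ^+ 2) * (\sum_i y i ^+ 2).
    by rewrite mulr_suml; apply: eq_bigr => i _; rewrite mulr_sumr.
  have -> : \sum_i \sum_j ((x i * y i) * (x j * y j)) = (\sum_i x i * y i) * (\sum_i x i * y i).
    by rewrite mulr_suml; apply: eq_bigr => i _; rewrite mulr_sumr.
  by ring.
by move: h; rewrite hE; lra.
Qed.

Lemma enormD (d : nat) (v w : 'cV[R]_d) : enorm (v + w) <= enorm v + enorm w.
Proof.
apply: enorm_le; first by rewrite addr_ge0 ?enorm_ge0.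
rewrite sqrrD !enorm_sqr.
have -> : \sum_a (v + w) a 0 ^+ 2 =
    \sum_a v a 0 ^+ 2 + 2 * \sum_a v a 0 * w a 0 + \sum_a w a 0 ^+ 2.
  by rewrite mulr_sumr -!big_split/=; apply: eq_bigr => a _; rewrite mxE; ring.
have := cauchy_schwarz (fun a => v a 0) (fun a => w a 0).
rewrite -!enorm_sqr -exprMn => h.
have : \sum_a v a 0 * w a 0 <= enorm v * enorm w.
  apply: le_trans (ler_norm _) _.
  by rewrite -(@ler_pXn2r _ 2)// ?nnegrE ?mulr_ge0 ?enorm_ge0// real_normK// num_real.
by rewrite -mulr_natl; lra.
Qed.

Lemma enorm0 (d : nat) : enorm (0 : 'cV[R]_d) = 0.
Proof. by rewrite /enorm big1 ?sqrtr0// => a _; rewrite mxE expr0n. Qed.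

Lemma enormN (d : nat) (v : 'cV[R]_d) : enorm (- v) = enorm v.
Proof. by congr Num.sqrt; apply: eq_bigr => a _; rewrite mxE sqrrN. Qed.

Lemma enorm_eq0 (d : nat) (v : 'cV[R]_d) : enorm v = 0 -> v = 0.
Proof.
move=> v0; apply/matrixP => a b; rewrite ord1 mxE; apply/normr0_eq0/eqP.
by rewrite eq_le normr_ge0 andbT -v0 coord_le_enorm.
Qed.

Let l1 (m d : nat) (M : 'M[R]_(m, d)) : R := \sum_a \sum_b `|M a b|.

Lemma enorm_mulmx_le (m d : nat) (M : 'M[R]_(m, d)) v : enorm v <= 1 ->
  enorm (M *m v) <= l1 M.
Proof.
move=> v1; apply: le_trans (enorm_le_sum _) _; apply: ler_sum => a _.
rewrite mxE (le_trans (ler_norm_sum _ _ _))// ler_sum// => b _.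
by rewrite normrM ler_piMr// (le_trans (coord_le_enorm _ _)).
Qed.

Let opset (m d : nat) (M : 'M[R]_(m, d)) :=
  [set enorm (M *m v) | v in [set v : 'cV[R]_d | enorm v <= 1]].

(** [sup] is meaningful only on nonempty sets that are bounded above; every use of [opnorm] rests on
    this. *)
Let opset_sup (m d : nat) (M : 'M[R]_(m, d)) : has_sup (opset M).
Proof.
split; first by exists (enorm (M *m 0)), 0; rewrite //= enorm0.
by exists (l1 M) => _ [v v1 <-]; exact: enorm_mulmx_le.
Qed.

Lemma opnorm_ge (m d : nat) (M : 'M[R]_(m, d)) v : enorm v <= 1 ->
  enorm (M *m v) <= opnorm M.
Proof. by move=> v1; apply: sup_ubound; [case: (opset_sup M)|exists v]. Qed.

Lemma opnorm_le (m d : nat) (M : 'M[R]_(m, d)) (c : R) :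
  (forall v, enorm v <= 1 -> enorm (M *m v) <= c) -> opnorm M <= c.
Proof.
move=> h; apply: ge_sup; first by case: (opset_sup M).
by move=> _ [v v1 <-]; exact: h.
Qed.

Lemma opnorm_le_sum (m d : nat) (M : 'M[R]_(m, d)) :
  opnorm M <= \sum_a \sum_b `|M a b|.
Proof. by apply: opnorm_le => v; exact: enorm_mulmx_le. Qed.

Lemma entry_le_opnorm (m d : nat) (M : 'M[R]_(m, d)) a b : `|M a b| <= opnorm M.
Proof.
apply: (@le_trans _ _ (enorm (M *m delta_mx b 0))).
  have -> : M a b = (M *m delta_mx b 0 : 'cV_m) a 0.
    rewrite mxE (bigD1 b)//= mxE !eqxx mulr1 big1 ?addr0// => j.
    by rewrite mxE => /negbTE ->; rewrite mulr0.
  exact: coord_le_enorm.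
apply: opnorm_ge; rewrite /enorm (bigD1 b)//= mxE !eqxx expr1n big1 ?addr0 ?sqrtr1//.
by move=> j; rewrite mxE => /negbTE ->; rewrite expr0n.
Qed.

Lemma opnormB_le (m d : nat) (M N : 'M[R]_(m, d)) :
  `|opnorm M - opnorm N| <= \sum_a \sum_b `|M a b - N a b|.
Proof.
have h (A B : 'M[R]_(m, d)) : opnorm A <= opnorm B + \sum_a \sum_b `|A a b - B a b|.
  apply: opnorm_le => v v1.
  have -> : A *m v = B *m v + (A - B) *m v by rewrite -mulmxDl addrC subrK.
  apply: le_trans (enormD _ _) _; apply: lerD; first exact: opnorm_ge.
  apply: le_trans (opnorm_ge _ v1) _; apply: le_trans (opnorm_le_sum _) _.
  by apply: ler_sum => a _; apply: ler_sum => b _; rewrite !mxE.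
rewrite ler_norml lerNl opprB !lerBlDl h andbT.
apply: le_trans (h N M) _; rewrite lerD2l; apply: ler_sum => a _; apply: ler_sum => b _.
by rewrite distrC.
Qed.

Lemma opnorm_continuous (m d : nat) : continuous (@opnorm R m d).
Proof.
move=> M A /nbhs_ballP[eps /= eps0 hA].
pose del := eps / (m * d).+1%:R.
have del0 : 0 < del by rewrite divr_gt0.
exists (fun a b => ball (M a b) del); first by move=> a b; exact: nbhsx_ballx.
move=> N /= hN; apply: hA; rewrite /ball/=; apply: le_lt_trans (opnormB_le _ _) _.
apply: (@le_lt_trans _ _ (\sum_(a < m) \sum_(b < d) del)).
  by apply: ler_sum => a _; apply: ler_sum => b _; exact/ltW/hN.
rewrite !sumr_const !card_ord -mulrnA -[_ *+ _]mulr_natl /del.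
by rewrite mulrCA gtr_pMr// ltr_pdivrMr// mul1r ltr_nat mulnC.
Qed.

Lemma enorm_continuous (d : nat) : continuous (@enorm R d).
Proof.
move=> v A /nbhs_ballP[eps /= eps0 hA].
pose del := eps / d.+1%:R.
have del0 : 0 < del by rewrite divr_gt0.
exists (fun a b => ball (v a b) del); first by move=> a b; exact: nbhsx_ballx.
have h (x y : 'cV[R]_d) : enorm x <= enorm y + \sum_a `|x a 0 - y a 0|.
  have -> : enorm x = enorm (y + (x - y)) by rewrite addrC subrK.
  apply: le_trans (enormD _ _) _.
  rewrite lerD2l; apply: le_trans (enorm_le_sum _) _.
  by apply: ler_sum => a _; rewrite !mxE.
move=> w /= hw; apply: hA; rewrite /ball/=; apply: (@le_lt_trans _ _ (\sum_a `|v a 0 - w a 0|)).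
  rewrite ler_norml lerNl opprB !lerBlDl h andbT.
  by apply: le_trans (h w v) _; rewrite lerD2l; apply: ler_sum => a _; rewrite distrC.
apply: (@le_lt_trans _ _ (\sum_(a < d) del)).
  by apply: ler_sum => a _; exact/ltW/hw.
rewrite sumr_const card_ord -[_ *+ _]mulr_natl /del.
by rewrite mulrCA gtr_pMr// ltr_pdivrMr// mul1r ltr_nat.
Qed.

End euclidean_norm.

(** * Derivatives as sequential limits *)

Section directional_derivatives.
Context (R : realType) (d : nat).

Lemma harmonic_dnbhs : (fun N : nat => N.+1%:R^-1 : R) @ \oo --> (0 : R)^'.
Proof.
move=> A /= hA.
have : \forall N \near \oo, harmonic N != 0 -> A (harmonic N) :=
  @cvg_harmonic R _ hA.
apply: filterS => N; apply.
by rewrite invr_eq0 pnatr_eq0.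
Qed.

Lemma diff_seq_cvg (W : normedModType R) (F : 'cV[R]_d -> W) x v :
  differentiable F x ->
  (fun N : nat => N.+1%:R *: (F (x + N.+1%:R^-1 *: v) - F x)) @ \oo --> 'd F x v.
Proof.
move=> dF; rewrite -deriveE//.
have dr : derivable F x v by exact: diff_derivable.
rewrite (_ : (fun N => _) = (fun h => h^-1 *: ((F \o shift x) (h *: v) - F x)) \o
   (fun N : nat => N.+1%:R^-1)); last first.
  by apply/funext => N /=; rewrite invrK [_ + x]addrC.
exact: cvg_comp harmonic_dnbhs dr.
Qed.

Lemma grad_seq_cvg (f : 'cV[R]_d -> R) x a :
  differentiable (f : 'cV[R]_d -> R^o) x ->
  (fun N : nat => N.+1%:R * (f (x + N.+1%:R^-1 *: delta_mx a 0) - f x)) @ \oo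
    --> grad f x a 0.
Proof. by move=> /(diff_seq_cvg (v:=delta_mx a 0)); rewrite mxE. Qed.

Lemma jac_seq_cvg m (F : 'cV[R]_d -> 'cV[R]_m) x a b :
  differentiable F x ->
  (fun N : nat => N.+1%:R * (F (x + N.+1%:R^-1 *: delta_mx b 0) a 0 - F x a 0)) @ \oo
    --> jac F x a b.
Proof.
move=> /(diff_seq_cvg (v:=delta_mx b 0)); rewrite mxE => h.
rewrite (_ : (fun N => _) = (fun M : 'cV_m => M a 0) \o
   (fun N : nat => N.+1%:R *: (F (x + N.+1%:R^-1 *: delta_mx b 0) - F x))); last first.
  by apply/funext => N /=; rewrite !mxE.
exact: cvg_comp h (@coord_continuous _ _ _ a 0 _).
Qed.

Lemma grad_coord_continuous (f : 'cV[R]_d -> R) a : twice_differentiable f ->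
  continuous (fun x => grad f x a 0).
Proof.
move=> [_ df] x; have := differentiable_continuous (df x) => h.
exact: (cvg_comp _ _ h (@coord_continuous _ _ _ a 0 _)).
Qed.

Lemma partial_mvt (f : 'cV[R]_d -> R) x a (t : R) : 0 < t ->
  (forall y, differentiable (f : 'cV[R]_d -> R^o) y) ->
  exists2 c, 0 < c < t &
    f (x + t *: delta_mx a 0) - f x = grad f (x + c *: delta_mx a 0) a 0 * t.
Proof.
move=> t0 df; pose phi (s : R) := f (x + s *: delta_mx a 0).
have dphi (s : R) : is_derive s 1 phi (grad f (x + s *: delta_mx a 0) a 0).
  rewrite mxE -deriveE//.
  have dr := diff_derivable (v:=delta_mx a 0) (df (x + s *: delta_mx a 0)).
  have E : (fun h : R => h^-1 *: ((phi \o shift s) (h *: 1) - phi s)) =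
     (fun h : R => h^-1 *: (((f : _ -> R^o) \o shift (x + s *: delta_mx a 0)) (h *: delta_mx a 0) - f (x + s *: delta_mx a 0))).
    apply/funext => h; rewrite /phi /=; congr (_ *: (f _ - _)).
    by rewrite [h *: 1]mulr1 scalerDl addrCA.
  by split; rewrite /derivable /derive /= E.
have cphi : {within `[0, t], continuous phi}.
  by apply: derivable_within_continuous => s _; have [] := dphi s.
have [c ct E] := MVT t0 (fun s _ => dphi s) cphi.
exists c => //.
by move: E; rewrite /phi scale0r addr0 subr0.
Qed.

End directional_derivatives.

(** * The objective *)

Lemma dotE (R : realType) (d : nat) (v w : 'cV[R]_d) : dot v w = \sum_a v a 0 * w a 0.
Proof. by rewrite /dot mxE; apply: eq_bigr => a _; rewrite mxE. Qed.

Lemma enormZ (R : realType) (d : nat) (c : R) (v : 'cV[R]_d) :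
  enorm (c *: v) = `|c| * enorm v.
Proof.
rewrite -sqrtr_sqr /enorm -sqrtrM ?sqr_ge0// mulr_sumr.
by congr Num.sqrt; apply: eq_bigr => a _; rewrite mxE exprMn.
Qed.

Lemma enorm_delta (R : realType) (d : nat) (a : 'I_d) :
  enorm (delta_mx a 0 : 'cV[R]_d) = 1.
Proof.
rewrite /enorm (bigD1 a)//= mxE !eqxx expr1n big1 ?addr0 ?sqrtr1//.
by move=> j; rewrite mxE => /negbTE ->; rewrite expr0n.
Qed.

Lemma measurable_enorm (R : realType) (dd : measure_display) (T : measurableType dd)
    (d : nat) (X : T -> 'cV[R]_d) :
  (forall a, measurable_fun [set: T] (fun t => X t a 0)) ->
  measurable_fun [set: T] (fun t => enorm (X t)).
Proof.
move=> mX; apply: (measurable_caratheodory (F := fun x _ => enorm x)) => //.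
- by move=> _; exact: enorm_continuous.
- by move=> a b; rewrite ord1.
Qed.

Lemma colB (R : realType) (d : nat) (u v : 'cV[R]_d) a : (u - v) a 0 = u a 0 - v a 0.
Proof. by rewrite mxE [X in _ + X]mxE. Qed.

Lemma measurable_rv (R : realType) (d1 d2 : measure_display) (T1 : measurableType d1)
    (T2 : measurableType d2) (V : {mfun T1 >-> T2}) (phi : T2 -> R) :
  measurable_fun [set: T2] phi -> measurable_fun [set: T1] (fun w => phi (V w)).
Proof. by move=> mphi; exact: (measurableT_comp mphi). Qed.

Lemma cvg_fsum (R : realType) (I : Type) (s : seq I) (u : I -> nat -> R) (l : I -> R) :
  (forall i, u i @ \oo --> l i) ->
  (fun N => \sum_(i <- s) u i N) @ \oo --> \sum_(i <- s) l i.
Proof.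
move=> ul; elim: s => [|i s IH].
  by rewrite big_nil; under eq_fun do rewrite big_nil; exact: cvg_cst.
by rewrite big_cons; under eq_fun do rewrite big_cons; apply: cvgD.
Qed.

Section objective.
Context (R : realType) (dO : measure_display) (Omega : measurableType dO)
  (P : probability Omega R) (n d : nat) (dZ : 'I_n -> measure_display)
  (Z : forall i, measurableType (dZ i)) (g : forall i, 'cV[R]_d -> Z i -> R)
  (zeta : forall i, {RV P >-> Z i}) (zetas : nat -> forall i, {RV P >-> Z i})
  (xstar : 'cV[R]_d) (mu c p U1 : R) (Lip : forall i, Z i -> R).
Arguments g : clear implicits.
Hypothesis cs : cost_setting P g zeta.
Hypothesis iid : iid_copies P zeta zetas.
Hypothesis oa : objective_assumption P g zeta xstar mu c p U1 Lip.

Let td (i : 'I_n) (z : Z i) : twice_differentiable (fun x => g i x z).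
Proof. exact: (cost_twice_differentiable cs). Qed.

(** The mean of the sampled partial derivative, not the derivative of the local cost:
    differentiability is assumed of the total cost only, and [grad_total_cost] links the two after
    summation. *)
Definition mgrad (i : 'I_n) (a : 'I_d) (x : 'cV[R]_d) : R := Ex P (fun w => sgrad g x (zeta i w) a 0).

Lemma sgrad_measurable i a x : measurable_fun [set: Z i] (fun z => sgrad g x z a 0).
Proof.
apply: (@measurable_fun_cvg _ _ _ _
  (fun (N : nat) z => N.+1%:R * (g i (x + N.+1%:R^-1 *: delta_mx a 0) z - g i x z))).
- move=> N; apply: measurable_funM => //.
  by apply: measurable_funB; exact: (cost_measurable cs).
- by move=> z _; apply: grad_seq_cvg; have [] := td z.
Qed.

Lemma sgrad_continuous i a (z : Z i) : continuous (fun x => sgrad g x z a 0).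
Proof. exact: grad_coord_continuous. Qed.

Lemma sgrad_continuous_mx i (z : Z i) : continuous (fun x => sgrad g x z).
Proof. by move=> x; have [_ h] := td z; exact: differentiable_continuous. Qed.

Lemma shess_seq_cvg i (a b : 'I_d) x (z : Z i) :
  (fun N : nat => N.+1%:R * (sgrad g (x + N.+1%:R^-1 *: delta_mx b 0) z a 0 - sgrad g x z a 0)) @ \oo
    --> shess g x z a b.
Proof. by apply: jac_seq_cvg; have [_] := td z. Qed.

Lemma shess_measurable i a b x : measurable_fun [set: Z i] (fun z => shess g x z a b).
Proof.
apply: (@measurable_fun_cvg _ _ _ _
  (fun (N : nat) (z : Z i) => N.+1%:R * (sgrad g (x + N.+1%:R^-1 *: delta_mx b 0) z a 0 - sgrad g x z a 0))).
- move=> N; apply: measurable_funM => //.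
  by apply: measurable_funB; exact: sgrad_measurable.
- by move=> z _; exact: shess_seq_cvg.
Qed.

(** The Lipschitz assumption has an exceptional null set for each pair of points. Random iterates
    call for a single one, and a measurable event, so that it passes from [zeta] to its copies. *)
Definition lip_good i : set (Z i) :=
  [set z | forall x y, enorm (sgrad g x z - sgrad g y z) <= Lip z * enorm (x - y)].

Let lipq i (t : nat * 'cV[int]_d * 'cV[int]_d) : set (Z i) :=
  let x := ungrid R t.1.1 t.1.2 in let y := ungrid R t.1.1 t.2 in
  [set z | enorm (sgrad g x z - sgrad g y z) <= Lip z * enorm (x - y)].

Let lipq_measurable i t : measurable (@lipq i t).
Proof.
rewrite /lipq; set x := ungrid _ _ _; set y := ungrid _ _ _.
have -> : [set z | enorm (sgrad g x z - sgrad g y z) <= Lip z * enorm (x - y)] =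
   (fun z : Z i => Lip z * enorm (x - y) - enorm (sgrad g x z - sgrad g y z)) @^-1` `[0, +oo[%classic.
  by apply/seteqP; split => z /=; rewrite in_itv/= andbT subr_ge0.
rewrite -[X in measurable X]setTI.
have mI : measurable (`[0, +oo[%classic : set R) by exact: measurable_itv.
move: mI; apply: measurable_funB => //.
  by apply: measurable_funM => //; exact: (obj_Lip_measurable oa).
apply: measurable_enorm => a.
have h u : measurable_fun [set: Z i] (fun z => sgrad g u z a 0) by exact: sgrad_measurable.
rewrite (_ : (fun z => _) = (fun z => sgrad g x z a 0 - sgrad g y z a 0)).
  exact: measurable_funB.
by apply/funext => z; rewrite colB.
Qed.

(** Countably many lattice pairs suffice, because both sides of the inequality are continuous in the
    pair of points. *)
Let lip_goodE i : @lip_good i = ~` \bigcup_(t in [set: nat * 'cV[int]_d * 'cV[int]_d]) ~` @lipq i t.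
Proof.
rewrite setC_bigcup; under eq_bigcapr do rewrite setCK.
apply/seteqP; split => z /= h; first by move=> t _; exact: h.
move=> x y.
pose q (u : 'cV[R]_d) N : 'cV[R]_d := ungrid R N (map_mx (grid N) u).
have hq u : (q u : nat -> _) @ \oo --> u by exact: ungrid_cvg.
have h1 : (fun N => enorm (sgrad g (q x N) z - sgrad g (q y N) z)) @ \oo --> enorm (sgrad g x z - sgrad g y z).
  apply: (cvg_comp (fun N => sgrad g (q x N) z - sgrad g (q y N) z) (@enorm R d)); last exact: enorm_continuous.
  by apply: cvgB; apply: (cvg_comp _ (fun x => sgrad g x z) (hq _)); exact: sgrad_continuous_mx.
have h2 : (fun N => Lip z * enorm (q x N - q y N)) @ \oo --> Lip z * enorm (x - y).
  apply: cvgMr; apply: (cvg_comp (fun N => q x N - q y N) (@enorm R d)); last exact: enorm_continuous.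
  by apply: cvgB; exact: hq.
rewrite -(cvg_lim _ h1)// -(cvg_lim _ h2)//.
apply: ler_lim; [by apply/cvg_ex; exists (enorm (sgrad g x z - sgrad g y z))|by apply/cvg_ex; exists (Lip z * enorm (x - y))|].
by apply: nearW => N; exact: (h (N, map_mx (grid N) x, map_mx (grid N) y) I).
Qed.

Lemma lip_good_measurable i : measurable (@lip_good i).
Proof.
rewrite lip_goodE; apply: measurableC; apply: countable_bigcupT_measurable.
  exact: countableP.
by move=> t; apply: measurableC; exact: lipq_measurable.
Qed.

Lemma lip_good_ae i : {ae P, forall w, @lip_good i (zeta i w)}.
Proof.
(* [unpickle] enumerates the lattice pairs, so that countably many null sets are united. *)
have h (m : nat) : {ae P, forall w, if unpickle m is Some t then @lipq i t (zeta i w) else True}.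
  case: (unpickle m) => [t|]; last exact: aeW.
  exact: (obj_lipschitz oa).
move/ae_foralln : h; apply: filterS => w h.
by rewrite lip_goodE => -[t _]; apply; have := h (pickle t); rewrite pickleK.
Qed.

Lemma lip_good_zetas k i : {ae P, forall w, @lip_good i (zetas k i w)}.
Proof. by apply: (zetas_ae iid); [exact: lip_good_measurable|exact: lip_good_ae]. Qed.

Lemma lip_good_coord i (z : Z i) a x y : lip_good z ->
  `|sgrad g x z a 0 - sgrad g y z a 0| <= Lip z * enorm (x - y).
Proof.
move=> h; apply: le_trans (h x y).
by have := coord_le_enorm (sgrad g x z - sgrad g y z) a; rewrite colB.
Qed.

Let sqr_le_powR (t : R) : 0 <= t -> t ^+ 2 <= 1 + t `^ p.
Proof.
move=> t0; have [t1|t1] := leP t 1.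
  by rewrite ler_wpDr ?powR_ge0// expr_le1.
apply: (@le_trans _ _ (t `^ p)); last by rewrite lerDr.
rewrite -powR_mulrn//; apply: ler_powR; first exact: ltW.
exact: ltW (obj_p_gt2 oa).
Qed.

Let Lip_measurable_zeta i : measurable_fun [set: Omega] (fun w => Lip (zeta i w)).
Proof. exact: (measurable_rv (zeta i) (obj_Lip_measurable oa (i:=i))).
Qed.

Lemma Lip_sqitg i : sqitg P (fun w => Lip (zeta i w)).
Proof.
have ip : itg P (fun w => Lip (zeta i w) `^ p).
  apply/integrableP; split.
    by apply/measurable_EFinP; exact: (measurableT_comp (measurable_powR p)).
  have := obj_Lip_moment oa i; rewrite unlock; apply: le_lt_trans.
  by apply: ge0_le_integral_upper => w //=; rewrite lee_fin ger0_norm// powR_ge0.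
apply: (sqitg_le _ (itgD (itg_cst P 1) ip)) => // w.
by apply: sqr_le_powR; exact: ltW (obj_Lip_gt0 oa _).
Qed.

Lemma sgrad_xstar_sqitg i a : sqitg P (fun w => sgrad g xstar (zeta i w) a 0).
Proof.
pose m := grad (local_cost P g (fun i => zeta i) i) xstar.
have mG b : measurable_fun [set: Omega] (fun w => sgrad g xstar (zeta i w) b 0).
  exact: (measurable_rv (zeta i) (@sgrad_measurable i b xstar)).
have me : measurable_fun [set: Omega] (fun w => enorm (sgrad g xstar (zeta i w) - m)).
  apply: measurable_enorm => b.
  rewrite (_ : (fun w => _) = (fun w => sgrad g xstar (zeta i w) b 0 - m b 0)).
    exact: measurable_funB.
  by apply/funext => w; rewrite colB.
have ip : itg P (fun w => enorm (sgrad g xstar (zeta i w) - m) `^ p).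
  apply/integrableP; split.
    by apply/measurable_EFinP; exact: (measurableT_comp (measurable_powR p)).
  have hU := obj_noise_moment oa i xstar; rewrite unlock in hU.
  apply: le_lt_trans (le_lt_trans hU (ltry _)).
  by apply: ge0_le_integral_upper => w //=; rewrite lee_fin ger0_norm// powR_ge0.
have s1 : sqitg P (fun w => sgrad g xstar (zeta i w) a 0 - m a 0).
  apply: (sqitg_le _ (itgD (itg_cst P 1) ip)) => [|w].
    exact: measurable_funB.
  apply: le_trans (sqr_le_powR (enorm_ge0 _)).
  rewrite -[leLHS]real_normK ?num_real// lerXn2r ?nnegrE ?enorm_ge0//.
  by have := coord_le_enorm (sgrad g xstar (zeta i w) - m) a; rewrite colB.
have := sqitgD s1 (sqitg_cst P (m a 0)).
by congr sqitg; apply/funext => w; rewrite subrK.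
Qed.

Lemma sgrad_sqitg i a x : sqitg P (fun w => sgrad g x (zeta i w) a 0).
Proof.
have mG y : measurable_fun [set: Omega] (fun w => sgrad g y (zeta i w) a 0).
  exact: (measurable_rv (zeta i) (@sgrad_measurable i a y)).
have s1 : sqitg P (fun w => sgrad g x (zeta i w) a 0 - sgrad g xstar (zeta i w) a 0).
  apply: (sqitg_le_ae _ (itgZ (enorm (x - xstar) ^+ 2) (Lip_sqitg i).2)).
    exact: measurable_funB.
  apply: filterS (@lip_good_ae i) => w hw.
  rewrite -[leLHS]real_normK ?num_real// mulrC -exprMn lerXn2r ?nnegrE ?mulr_ge0 ?enorm_ge0//.
    exact: ltW (obj_Lip_gt0 oa _).
  exact: lip_good_coord.
have := sqitgD s1 (sgrad_xstar_sqitg i a).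
by congr sqitg; apply/funext => w; rewrite subrK.
Qed.

Lemma mgrad_lipschitz i a x y :
  `|mgrad i a x - mgrad i a y| <= Ex P (fun w => Lip (zeta i w)) * enorm (x - y).
Proof.
have ig u := sqitg_itg (sgrad_sqitg i a u).
rewrite /mgrad -ExB// (le_trans (Ex_abs (itgB (ig x) (ig y))))// mulrC -ExZ; last first.
  exact: sqitg_itg (Lip_sqitg i).
apply: Ex_le_ae => //.
- by apply: itg_abs; exact: itgB.
- by apply: itgZ; exact: sqitg_itg (Lip_sqitg i).
- by move=> w; rewrite mulr_ge0 ?enorm_ge0//; exact: ltW (obj_Lip_gt0 oa _).
- by apply: filterS (@lip_good_ae i) => w hw; rewrite mulrC; exact: lip_good_coord.
Qed.

(** Differentiation under the expectation. By the mean value theorem each difference quotient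
    differs from the sampled derivative by at most [Lip / (N + 1)], which vanishes in mean; as the
    total cost is differentiable, one sequence of increments identifies the gradient. *)
Lemma grad_total_cost x a :
  grad (total_cost P g (fun i => zeta i)) x a 0 = \sum_i mgrad i a x.
Proof.
have h1 := grad_seq_cvg (a:=a) (obj_differentiable oa x).
suff h2 : (fun N : nat => N.+1%:R * (total_cost P g (fun i => zeta i) (x + N.+1%:R^-1 *: delta_mx a 0)
    - total_cost P g (fun i => zeta i) x)) @ \oo --> \sum_i mgrad i a x.
  exact: cvg_unique h1 h2.
have lE y : total_cost P g (fun i => zeta i) y = \sum_i Ex P (fun w => g i y (zeta i w)).
  by apply: eq_bigr => i _; rewrite /local_cost unlock.
have ig i y : itg P (fun w => g i y (zeta i w)) by exact: (cost_integrable cs).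
rewrite (_ : (fun N => _) = (fun N : nat => \sum_i Ex P (fun w => N.+1%:R *
    (g i (x + N.+1%:R^-1 *: delta_mx a 0) (zeta i w) - g i x (zeta i w))))); last first.
  apply/funext => N; rewrite !lE -sumrB mulr_sumr; apply: eq_bigr => i _.
  by rewrite -ExB// -ExZ//; exact: itgB.
apply: (@cvg_fsum R _ _ (fun i (N : nat) => Ex P (fun w => N.+1%:R *
    (g i (x + N.+1%:R^-1 *: delta_mx a 0) (zeta i w) - g i x (zeta i w))))) => i.
pose K := Ex P (fun w => Lip (zeta i w)).
have iL := sqitg_itg (Lip_sqitg i).
have iG := sqitg_itg (sgrad_sqitg i a x).
apply/cvgrPdist_le => e e0.
have : (fun N => K * harmonic N) @ \oo --> 0.
  by rewrite -(mulr0 K); apply: cvgMr; exact: cvg_harmonic.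
move/cvgrPdist_le => /(_ e e0).
apply: filterS => N /=; rewrite sub0r normrN; apply: le_trans.
apply: le_trans (ler_norm _); rewrite distrC.
have t0 : 0 < N.+1%:R^-1 :> R by rewrite invr_gt0.
rewrite /mgrad -ExB//; last by apply: itgZ; exact: itgB.
rewrite (le_trans (Ex_abs _))//; first by apply: itgB => //; apply: itgZ; exact: itgB.
rewrite /K mulrC -ExZ//; apply: Ex_le_ae => //.
- by apply: itg_abs; apply: itgB => //; apply: itgZ; exact: itgB.
- exact: itgZ.
- by move=> w; rewrite mulr_ge0 ?harmonic_ge0//; exact: ltW (obj_Lip_gt0 oa _).
apply: filterS (@lip_good_ae i) => w hw.
have [cc /andP[c0 ct] ->] := partial_mvt x a t0 (td (zeta i w)).1.
rewrite mulrCA mulfV ?pnatr_eq0// mulr1.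
rewrite -/(sgrad g (x + cc *: delta_mx a 0) (zeta i w)).
apply: le_trans (lip_good_coord a _ _ hw) _.
rewrite addrC addKr enormZ enorm_delta mulr1 mulrC ler_wpM2r//.
  exact: ltW (obj_Lip_gt0 oa _).
by rewrite gtr0_norm// ltW.
Qed.

Let H := hess (total_cost P g (fun i => zeta i)) xstar.

(** At [x = xstar] the estimate [obj_hess_approx] reduces to: the norm of the gradient at [xstar] is
    at most 0. *)
Lemma mgrad_xstar a : \sum_i mgrad i a xstar = 0.
Proof.
have := obj_hess_approx oa xstar.
rewrite subrr mulmx0 subr0 enorm0 expr0n mulr0 => h.
rewrite -grad_total_cost.
have /enorm_eq0 -> : enorm (grad (total_cost P g (fun i => zeta i)) xstar) = 0.
  by apply/eqP; rewrite eq_le h enorm_ge0.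
by rewrite mxE.
Qed.

(** The sum of the strong convexity inequalities for ([x], [xstar]) and ([xstar], [x]); the gradient
    vanishes at [xstar] and the two halves of [mu] add up. *)
Lemma mgrad_monotone x :
  mu * enorm (x - xstar) ^+ 2 <= \sum_a (x - xstar) a 0 * \sum_i mgrad i a x.
Proof.
have h1 := obj_strongly_convex oa x xstar.
have h2 := obj_strongly_convex oa xstar x.
have d2 : dot (grad (total_cost P g (fun i => zeta i)) xstar) (x - xstar) = 0.
  rewrite dotE big1// => a _; rewrite grad_total_cost mgrad_xstar mul0r//.
have d1 : dot (grad (total_cost P g (fun i => zeta i)) x) (xstar - x) =
   - \sum_a (x - xstar) a 0 * \sum_i mgrad i a x.
  rewrite dotE -sumrN; apply: eq_bigr => a _; rewrite grad_total_cost !colB; ring.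
have e12 : enorm (xstar - x) = enorm (x - xstar) by rewrite -enormN opprB.
rewrite d1 in h1; rewrite d2 e12 in h2.
move: (total_cost _ _ _ x) (total_cost _ _ _ xstar) (\sum_a _) (enorm _) h1 h2.
by move=> *; lra.
Qed.

Lemma shess_xstar_itg i a b : itg P (fun w => shess g xstar (zeta i w) a b) /\
  (fun N : nat => Ex P (fun w => N.+1%:R * (sgrad g (xstar + N.+1%:R^-1 *: delta_mx b 0) (zeta i w) a 0 - sgrad g xstar (zeta i w) a 0)))
  @ \oo --> Ex P (fun w => shess g xstar (zeta i w) a b).
Proof.
apply: (Ex_dominated (g := fun w => Lip (zeta i w))).
- move=> N; apply: measurable_funM => //; apply: measurable_funB.
    exact: (measurable_rv (zeta i) (@sgrad_measurable i a _)).
  exact: (measurable_rv (zeta i) (@sgrad_measurable i a _)).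
- exact: (measurable_rv (zeta i) (@shess_measurable i a b xstar)).
- exact: sqitg_itg (Lip_sqitg i).
- by apply: aeW => w; exact: shess_seq_cvg.
apply: filterS (@lip_good_ae i) => w hw N.
have N0 : 0 < N.+1%:R :> R by [].
rewrite normrM ger0_norm// mulrC -ler_pdivlMr//.
apply: le_trans (lip_good_coord a _ _ hw) _.
by rewrite addrC addKr enormZ enorm_delta mulr1 ger0_norm ?invr_ge0.
Qed.

(** The gradient of the total cost is not assumed differentiable, so [H] is identified from its
    quadratic estimate: difference quotients of the gradient at [xstar] tend to [H] with error
    [c / (N + 1)]. Dominated convergence, with [Lip] as the bound, gives the other limit. *)
Lemma hess_total_cost a b : H a b = \sum_i Ex P (fun w => shess g xstar (zeta i w) a b).
Proof.
pose f := total_cost P g (fun i => zeta i).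
pose u (N : nat) : R := N.+1%:R * grad f (xstar + N.+1%:R^-1 *: delta_mx b 0) a 0.
have h1 : u @ \oo --> H a b.
  apply/cvgrPdist_le => e e0.
  have : (fun N => c * harmonic N) @ \oo --> 0.
    by rewrite -(mulr0 c); apply: cvgMr; exact: cvg_harmonic.
  move/cvgrPdist_le => /(_ e e0).
  apply: filterS => N /=; rewrite sub0r normrN; apply: le_trans.
  apply: le_trans (ler_norm _); rewrite distrC /u.
  set t : R := N.+1%:R^-1.
  have N0 : 0 < N.+1%:R :> R by [].
  have := obj_hess_approx oa (xstar + t *: delta_mx b 0).
  rewrite [xstar + _ - _]addrC addKr enormZ enorm_delta mulr1.
  move/(le_trans (coord_le_enorm _ a)).
  have -> : (grad (total_cost P g (fun i => zeta i)) (xstar + t *: delta_mx b 0) -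
     hess (total_cost P g (fun i => zeta i)) xstar *m (t *: delta_mx b 0)) a 0 =
     grad f (xstar + t *: delta_mx b 0) a 0 - t * H a b.
    rewrite colB -scalemxAr [X in _ - X]mxE; congr (_ - _ * _).
    by rewrite -colE [LHS]mxE.
  set gr := grad _ _ _ _; rewrite real_normK ?num_real// => hh.
  have -> : N.+1%:R * gr - H a b = N.+1%:R * (gr - t * H a b).
    by rewrite mulrBr mulrA mulfV ?mul1r// pnatr_eq0.
  rewrite normrM ger0_norm// -ler_pdivlMl//.
  apply: le_trans hh _; rewrite /harmonic/= -/t expr2 le_eqVlt; apply/orP; left; apply/eqP; ring.
suff h2 : u @ \oo --> \sum_i Ex P (fun w => shess g xstar (zeta i w) a b) by exact: cvg_unique h1 h2.
rewrite (_ : u = (fun N : nat => \sum_i Ex P (fun w => N.+1%:R * (sgrad g (xstar + N.+1%:R^-1 *: delta_mx b 0) (zeta i w) a 0 - sgrad g xstar (zeta i w) a 0)))); last first.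
  apply/funext => N; pose x := xstar + N.+1%:R^-1 *: delta_mx b 0.
  transitivity (N.+1%:R * \sum_i (mgrad i a x - mgrad i a xstar)).
    have E y : \sum_i (mgrad i a y - mgrad i a xstar) =
        grad (total_cost P g (fun i => zeta i)) y a 0.
      by rewrite grad_total_cost sumrB [X in _ - X](mgrad_xstar a) subr0.
    by rewrite E.
  rewrite mulr_sumr; apply: eq_bigr => i _.
  have iG y := sqitg_itg (sgrad_sqitg i a y).
  by rewrite ExZ ?ExB//; exact: itgB.
apply: (@cvg_fsum R _ _ (fun i (N : nat) => Ex P (fun w => N.+1%:R *
  (sgrad g (xstar + N.+1%:R^-1 *: delta_mx b 0) (zeta i w) a 0 - sgrad g xstar (zeta i w) a 0)))) => i.
exact: (shess_xstar_itg i a b).2.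
Qed.

(** Along a kernel vector the gradient would be of second order in [t], while strong monotonicity
    forces first-order growth. *)
Lemma hess_total_cost_unit : H \in unitmx.
Proof.
(* [det0P] produces a row vector; applied to the transpose it yields a right kernel vector of [H]
   without appeal to symmetry. *)
rewrite -unitmx_tr unitmxE unitfE; apply/negP => /det0P[v v0 vH].
have Hv : H *m v^T = 0 by rewrite -[H]trmxK -trmx_mul vH trmx0.
pose e := enorm v^T.
have e0 : 0 < e.
  rewrite lt_neqAle enorm_ge0 andbT eq_sym; apply/eqP => /enorm_eq0 h.
  by move: v0; rewrite -[v]trmxK h trmx0 eqxx.
have key t : 0 < t -> mu <= c * t * e.
  move=> t0; pose x := xstar + t *: v^T.
  have xE : x - xstar = t *: v^T by rewrite /x addrC addKr.
  have := obj_hess_approx oa x; rewrite xE -scalemxAr Hv scaler0 subr0 enormZ gtr0_norm// -/e => hg.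
  have := mgrad_monotone x; rewrite xE enormZ gtr0_norm// -/e.
  under eq_bigr do rewrite -grad_total_cost mulrC.
  set gr := grad _ x in hg *.
  have -> : \sum_a gr a 0 * (t *: v^T) a 0 = dot gr (t *: v^T) by rewrite dotE.
  have hd : dot gr (t *: v^T) <= enorm gr * (t * e).
    rewrite dotE (le_trans (ler_norm _))// -(@ler_pXn2r _ 2)// ?nnegrE; last first.
      by rewrite !mulr_ge0 ?enorm_ge0// ltW.
    rewrite real_normK ?num_real// exprMn.
    have := cauchy_schwarz (fun a => gr a 0) (fun a => (t *: v^T) a 0).
    by rewrite -!enorm_sqr enormZ gtr0_norm.
  move=> /le_trans/(_ hd) h; have te0 : 0 < t * e by rewrite mulr_gt0.
  have := ler_wpM2r (ltW te0) hg; move/(le_trans h).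
  have -> : c * (t * e) ^+ 2 * (t * e) = (c * t * e) * (t * e) ^+ 2 by ring.
  by rewrite ler_pM2r ?exprn_gt0.
have mu0 := obj_mu_gt0 oa; have c0 := obj_c_gt0 oa.
have t0 : 0 < mu / (2 * c * e) by rewrite divr_gt0// !mulr_gt0.
have := key _ t0; have -> : c * (mu / (2 * c * e)) * e = mu / 2.
  by field; rewrite !gt_eqF.
by lra.
Qed.

End objective.

Lemma sqr_add2_le (R : realType) (x y : R) : (x + y) ^+ 2 <= 2 * x ^+ 2 + 2 * y ^+ 2.
Proof. by have := sqr_ge0 (x - y); nra. Qed.

Lemma sqr_add3_le (R : realType) (x y z : R) :
  (x + y + z) ^+ 2 <= 3 * (x ^+ 2 + y ^+ 2 + z ^+ 2).
Proof.
by have := sqr_ge0 (x - y); have := sqr_ge0 (x - z); have := sqr_ge0 (y - z); nra.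
Qed.

(** * Mean-square convergence of the iterates *)

Section coordinate_path.
Context (R : realType) (n : nat) (A B : 'M[R]_n) (pi v : 'I_n -> R) (al : nat -> R)
  (C rho : R) (X Y G : nat -> 'I_n -> R).
Hypothesis pi_sum : \sum_i pi i = 1.
Hypothesis pi_ge0 : forall i, 0 <= pi i.
Hypothesis piA : forall j, \sum_i pi i * A i j = pi j.
Hypothesis Bv : forall i, \sum_j B i j * v j = v i.
Hypotheses (C0 : 0 <= C) (rho0 : 0 < rho) (rho1 : rho < 1).
Hypothesis A_geo : forall k i j, `|(A ^+ k) i j - pi j| <= C * rho ^+ k.
Hypothesis B_geo : forall k i j, `|(B ^+ k) i j - v i / n%:R| <= C * rho ^+ k.
Hypothesis Y0 : forall i, Y 0%N i = G 0%N i.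
Hypothesis XS : forall k i, X k.+1 i = \sum_j A i j * X k j - al k * Y k i.
Hypothesis YS : forall k i, Y k.+1 i = \sum_j B i j * Y k j + G k.+1 i - G k i.

Let KA k : 'M[R]_n := \matrix_(i, j) ((A ^+ k) i j - pi j).
Let KB k : 'M[R]_n := \matrix_(i, j) ((B ^+ k) i j - v i / n%:R).
Let vbar i := v i / n%:R.

(* The memory of the gradient tracker: [Y k = v Gbar k + memory k.+1 - memory k],
   so that it telescopes against the slowly varying step sizes. *)
Definition memory (k : nat) (i : 'I_n) : R :=
  \sum_(l < k) \sum_j KB (k.-1 - l)%N i j * G l j.

Lemma memoryS k i :
  memory k.+1 i = \sum_j B i j * memory k j + G k i - vbar i * \sum_j G k j.
Proof.
rewrite /memory big_ord_recr/= subnn -[RHS]addrA; congr (_ + _).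
  under [RHS]eq_bigr do rewrite mulr_sumr.
  rewrite [RHS]exchange_big/=; apply: eq_bigr => l _.
  under [RHS]eq_bigr do rewrite mulr_sumr.
  rewrite [RHS]exchange_big/=; apply: eq_bigr => j _.
  under [RHS]eq_bigr do rewrite mulrA.
  rewrite -mulr_suml; congr (_ * _).
  have -> : (k - l)%N = (k.-1 - l)%N.+1.
    by case: k l => [[]//|k] l; rewrite /= subSn// -ltnS.
  rewrite mxE exprS mxE.
  under [RHS]eq_bigr do rewrite mxE mulrBr mulrA.
  by rewrite sumrB -mulr_suml Bv.
under eq_bigr do rewrite mxE expr0 mxE mulrBl.
rewrite sumrB -mulr_sumr; congr (_ - _).
rewrite (bigD1 i)//= eqxx mul1r big1 ?addr0// => j.
by rewrite eq_sym => /negbTE ->; rewrite mul0r.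
Qed.

Lemma tracker_decomposition k i :
  Y k i = vbar i * \sum_j G k j + memory k.+1 i - memory k i.
Proof.
elim: k i => [|k IH] i.
  have m0 j : memory 0 j = 0 by rewrite /memory big_ord0.
  have Bm0 : \sum_j B i j * memory 0 j = 0 by rewrite big1// => j _; rewrite m0 mulr0.
  rewrite Y0 memoryS m0 Bm0.
  by ring.
rewrite YS; under eq_bigr do rewrite IH.
have -> : \sum_j B i j * (vbar j * (\sum_j0 G k j0) + memory k.+1 j - memory k j) =
  vbar i * (\sum_j0 G k j0) + (\sum_j B i j * memory k.+1 j) - \sum_j B i j * memory k j.
  under eq_bigr do rewrite mulrBr mulrDr.
  rewrite sumrB big_split/=; congr (_ + _ - _).
  under eq_bigr do rewrite mulrA /vbar mulrA.
  by rewrite -mulr_suml -mulr_suml Bv.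
have h1 := memoryS k i; have h2 := memoryS k.+1 i.
by rewrite h2 [in RHS]h1; ring.
Qed.

Definition average (k : nat) : R := \sum_i pi i * X k i.

Definition corrected (k : nat) : R := average k + al k * \sum_i pi i * memory k i.

Lemma averageS k : average k.+1 = average k - al k * \sum_i pi i * Y k i.
Proof.
rewrite /average; under eq_bigr do rewrite XS mulrBr mulr_sumr.
rewrite sumrB exchange_big/=; congr (_ - _).
  apply: eq_bigr => j _; under eq_bigr do rewrite mulrA.
  by rewrite -mulr_suml piA.
by rewrite mulr_sumr; apply: eq_bigr => i _; rewrite mulrCA.
Qed.

(** Summation by parts: the memory difference in the tracker cancels against the change of the
    correction, up to the variation of the step size. *)
Lemma correctedS k : corrected k.+1 = corrected k
  - al k * (\sum_i pi i * v i / n%:R) * \sum_j G k j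
  - (al k - al k.+1) * \sum_i pi i * memory k.+1 i.
Proof.
rewrite /corrected averageS; under eq_bigr do rewrite tracker_decomposition.
have -> : \sum_i pi i * (vbar i * (\sum_j G k j) + memory k.+1 i - memory k i) =
  (\sum_i pi i * v i / n%:R) * (\sum_j G k j) + (\sum_i pi i * memory k.+1 i) -
  (\sum_i pi i * memory k i).
  under eq_bigr do rewrite mulrBr mulrDr.
  rewrite sumrB big_split/=; congr (_ + _ - _).
  by rewrite mulr_suml; apply: eq_bigr => i _; rewrite /vbar !mulrA.
by ring.
Qed.

(** Variation of constants for the recursion of [X]; subtracting the weighted average turns the
    powers of [A] into the geometrically small kernels [KA]. *)
Lemma consensus_error k i : X k i - average k =
  \sum_j KA k i j * X 0%N j - \sum_(l < k) \sum_j KA (k.-1 - l)%N i j * (al l * Y l j).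
Proof.
have XE m j : X m j = \sum_s (A ^+ m) j s * X 0%N s
    - \sum_(l < m) \sum_s (A ^+ (m.-1 - l)) j s * (al l * Y l s).
  elim: m j => [|m IH] j.
    rewrite big_ord0 subr0 expr0 (bigD1 j)//= mxE eqxx mul1r big1 ?addr0// => s.
    by rewrite mxE eq_sym => /negbTE ->; rewrite mul0r.
  rewrite XS; under eq_bigr do rewrite IH mulrBr.
  rewrite sumrB big_ord_recr/= subnn opprD addrA; congr (_ - _ - _).
  - under eq_bigr do rewrite mulr_sumr.
    rewrite exchange_big/=; apply: eq_bigr => s _.
    by rewrite exprS [in RHS]mxE mulr_suml; apply: eq_bigr => t _; rewrite mulrA.
  - under eq_bigr do rewrite mulr_sumr.
    rewrite exchange_big/=; apply: eq_bigr => l _.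
    under eq_bigr do rewrite mulr_sumr.
    rewrite exchange_big/=; apply: eq_bigr => s _.
    have -> : (m - l)%N = (m.-1 - l)%N.+1.
      by case: m l {IH} => [[]//|m] l; rewrite /= subSn// -ltnS.
    by rewrite exprS [in RHS]mxE mulr_suml; apply: eq_bigr => t _; rewrite !mulrA.
  - rewrite expr0 (bigD1 j)//= mxE eqxx mul1r big1 ?addr0// => s.
    by rewrite mxE eq_sym => /negbTE ->; rewrite mul0r.
have piAk m j : \sum_s pi s * (A ^+ m) s j = pi j.
  elim: m j => [|m IH] j.
    rewrite expr0 (bigD1 j)//= mxE eqxx mulr1 big1 ?addr0// => s.
    by rewrite mxE => /negbTE ->; rewrite mulr0.
  under eq_bigr do rewrite exprSr mxE mulr_sumr.
  rewrite exchange_big/= -[RHS]piA; apply: eq_bigr => l _.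
  by rewrite -[in RHS]IH mulr_suml; apply: eq_bigr => s _; rewrite mulrA.
have aE : average k = \sum_s pi s * X 0%N s - \sum_(l < k) \sum_s pi s * (al l * Y l s).
  rewrite /average; under eq_bigr do rewrite XE mulrBr.
  rewrite sumrB; congr (_ - _).
    under eq_bigr do rewrite mulr_sumr.
    rewrite exchange_big/=; apply: eq_bigr => s _.
    by rewrite -[pi s](piAk k) mulr_suml; apply: eq_bigr => t _; rewrite mulrA.
  under eq_bigr do rewrite mulr_sumr.
  rewrite exchange_big/=; apply: eq_bigr => l _.
  under eq_bigr do rewrite mulr_sumr.
  rewrite exchange_big/=; apply: eq_bigr => s _.
  by rewrite -[pi s](piAk (k.-1 - l)%N) mulr_suml; apply: eq_bigr => t _; rewrite !mulrA.
rewrite XE aE (_ : forall s t s' t' : R, s - t - (s' - t') = (s - s') - (t - t')); last first.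
  by move=> *; ring.
congr (_ - _).
  by rewrite -sumrB; apply: eq_bigr => s _; rewrite mxE mulrBl.
rewrite -sumrB; apply: eq_bigr => l _.
by rewrite -sumrB; apply: eq_bigr => s _; rewrite mxE mulrBl.
Qed.

(** Scalar majorants: [Gam] of the squared gradients, and, up to constants, [q] of the squared
    memory and [w] of the squared consensus error. Their recursions for [q] and [w] are equalities,
    hence pass to expectations directly. *)
Context (q w Gam : nat -> R) (Cw Cd : R).
Hypothesis q0 : 0 <= q 0%N.
Hypothesis qS : forall k, q k.+1 = rho * q k + Gam k.
Hypothesis GamE : forall k, \sum_j G k j ^+ 2 <= Gam k.

(** The factor of [geometric_convolution]. The three constants after it record the factors produced
    in [tracker_bound], [consensus_bound] and [corrected_step]. *)
Definition conv_const : R := C ^+ 2 * (n%:R / (1 - rho)).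
Definition tracker_const : R := 3 * (n%:R * (\sum_i vbar i ^+ 2) + 2 * conv_const).
Definition consensus_const : R := 2 * (C ^+ 2 + conv_const).
Definition drift_const : R := (Cd + 2) * (n%:R * conv_const)
  + 2 * (\sum_i pi i * v i / n%:R) ^+ 2 * n%:R.

Hypothesis CwE : n%:R * tracker_const <= Cw.
Hypothesis w0 : (\sum_j `|X 0%N j|) ^+ 2 <= w 0%N.
Hypothesis wS : forall k, w k.+1 = rho * w k + Cw * al k ^+ 2 * (Gam k + q k).

Lemma conv_const_ge0 : 0 <= conv_const.
Proof. by rewrite mulr_ge0 ?sqr_ge0// divr_ge0// subr_ge0 ltW. Qed.

Let cc0 := conv_const_ge0.

Lemma Gam_ge0 k : 0 <= Gam k.
Proof. by apply: le_trans (GamE k); apply: sumr_ge0 => j _; exact: sqr_ge0. Qed.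

Lemma q_ge0 k : 0 <= q k.
Proof.
elim: k => [//|k IH]; rewrite qS addr_ge0 ?Gam_ge0//.
by rewrite mulr_ge0// ltW.
Qed.

Lemma memory_bound k i : memory k i ^+ 2 <= conv_const * q k.
Proof.
apply: geometric_convolution => // l; last by rewrite qS lerD2l.
by move=> s t; rewrite mxE; exact: B_geo.
Qed.

Lemma mean_memory_bound k :
  (\sum_i pi i * memory k i) ^+ 2 <= n%:R * conv_const * q k.
Proof.
apply: le_trans (sqr_sum_le _) _; rewrite card_ord -mulrA ler_wpM2l//.
have pi1 i : pi i <= 1 by rewrite -pi_sum (bigD1 i)//= lerDl sumr_ge0.
apply: (@le_trans _ _ (\sum_i pi i * (conv_const * q k))).
  apply: ler_sum => i _; rewrite exprMn; apply: ler_pM; rewrite ?sqr_ge0 ?memory_bound//.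
  by rewrite expr2 ler_piMr.
by rewrite -mulr_suml pi_sum mul1r.
Qed.

Lemma qS_le k : q k.+1 <= q k + Gam k.
Proof. by rewrite qS lerD2r ler_piMl ?q_ge0// ltW. Qed.

Lemma sum_grad_bound k : (\sum_j G k j) ^+ 2 <= n%:R * Gam k.
Proof. by apply: le_trans (sqr_sum_le _) _; rewrite card_ord ler_wpM2l. Qed.

Lemma tracker_bound k i : Y k i ^+ 2 <= tracker_const * (Gam k + q k).
Proof.
rewrite tracker_decomposition; apply: le_trans (sqr_add3_le _ _ _) _.
rewrite sqrrN /tracker_const -mulrA ler_wpM2l// mulrDl -addrA lerD//.
  rewrite exprMn [leRHS]mulrAC [leRHS]mulrC; apply: ler_pM; rewrite ?sqr_ge0//.
    by rewrite (bigD1 i)//= lerDl sumr_ge0// => j _; exact: sqr_ge0.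
  by apply: le_trans (sum_grad_bound k) _; rewrite ler_wpM2l// lerDl q_ge0.
have h1 := memory_bound k.+1 i; have h2 := memory_bound k i.
have h3 := ler_wpM2l cc0 (qS_le k).
have h4 : conv_const * q k <= conv_const * (Gam k + q k).
  by rewrite ler_wpM2l// lerDr Gam_ge0.
have -> : 2 * conv_const * (Gam k + q k) =
  conv_const * (q k + Gam k) + conv_const * (Gam k + q k) by ring.
by apply: lerD; [exact: le_trans h1 h3|exact: le_trans h2 h4].
Qed.

Lemma consensus_bound k i : (X k i - average k) ^+ 2 <= consensus_const * w k.
Proof.
have w00 : 0 <= w 0%N by apply: le_trans w0; exact: sqr_ge0.
have Cw0 : 0 <= Cw.
  apply: le_trans CwE; apply: mulr_ge0 => //; apply: mulr_ge0 => //.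
  apply: addr_ge0; last exact: mulr_ge0.
  by apply: mulr_ge0 => //; apply: sumr_ge0 => j _; exact: sqr_ge0.
have inc0 l : 0 <= Cw * al l ^+ 2 * (Gam l + q l).
  by apply: mulr_ge0; [rewrite mulr_ge0 ?sqr_ge0|rewrite addr_ge0 ?Gam_ge0 ?q_ge0].
have wk : rho ^+ k * w 0%N <= w k.
  elim: k => [|k IH]; first by rewrite mul1r.
  rewrite wS exprS -mulrA; apply: ler_wpDr => //.
  by rewrite ler_wpM2l// ltW.
rewrite consensus_error; apply: le_trans (sqr_add2_le _ _) _.
rewrite sqrrN /consensus_const -mulrDr -mulrA ler_wpM2l// mulrDl lerD//; last first.
  apply: (geometric_convolution (h := fun l j => al l * Y l j)) => //.
  - by move=> l s t; rewrite mxE; exact: A_geo.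
  move=> l; rewrite wS lerD2l.
  apply: (@le_trans _ _ (\sum_(j < n) al l ^+ 2 * (tracker_const * (Gam l + q l)))).
    by apply: ler_sum => j _; rewrite exprMn ler_wpM2l ?sqr_ge0// tracker_bound.
  rewrite sumr_const card_ord -mulr_natl mulrCA mulrA [Cw * _]mulrC -mulrA.
  rewrite -[leRHS]mulrA ler_wpM2l ?sqr_ge0// mulrA ler_wpM2r//.
  by rewrite addr_ge0 ?Gam_ge0 ?q_ge0.
apply: (@le_trans _ _ ((C * rho ^+ k * \sum_j `|X 0%N j|) ^+ 2)).
  rewrite -[leLHS]real_normK ?num_real// lerXn2r ?nnegrE ?mulr_ge0 ?sumr_ge0 ?exprn_ge0 ?(ltW rho0)//.
  rewrite (le_trans (ler_norm_sum _ _ _))// mulr_sumr ler_sum// => j _.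
  by rewrite normrM ler_wpM2r// mxE A_geo.
rewrite exprMn exprMn -mulrA ler_wpM2l ?sqr_ge0//; apply: le_trans wk.
apply: ler_pM; rewrite ?sqr_ge0// expr2 ler_piMl ?exprn_ge0 ?(ltW rho0)//.
by rewrite exprn_ile1 ?(ltW rho0) ?(ltW rho1).
Qed.

Lemma deviation_bound k i t : (X k i - t) ^+ 2 <=
  3 * (consensus_const * w k + (corrected k - t) ^+ 2 + al k ^+ 2 * (n%:R * conv_const * q k)).
Proof.
have -> : X k i - t = (X k i - average k) + (corrected k - t)
    + (- (al k * \sum_i pi i * memory k i)) by rewrite /corrected; ring.
apply: le_trans (sqr_add3_le _ _ _) _; rewrite ler_wpM2l// sqrrN exprMn.
apply: lerD; last by rewrite ler_wpM2l ?sqr_ge0// mean_memory_bound.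
by rewrite lerD2r consensus_bound.
Qed.

Lemma corrected_gap_bound k i : (X k i - corrected k) ^+ 2 <=
  2 * (consensus_const * w k + al k ^+ 2 * (n%:R * conv_const * q k)).
Proof.
have -> : X k i - corrected k = (X k i - average k)
    + (- (al k * \sum_i pi i * memory k i)) by rewrite /corrected; ring.
apply: le_trans (sqr_add2_le _ _) _; rewrite -mulrDr ler_wpM2l// sqrrN exprMn.
by apply: lerD; [exact: consensus_bound|rewrite ler_wpM2l ?sqr_ge0// mean_memory_bound].
Qed.

Hypothesis al0 : forall k, 0 <= al k.
Hypothesis alN : forall k, al k.+1 <= al k.
Hypothesis alD : forall k, al k - al k.+1 <= Cd * al k ^+ 2.
Hypothesis Cd0 : 0 <= Cd.

(** The cross term with the memory carries the step variation, so Young's inequality makes it second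
    order. The cross term with the gradients is kept intact: only its mean is favourable. *)
Lemma corrected_step k t : (corrected k.+1 - t) ^+ 2 <=
  (1 + Cd * al k ^+ 2) * (corrected k - t) ^+ 2
  - 2 * al k * (\sum_i pi i * v i / n%:R) * ((corrected k - t) * \sum_j G k j)
  + drift_const * al k ^+ 2 * (Gam k + q k).
Proof.
set D := corrected k - t; set S := \sum_j G k j; set ga := \sum_i pi i * v i / n%:R.
set de := al k - al k.+1; set r := \sum_i pi i * memory k.+1 i.
have de0 : 0 <= de by rewrite subr_ge0.
have deD : de <= Cd * al k ^+ 2 by exact: alD.
have de2 : de ^+ 2 <= al k ^+ 2 by rewrite lerXn2r ?nnegrE// gerBl.
have -> : corrected k.+1 - t = D - al k * ga * S - de * r.
  by rewrite correctedS -/S -/ga -/r -/de /D; ring.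
have r2 : r ^+ 2 <= n%:R * conv_const * (Gam k + q k).
  apply: le_trans (mean_memory_bound _) _; apply: ler_wpM2l; first exact: mulr_ge0.
  by rewrite [leRHS]addrC qS_le.
have S2 : S ^+ 2 <= n%:R * (Gam k + q k).
  by apply: le_trans (sum_grad_bound k) _; rewrite ler_wpM2l// lerDl q_ge0.
have h1 : - (2 * de * (D * r)) <= de * (D ^+ 2 + r ^+ 2).
  by have := sqr_ge0 (D + r) => h; have := mulr_ge0 de0 h; nra.
have h2 : (al k * ga * S + de * r) ^+ 2 <= 2 * (al k * ga * S) ^+ 2 + 2 * (de * r) ^+ 2.
  exact: sqr_add2_le.
have h3 : de * (D ^+ 2 + r ^+ 2) <= Cd * al k ^+ 2 * (D ^+ 2 + r ^+ 2).
  by rewrite ler_wpM2r// addr_ge0 ?sqr_ge0.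
have h4 : Cd * al k ^+ 2 * r ^+ 2 <= Cd * al k ^+ 2 * (n%:R * conv_const * (Gam k + q k)).
  by rewrite ler_wpM2l// mulr_ge0 ?sqr_ge0.
have h5 : (de * r) ^+ 2 <= al k ^+ 2 * (n%:R * conv_const * (Gam k + q k)).
  by rewrite exprMn ler_pM ?sqr_ge0.
have h6 : (al k * ga * S) ^+ 2 <= al k ^+ 2 * ga ^+ 2 * (n%:R * (Gam k + q k)).
  by rewrite exprMn [X in X * _]exprMn ler_wpM2l// mulr_ge0 ?sqr_ge0.
have -> : (D - al k * ga * S - de * r) ^+ 2 = D ^+ 2 - 2 * al k * ga * (D * S)
   - 2 * de * (D * r) + (al k * ga * S + de * r) ^+ 2 by ring.
rewrite /drift_const -/ga.
set u := al k ^+ 2 in h3 h4 h5 h6 *; set T := Gam k + q k in h4 h5 h6 *.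
set nc := n%:R * conv_const in h4 h5 *.
have -> : ((Cd + 2) * nc + 2 * ga ^+ 2 * n%:R) * u * T =
   Cd * u * (nc * T) + 2 * (u * (nc * T)) + 2 * (u * ga ^+ 2 * (n%:R * T)) by ring.
lra.
Qed.

End coordinate_path.

(** * Measurability and moments along the iteration *)

Section iterates.
Context (R : realType) (dO : measure_display) (Omega : measurableType dO)
  (P : probability Omega R) (n d : nat) (dZ : 'I_n -> measure_display)
  (Z : forall i, measurableType (dZ i)) (g : forall i, 'cV[R]_d -> Z i -> R)
  (zeta : forall i, {RV P >-> Z i}) (zetas : nat -> forall i, {RV P >-> Z i})
  (xstar : 'cV[R]_d) (mu c p U1 : R) (Lip : forall i, Z i -> R).
Arguments g : clear implicits.
Hypothesis cs : cost_setting P g zeta.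
Hypothesis iid : iid_copies P zeta zetas.
Hypothesis oa : objective_assumption P g zeta xstar mu c p U1 Lip.

Local Notation adapted := (adapted zetas).

Lemma sqitg_dist (X : Omega -> 'cV[R]_d) (t : 'cV[R]_d) :
  (forall a, sqitg P (fun w => X w a 0)) ->
  itg P (fun w => enorm (X w - t) ^+ 2).
Proof.
move=> sX; under eq_fun do rewrite enorm_sqr.
apply: itg_sum => a; under eq_fun do rewrite colB.
by apply: (sqitgB (sX a) (sqitg_cst P (t a 0))).2.
Qed.

Lemma adapted_dist k (X : Omega -> 'cV[R]_d) (t : 'cV[R]_d) :
  (forall a, adapted k (fun w => X w a 0)) ->
  adapted k (fun w => enorm (X w - t) ^+ 2).
Proof.
move=> aX; under eq_fun do rewrite enorm_sqr.
apply: adapted_sum => a; under eq_fun do rewrite colB.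
by apply: measurable_funX; apply: measurable_funB => //; exact: aX.
Qed.

Definition grad_moment (i : 'I_n) (a : 'I_d) : R :=
  Ex P (fun w => sgrad g xstar (zeta i w) a 0 ^+ 2).
Definition lip_moment (i : 'I_n) : R := Ex P (fun w => Lip (zeta i w) ^+ 2).

Lemma lip_moment_ge0 i : 0 <= lip_moment i.
Proof. by apply: Ex_ge0 => w; exact: sqr_ge0. Qed.

Lemma grad_moment_ge0 i a : 0 <= grad_moment i a.
Proof. by apply: Ex_ge0 => w; exact: sqr_ge0. Qed.

Lemma state_grad_adapted k i a (X : Omega -> 'cV[R]_d) :
  (forall a, adapted k (fun w => X w a 0)) ->
  adapted k.+1 (fun w => sgrad g (X w) (zetas k i w) a 0).
Proof.
move=> aX; apply: (measurable_caratheodory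
   (T := g_sigma_algebraType (past zetas k.+1))
   (F := fun x w => sgrad g x (zetas k i w) a 0)).
- by move=> x; exact: (adapted_zetas (sgrad_measurable cs a x)).
- by move=> w; exact: (sgrad_continuous cs).
- by move=> b j; rewrite ord1; exact: (adapted_le (leqnSn k)) (aX b).
Qed.

(** The Lipschitz constant of the fresh sample is independent of [X], so the second moment of the
    product bound factorises. *)
Lemma state_grad_diff k i a (X : Omega -> 'cV[R]_d) :
  (forall a, adapted k (fun w => X w a 0)) ->
  (forall a, sqitg P (fun w => X w a 0)) ->
  let D w := sgrad g (X w) (zetas k i w) a 0 - sgrad g xstar (zetas k i w) a 0 in
  sqitg P D /\
  Ex P (fun w => D w ^+ 2) <= lip_moment i * Ex P (fun w => enorm (X w - xstar) ^+ 2).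
Proof.
move=> aX sX D.
have mD : measurable_fun [set: Omega] D.
  apply: measurable_funB.
    exact: (adapted_measurable (state_grad_adapted i a aX)).
  exact: (measurable_rv (zetas k i) (sgrad_measurable cs a xstar)).
have sL := Lip_sqitg oa i.
have mL : measurable_fun [set: Z i] (fun z => Lip z ^+ 2).
  by apply: measurable_funX; exact: (obj_Lip_measurable oa).
have [iE EE] := indep_mul iid (adapted_dist xstar aX) (sqitg_dist xstar sX) mL sL.2.
have DL : {ae P, forall w, D w ^+ 2 <= enorm (X w - xstar) ^+ 2 * Lip (zetas k i w) ^+ 2}.
  apply: filterS (lip_good_zetas cs iid oa k i) => w hw.
  rewrite -[leLHS]real_normK ?num_real// -exprMn lerXn2r ?nnegrE ?mulr_ge0 ?enorm_ge0//.
    exact: ltW (obj_Lip_gt0 oa _).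
  by rewrite mulrC; exact: lip_good_coord.
have sD : sqitg P D by exact: sqitg_le_ae iE DL.
split => //; rewrite mulrC -EE; apply: Ex_le_ae => //.
- exact: sD.2.
- by move=> w; exact: sqr_ge0.
- by move=> w; rewrite mulr_ge0 ?sqr_ge0.
Qed.

Lemma state_grad_moment k i a (X : Omega -> 'cV[R]_d) :
  (forall a, adapted k (fun w => X w a 0)) ->
  (forall a, sqitg P (fun w => X w a 0)) ->
  sqitg P (fun w => sgrad g (X w) (zetas k i w) a 0) /\
  Ex P (fun w => sgrad g (X w) (zetas k i w) a 0 ^+ 2) <=
    2 * lip_moment i * Ex P (fun w => enorm (X w - xstar) ^+ 2) + 2 * grad_moment i a.
Proof.
move=> aX sX; have /= [sD ED] := state_grad_diff i a aX sX.
have [sG EG] := zetas_sqitg iid k (sgrad_measurable cs a xstar) (sgrad_xstar_sqitg cs oa i a).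
set D := (fun w : Omega => _ - _) in sD ED.
have sGx : sqitg P (fun w => sgrad g (X w) (zetas k i w) a 0).
  by have := sqitgD sD sG; congr sqitg; apply/funext => w; rewrite subrK.
split; first exact: sGx.
apply: (@le_trans _ _ (Ex P (fun w => 2 * D w ^+ 2 +
   2 * sgrad g xstar (zetas k i w) a 0 ^+ 2))).
  apply: Ex_le; first exact: sGx.2.
  - by apply: itgD; apply: itgZ; [exact: sD.2|exact: sG.2].
  - move=> w; apply: le_trans (sqr_add2_le _ _).
    by rewrite subrK.
rewrite ExD; [|by apply: itgZ; exact: sD.2|by apply: itgZ; exact: sG.2].
rewrite (ExZ _ sD.2) (ExZ _ sG.2).
by rewrite EG lerD2r -mulrA ler_wpM2l.
Qed.

Context (A B : 'M[R]_n) (al : nat -> R) (x0 : 'I_n -> 'cV[R]_d)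
  (x y : 'I_n -> nat -> Omega -> 'cV[R]_d).
Hypothesis sab : SAB_iteration g zetas A B al x0 x y.

Lemma sumcE (I : Type) (s : seq I) (f : I -> 'cV[R]_d) a :
  (\sum_(i <- s) f i) a 0 = \sum_(i <- s) f i a 0.
Proof. by rewrite summxE. Qed.

Lemma SAB_coord_x k i w a : x i k.+1 w a 0 = \sum_j A i j * x j k w a 0 - al k * y i k w a 0.
Proof.
rewrite (SAB_x sab) colB [X in _ - X]mxE sumcE; congr (_ - _).
by apply: eq_bigr => j _; rewrite mxE.
Qed.

Lemma SAB_coord_y k i w a : y i k.+1 w a 0 = \sum_j B i j * y j k w a 0
  + sgrad g (x i k.+1 w) (zetas k.+1 i w) a 0 - sgrad g (x i k w) (zetas k i w) a 0.
Proof.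
rewrite (SAB_y sab) colB [X in X - _]mxE sumcE; congr (_ + _ - _).
by apply: eq_bigr => j _; rewrite mxE.
Qed.

Lemma iterates_adapted k :
  (forall i a, adapted k (fun w => x i k w a 0)) /\
  (forall i a, adapted k.+1 (fun w => y i k w a 0)).
Proof.
elim: k => [|k [IHx IHy]].
  have h i a : adapted 0 (fun w => x i 0%N w a 0).
    by under eq_fun do rewrite (SAB_x0 sab); exact: adapted_cst.
  split=> // i a; under eq_fun do rewrite (SAB_y0 sab).
  exact: state_grad_adapted.
have h i a : adapted k.+1 (fun w => x i k.+1 w a 0).
  under eq_fun do rewrite SAB_coord_x.
  apply: adaptedB; last by apply: adaptedM => //; exact: adapted_cst.
  apply: adapted_sum => j; apply: adaptedM; first exact: adapted_cst.
  exact: (adapted_le (leqnSn k)) (IHx j a).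
split=> // i a; under eq_fun do rewrite SAB_coord_y.
apply: adaptedB; last first.
  by apply: (adapted_le (leqnSn _)); exact: state_grad_adapted.
apply: adaptedD; last exact: state_grad_adapted.
apply: adapted_sum => j; apply: adaptedM; first exact: adapted_cst.
exact: (adapted_le (leqnSn _)) (IHy j a).
Qed.

Lemma iterates_sqitg k :
  (forall i a, sqitg P (fun w => x i k w a 0)) /\
  (forall i a, sqitg P (fun w => y i k w a 0)).
Proof.
elim: k => [|k [IHx IHy]].
  have h i a : sqitg P (fun w => x i 0%N w a 0).
    by under eq_fun do rewrite (SAB_x0 sab); exact: sqitg_cst.
  split=> // i a; under eq_fun do rewrite (SAB_y0 sab).
  by apply: (state_grad_moment i a _ _).1 => // b; exact: (iterates_adapted 0).1.
have h i a : sqitg P (fun w => x i k.+1 w a 0).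
  under eq_fun do rewrite SAB_coord_x.
  by apply: sqitgB; [apply: sqitg_sum => j|]; apply: sqitgZ.
split=> // i a; under eq_fun do rewrite SAB_coord_y.
apply: sqitgB.
  apply: sqitgD; first by apply: sqitg_sum => j; exact: sqitgZ.
  by apply: (state_grad_moment i a _ _).1 => // b; exact: (iterates_adapted k.+1).1.
by apply: (state_grad_moment i a _ _).1 => // b; exact: (iterates_adapted k).1.
Qed.

Lemma grad_adapted k i a : adapted k.+1 (fun w => sgrad g (x i k w) (zetas k i w) a 0).
Proof. by apply: state_grad_adapted => b; exact: (iterates_adapted k).1. Qed.

Lemma grad_sqitg k i a : sqitg P (fun w => sgrad g (x i k w) (zetas k i w) a 0).
Proof.
by apply: (state_grad_moment i a _ _).1 => b;
  [exact: (iterates_adapted k).1|exact: (iterates_sqitg k).1].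
Qed.

End iterates.

Fixpoint affine_seq (R : realType) (rho s0 : R) (f : nat -> R) (k : nat) : R :=
  if k is k'.+1 then rho * affine_seq rho s0 f k' + f k' else s0.

(** The weights are such that [N] summands together cost [r / 2 * D ^+ 2]. With [r = mu] and one
    summand per agent, half of the strong monotonicity survives. *)
Lemma weighted_young (R : realType) (D m1 m2 t r N : R) : 0 < r -> 0 < N ->
  `|m2 - m1| <= t -> D * (m1 - m2) <= r / (2 * N) * D ^+ 2 + N / (2 * r) * t ^+ 2.
Proof.
move=> r0 N0 ht; have t0 : 0 <= t by exact: le_trans ht.
have hm : (m1 - m2) ^+ 2 <= t ^+ 2.
  by rewrite -[leLHS]real_normK ?num_real// lerXn2r ?nnegrE// distrC.
have h3 : 0 <= (r * D - N * (m1 - m2)) ^+ 2 by exact: sqr_ge0.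
have nm : 0 < 2 * N * r by rewrite !mulr_gt0.
have -> : r / (2 * N) * D ^+ 2 + N / (2 * r) * t ^+ 2 =
   (r ^+ 2 * D ^+ 2 + N ^+ 2 * t ^+ 2) / (2 * N * r) by field; rewrite !gt_eqF.
rewrite ler_pdivlMr//.
have h4 : N ^+ 2 * (m1 - m2) ^+ 2 <= N ^+ 2 * t ^+ 2 by rewrite ler_wpM2l// sqr_ge0.
by nra.
Qed.

Lemma half_margin (R : realType) (S1 S2 S3 e t m : R) :
  m * e <= S1 -> S1 - S2 <= S3 -> S3 <= m / 2 * e + t -> m / 2 * e - t <= S2.
Proof. by lra. Qed.

Lemma drift_combine (R : realType) (s t D m K T E S b : R) :
  2 * s * t * (m / 2 * D - K * T) <= 2 * s * t * S ->
  (1 + b) * D - 2 * s * t * S + E <= (1 - t * m * s + b) * D + 2 * t * K * s * T + E.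
Proof. by lra. Qed.

Lemma six_le_sum (R : realType) (S a1 a2 a3 a4 a5 a6 : R) : S = a1 + a2 + a3 + a4 + a5 + a6 ->
  0 <= a1 -> 0 <= a2 -> 0 <= a3 -> 0 <= a4 -> 0 <= a5 -> 0 <= a6 ->
  0 <= S /\ [/\ a1 <= S, a2 <= S, a3 <= S & [/\ a4 <= S, a5 <= S & a6 <= S]].
Proof. by move=> -> *; split; [lra|split; [lra..|split; lra]]. Qed.

(** * Recursions in expectation *)

Section mean_square_convergence.
Context (R : realType) (dO : measure_display) (Omega : measurableType dO)
  (P : probability Omega R) (n d : nat) (dZ : 'I_n -> measure_display)
  (Z : forall i, measurableType (dZ i)) (g : forall i, 'cV[R]_d -> Z i -> R)
  (zeta : forall i, {RV P >-> Z i}) (zetas : nat -> forall i, {RV P >-> Z i})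
  (xstar : 'cV[R]_d) (mu c p U1 : R) (Lip : forall i, Z i -> R).
Arguments g : clear implicits.
Hypothesis cs : cost_setting P g zeta.
Hypothesis iid : iid_copies P zeta zetas.
Hypothesis oa : objective_assumption P g zeta xstar mu c p U1 Lip.
Context (A B : 'M[R]_n) (al : nat -> R) (x0 : 'I_n -> 'cV[R]_d)
  (x y : 'I_n -> nat -> Omega -> 'cV[R]_d).
Hypothesis sab : SAB_iteration g zetas A B al x0 x y.
Context (pi v : 'I_n -> R) (C rho Cd : R).
Hypothesis n0 : (0 < n)%N.
Hypothesis pi_sum : \sum_i pi i = 1.
Hypothesis pi_ge0 : forall i, 0 <= pi i.
Hypothesis piA : forall j, \sum_i pi i * A i j = pi j.
Hypothesis Bv : forall i, \sum_j B i j * v j = v i.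
Hypotheses (C0 : 0 <= C) (rho0 : 0 < rho) (rho1 : rho < 1).
Hypothesis A_geo : forall k i j, `|(A ^+ k) i j - pi j| <= C * rho ^+ k.
Hypothesis B_geo : forall k i j, `|(B ^+ k) i j - v i / n%:R| <= C * rho ^+ k.
Hypothesis ga0 : 0 < \sum_i pi i * v i / n%:R.
Hypothesis al_gt0 : forall k, 0 < al k.
Hypothesis alN : forall k, al k.+1 <= al k.
Hypothesis alD : forall k, al k - al k.+1 <= Cd * al k ^+ 2.
Hypothesis Cd0 : 0 <= Cd.
Hypothesis al_cvg0 : al @ \oo --> 0.
Hypothesis al_dvg : (\sum_(l < k) al l) @[k --> \oo] --> +oo.

Local Notation adapted := (adapted zetas).

Let Xc w (a : 'I_d) k i := x i k w a 0.
Let Yc w (a : 'I_d) k i := y i k w a 0.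
Let Gc w (a : 'I_d) k i := sgrad g (x i k w) (zetas k i w) a 0.
Let zc w a k := corrected B pi v al (Xc w a) (Gc w a) k.
Let Zv k w : 'cV[R]_d := \col_a zc w a k.
(** Summed over all coordinates, so that [q] and [ww] are the same sequences whichever coordinate
    the pathwise bounds are applied to. *)
Let Gam w k := \sum_a \sum_i Gc w a k i ^+ 2.
Let q w k := affine_seq rho 0 (Gam w) k.
Let Cw : R := n%:R * tracker_const v C rho.
Let W0 : R := \sum_a (\sum_j `|x0 j a 0|) ^+ 2.
Let ww w k := affine_seq rho W0 (fun k => Cw * al k ^+ 2 * (Gam w k + q w k)) k.

Let Y0 w a i : Yc w a 0%N i = Gc w a 0%N i.
Proof. by rewrite /Yc /Gc (SAB_y0 sab). Qed.

Let XS w a k i : Xc w a k.+1 i = \sum_j A i j * Xc w a k j - al k * Yc w a k i.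
Proof. exact: (SAB_coord_x sab). Qed.

Let YS w a k i : Yc w a k.+1 i = \sum_j B i j * Yc w a k j + Gc w a k.+1 i - Gc w a k i.
Proof. exact: (SAB_coord_y sab). Qed.

Let GamE w a k : \sum_j Gc w a k j ^+ 2 <= Gam w k.
Proof.
rewrite /Gam (bigD1 a)//= lerDl sumr_ge0// => b _; rewrite sumr_ge0// => i _.
exact: sqr_ge0.
Qed.

Let w0P w a : (\sum_j `|Xc w a 0%N j|) ^+ 2 <= ww w 0%N.
Proof.
have -> : \sum_j `|Xc w a 0%N j| = \sum_j `|x0 j a 0|.
  by apply: eq_bigr => j _; rewrite /Xc (SAB_x0 sab).
by rewrite /ww /= /W0 (bigD1 a)//= lerDl sumr_ge0// => b _; exact: sqr_ge0.
Qed.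

Let Gam0 w k : 0 <= Gam w k.
Proof. by apply: sumr_ge0 => a _; apply: sumr_ge0 => i _; exact: sqr_ge0. Qed.

Let q_ge0 w k : 0 <= q w k.
Proof. by elim: k => [//|k IH] /=; rewrite addr_ge0// mulr_ge0// ltW. Qed.

Let cc := @conv_const R n C rho.
Let kc := @consensus_const R n C rho.
Let cc0 : 0 <= cc.
Proof. exact: conv_const_ge0. Qed.

Let kc0 : 0 <= kc.
Proof. by apply: mulr_ge0 => //; apply: addr_ge0 => //; exact: sqr_ge0. Qed.

Let Cw0 : 0 <= Cw.
Proof.
apply: mulr_ge0 => //; apply: mulr_ge0 => //; apply: addr_ge0; last exact: mulr_ge0.
by apply: mulr_ge0 => //; apply: sumr_ge0 => j _; exact: sqr_ge0.
Qed.

Let ww_ge0 w k : 0 <= ww w k.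
Proof.
elim: k => [|k IH] /=; first by apply: sumr_ge0 => a _; exact: sqr_ge0.
apply: addr_ge0; first by apply: mulr_ge0 => //; exact: ltW.
by apply: mulr_ge0; [apply: mulr_ge0 => //; exact: sqr_ge0|exact: addr_ge0].
Qed.

Let deviation w k i t : enorm (x i k w - t) ^+ 2 <=
  3 * (d%:R * kc * ww w k + enorm (Zv k w - t) ^+ 2 + al k ^+ 2 * (d%:R * n%:R * cc * q w k)).
Proof.
rewrite !enorm_sqr.
apply: (@le_trans _ _ (\sum_(a < d) 3 * (kc * ww w k + (zc w a k - t a 0) ^+ 2
    + al k ^+ 2 * (n%:R * cc * q w k)))).
  apply: ler_sum => a _; rewrite colB.
  exact: (deviation_bound pi_sum pi_ge0 piA Bv C0 rho0 rho1 A_geo B_geo (Y0 w a)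
    (XS w a) (YS w a) (q := q w) (w := ww w) (Gam := Gam w) (Cw := Cw)).
rewrite -mulr_sumr !big_split/= !sumr_const card_ord.
rewrite le_eqVlt; apply/orP; left; apply/eqP; congr (3 * (_ + _ + _)).
- by rewrite -[LHS]mulr_natl; ring.
- by apply: eq_bigr => a _; rewrite colB mxE.
- by rewrite -[LHS]mulr_natl; ring.
Qed.

Let gap w k i : enorm (x i k w - Zv k w) ^+ 2 <=
  2 * (d%:R * (kc + n%:R * cc)) * (ww w k + al k ^+ 2 * q w k).
Proof.
rewrite enorm_sqr.
apply: (@le_trans _ _ (\sum_(a < d) 2 * (kc * ww w k + al k ^+ 2 * (n%:R * cc * q w k)))).
  apply: ler_sum => a _; rewrite colB mxE.
  exact: (corrected_gap_bound pi_sum pi_ge0 piA Bv C0 rho0 rho1 A_geo B_geo (Y0 w a)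
    (XS w a) (YS w a) (q := q w) (w := ww w) (Gam := Gam w) (Cw := Cw)).
rewrite sumr_const card_ord -[leLHS]mulr_natl.
set s := al k ^+ 2 * q w k.
have s0 : 0 <= s by rewrite mulr_ge0 ?sqr_ge0.
have -> : al k ^+ 2 * (n%:R * cc * q w k) = n%:R * cc * s by rewrite /s; ring.
have -> : d%:R * (2 * (kc * ww w k + n%:R * cc * s)) =
  2 * (d%:R * (kc * ww w k + n%:R * cc * s)) by ring.
have -> : 2 * (d%:R * (kc + n%:R * cc)) * (ww w k + s) =
   2 * (d%:R * ((kc + n%:R * cc) * (ww w k + s))) by ring.
rewrite ler_wpM2l// ler_wpM2l//.
have h1 : 0 <= kc * s by exact: mulr_ge0.
have h2 : 0 <= n%:R * cc * ww w k by apply: mulr_ge0 => //; exact: mulr_ge0.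
by rewrite mulrDl !mulrDr; lra.
Qed.

Let memory_adapted a k i : adapted k (fun w => memory B v (Gc w a) k i).
Proof.
apply: adapted_sum => l; apply: adapted_sum => j; apply: adaptedM.
  exact: adapted_cst.
by apply: (adapted_le (ltn_ord l)); exact: (grad_adapted cs sab).
Qed.

Let memory_sqitg a k i : sqitg P (fun w => memory B v (Gc w a) k i).
Proof.
apply: sqitg_sum => l; apply: sqitg_sum => j; apply: sqitgZ.
exact: (grad_sqitg cs iid oa sab).
Qed.

Let zc_adapted a k : adapted k (fun w => zc w a k).
Proof.
apply: adaptedD.
  apply: adapted_sum => i; apply: adaptedM; first exact: adapted_cst.
  exact: (iterates_adapted cs sab k).1.
apply: adaptedM; first exact: adapted_cst.
apply: adapted_sum => i; apply: adaptedM; first exact: adapted_cst.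
exact: memory_adapted.
Qed.

Let zc_sqitg a k : sqitg P (fun w => zc w a k).
Proof.
apply: sqitgD.
  by apply: sqitg_sum => i; apply: sqitgZ; exact: (iterates_sqitg cs iid oa sab k).1.
by apply: sqitgZ; apply: sqitg_sum => i; apply: sqitgZ; exact: memory_sqitg.
Qed.

Let Gam_itg k : itg P (fun w => Gam w k).
Proof.
apply: itg_sum => a; apply: itg_sum => i.
exact: (grad_sqitg cs iid oa sab k i a).2.
Qed.

Let q_itg k : itg P (fun w => q w k).
Proof.
elim: k => [|k IH] /=; first exact: itg_cst.
by apply: itgD => //; exact: itgZ.
Qed.

Let ww_itg k : itg P (fun w => ww w k).
Proof.
elim: k => [|k IH] /=; first exact: itg_cst.
by apply: itgD; apply: itgZ => //; exact: itgD.
Qed.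

Let dist_itg k t : itg P (fun w => enorm (Zv k w - t) ^+ 2).
Proof.
apply: sqitg_dist => a; have := zc_sqitg a k.
by congr sqitg; apply/funext => w; rewrite mxE.
Qed.

Let DD k := Ex P (fun w => enorm (Zv k w - xstar) ^+ 2).
Let WW k := Ex P (fun w => ww w k).
Let QQ k := Ex P (fun w => q w k).
Let GG k := Ex P (fun w => Gam w k).

Let X_itg i k t : itg P (fun w => enorm (x i k w - t) ^+ 2).
Proof. by apply: sqitg_dist => a; exact: (iterates_sqitg cs iid oa sab k).1. Qed.

Let Kdev : R := 3 * (d%:R * kc + 1 + d%:R * n%:R * cc).
Let Kdev0 : 0 <= Kdev.
Proof.
apply: mulr_ge0 => //; apply: addr_ge0.
  by apply: addr_ge0 => //; exact: mulr_ge0.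
by apply: mulr_ge0 => //; exact: mulr_ge0.
Qed.

Let mean_deviation i k :
  Ex P (fun w => enorm (x i k w - xstar) ^+ 2) <= Kdev * (DD k + WW k + al k ^+ 2 * QQ k).
Proof.
have -> : Kdev * (DD k + WW k + al k ^+ 2 * QQ k) =
  Ex P (fun w => Kdev * (enorm (Zv k w - xstar) ^+ 2 + ww w k + al k ^+ 2 * q w k)).
  have i1 := itgD (dist_itg k xstar) (ww_itg k).
  have i2 := itgZ (al k ^+ 2) (q_itg k).
  by rewrite ExZ ?ExD ?ExZ//; exact: itgD.
apply: Ex_le => //.
  apply: itgZ; apply: itgD; last exact: itgZ.
  exact: itgD.
move=> w; apply: le_trans (deviation w k i xstar) _; rewrite /Kdev.
set D := enorm _ ^+ 2; set s := al k ^+ 2 * q w k.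
have D0 : 0 <= D by exact: sqr_ge0.
have s0 : 0 <= s by rewrite mulr_ge0 ?sqr_ge0.
have W0' := ww_ge0 w k.
have a1 : 0 <= d%:R * kc by exact: mulr_ge0.
have a2 : 0 <= d%:R * n%:R * cc by apply: mulr_ge0 => //; exact: mulr_ge0.
have -> : al k ^+ 2 * (d%:R * n%:R * cc * q w k) = d%:R * n%:R * cc * s by rewrite /s; ring.
rewrite -[leRHS]mulrA ler_wpM2l//.
move: a1 a2; set u := d%:R * kc; set t := d%:R * n%:R * cc => a1 a2.
have := mulr_ge0 a1 D0; have := mulr_ge0 a1 s0; have := mulr_ge0 a2 D0; have := mulr_ge0 a2 W0'.
by nra.
Qed.

Let Kg1 : R := \sum_(a < d) \sum_i 2 * lip_moment zeta Lip i * Kdev.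
Let Kg2 : R := \sum_(a < d) \sum_i 2 * grad_moment g zeta xstar i a.

(** The feedback that couples the recursions: the gradient moments are bounded only in terms of the
    error quantities themselves. *)
Let mean_grad k : GG k <= Kg1 * (DD k + WW k + al k ^+ 2 * QQ k) + Kg2.
Proof.
rewrite /GG /Gam /Kg1 /Kg2 mulr_suml -big_split/= Ex_sum; last first.
  move=> a; apply: itg_sum => i; exact: (grad_sqitg cs iid oa sab k i a).2.
apply: ler_sum => a _; rewrite mulr_suml -big_split/= Ex_sum; last first.
  move=> i; exact: (grad_sqitg cs iid oa sab k i a).2.
apply: ler_sum => i _.
have [_ h] := state_grad_moment cs iid oa i a ((iterates_adapted cs sab k).1 i)
  ((iterates_sqitg cs iid oa sab k).1 i).
apply: le_trans h _; rewrite lerD2r -[leRHS]mulrA; apply: ler_wpM2l.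
  by apply: mulr_ge0 => //; exact: lip_moment_ge0.
exact: mean_deviation.
Qed.

Let EL i := Ex P (fun w => Lip (zeta i w)).
Let Kip : R := d%:R * (n%:R / (2 * mu)) * (\sum_i EL i ^+ 2) * (2 * (d%:R * (kc + n%:R * cc))).

Let mu0 : 0 < mu. Proof. exact: obj_mu_gt0 oa. Qed.
Let nR0 : 0 < n%:R :> R. Proof. by rewrite ltr0n. Qed.

Let Kip0 : 0 <= Kip.
Proof.
apply: mulr_ge0; last by rewrite !mulr_ge0// addr_ge0// mulr_ge0.
apply: mulr_ge0; last by apply: sumr_ge0 => i _; exact: sqr_ge0.
by rewrite mulr_ge0// divr_ge0// mulr_ge0// ltW.
Qed.

(** The mean gradients are taken at the agents' own iterates, monotonicity holds at [Zv]. The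
    Lipschitz cost of moving the evaluation point is split by [weighted_young] into half of the
    monotone term and the consensus and memory errors. *)
Let drift_pointwise k w :
  mu / 2 * enorm (Zv k w - xstar) ^+ 2 - Kip * (ww w k + al k ^+ 2 * q w k) <=
  \sum_a (zc w a k - xstar a 0) * \sum_j mgrad g zeta j a (x j k w).
Proof.
set Zk := Zv k w; pose D (a : 'I_d) : R := (Zk - xstar) a 0.
have DE a : zc w a k - xstar a 0 = D a by rewrite /D colB mxE.
have h1 := mgrad_monotone cs oa Zk.
have h2 : \sum_a D a * (\sum_j mgrad g zeta j a Zk) - \sum_a D a * (\sum_j mgrad g zeta j a (x j k w))
   <= \sum_a \sum_j (mu / (2 * n%:R) * D a ^+ 2 + n%:R / (2 * mu) * (EL j ^+ 2 * enorm (x j k w - Zk) ^+ 2)).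
  rewrite -sumrB; apply: ler_sum => a _; rewrite -mulrBr -sumrB mulr_sumr.
  apply: ler_sum => j _.
  have hL := mgrad_lipschitz cs oa j a (x j k w) Zk; rewrite -/(EL j) in hL.
  by rewrite -exprMn; apply: weighted_young.
have h3 : \sum_a \sum_j (mu / (2 * n%:R) * D a ^+ 2 + n%:R / (2 * mu) * (EL j ^+ 2 * enorm (x j k w - Zk) ^+ 2))
   <= mu / 2 * enorm (Zk - xstar) ^+ 2 + Kip * (ww w k + al k ^+ 2 * q w k).
  under eq_bigr do rewrite big_split/= sumr_const card_ord -[_ *+ n]mulr_natl.
  rewrite big_split/= sumr_const card_ord; apply: lerD.
    rewrite enorm_sqr mulr_sumr; apply: ler_sum => a _; rewrite -/(D a).
    by rewrite le_eqVlt; apply/orP; left; apply/eqP; field; rewrite !gt_eqF.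
  rewrite -mulr_sumr -[leLHS]mulr_natl /Kip.
  set S := \sum_i EL i ^+ 2; set T := ww w k + _; set e := 2 * (d%:R * _).
  have hS : \sum_j EL j ^+ 2 * enorm (x j k w - Zk) ^+ 2 <= S * (e * T).
    rewrite mulr_suml; apply: ler_sum => j _; apply: ler_wpM2l; first exact: sqr_ge0.
    exact: gap.
  have -> : d%:R * (n%:R / (2 * mu)) * S * e * T = d%:R * (n%:R / (2 * mu) * (S * (e * T))).
    by rewrite !mulrA.
  apply: ler_wpM2l => //; apply: ler_wpM2l => //.
  by apply: divr_ge0 => //; apply: mulr_ge0 => //; exact: ltW.
under eq_bigr do rewrite DE.
exact: half_margin h1 h2 h3.
Qed.

(** [Zv k] depends on the past only, so [freezing_state] replaces the sampled gradients by mean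
    gradients at the current iterates. *)
Let drift_mean k :
  mu / 2 * DD k - Kip * (WW k + al k ^+ 2 * QQ k) <=
  Ex P (fun w => \sum_a (zc w a k - xstar a 0) * \sum_j Gc w a k j).
Proof.
have sD a : sqitg P (fun w => zc w a k - xstar a 0) by apply: sqitgB => //; exact: sqitg_cst.
have aD a : adapted k (fun w => zc w a k - xstar a 0) by apply: adaptedB => //; exact: adapted_cst.
have sG j a := grad_sqitg cs iid oa sab k j a.
have fr a j : itg P (fun w => (zc w a k - xstar a 0) * mgrad g zeta j a (x j k w)) /\
   Ex P (fun w => (zc w a k - xstar a 0) * Gc w a k j) =
   Ex P (fun w => (zc w a k - xstar a 0) * mgrad g zeta j a (x j k w)).
  apply: (freezing_state iid (Phi := fun t z => sgrad g t z a 0) (X := x j k)).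
  - have m1 t : measurable_fun [set: Z j] (fun z => sgrad g t z a 0).
      exact: (sgrad_measurable cs).
    have m2 (z : Z j) : continuous (fun t => sgrad g t z a 0).
      exact: (sgrad_continuous cs).
    have m3 b : adapted k (fun w => x j k w b 0) by exact: (iterates_adapted cs sab k).1.
    exact: (measurable_frozen m1 m2 m3).
  - exact: aD.
  - by move=> t; exact: sqitg_itg (sgrad_sqitg cs oa j a t).
  - exact: (sqitg_mul (sD a) (sG j a)).
have -> : Ex P (fun w => \sum_a (zc w a k - xstar a 0) * \sum_j Gc w a k j) =
  Ex P (fun w => \sum_a \sum_j (zc w a k - xstar a 0) * mgrad g zeta j a (x j k w)).
  have -> : (fun w => \sum_a (zc w a k - xstar a 0) * \sum_j Gc w a k j) =
     (fun w => \sum_a \sum_j (zc w a k - xstar a 0) * Gc w a k j).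
    by apply/funext => w; apply: eq_bigr => a _; rewrite mulr_sumr.
  rewrite Ex_sum; last by move=> a; apply: itg_sum => j; exact: (sqitg_mul (sD a) (sG j a)).
  rewrite Ex_sum; last by move=> a; apply: itg_sum => j; exact: (fr a j).1.
  apply: eq_bigr => a _.
  rewrite Ex_sum; last by move=> j; exact: (sqitg_mul (sD a) (sG j a)).
  rewrite Ex_sum; last by move=> j; exact: (fr a j).1.
  by apply: eq_bigr => j _; exact: (fr a j).2.
have i1 : itg P (fun w => ww w k + al k ^+ 2 * q w k) by apply: itgD => //; exact: itgZ.
have -> : mu / 2 * DD k - Kip * (WW k + al k ^+ 2 * QQ k) =
   Ex P (fun w => mu / 2 * enorm (Zv k w - xstar) ^+ 2 - Kip * (ww w k + al k ^+ 2 * q w k)).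
  rewrite ExB; [|exact: itgZ|exact: itgZ].
  by rewrite !ExZ// ExD ?ExZ//; exact: itgZ.
apply: Ex_le.
- by apply: itgB; exact: itgZ.
- by apply: itg_sum => a; apply: itg_sum => j; exact: (fr a j).1.
- move=> w; apply: le_trans (drift_pointwise k w) _.
  by apply: ler_sum => a _; rewrite mulr_sumr.
Qed.

Let ga := \sum_i pi i * v i / n%:R.
Let dc := drift_const pi v C rho Cd.
Let dc0 : 0 <= dc.
Proof.
apply: addr_ge0; last by apply: mulr_ge0 => //; apply: mulr_ge0 => //; exact: sqr_ge0.
by apply: mulr_ge0; [exact: addr_ge0|exact: mulr_ge0].
Qed.

Let DS k : DD k.+1 <= (1 - ga * mu * al k + Cd * al k ^+ 2) * DD k
  + 2 * ga * Kip * al k * (WW k + al k ^+ 2 * QQ k) + d%:R * dc * al k ^+ 2 * (GG k + QQ k).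
Proof.
pose S w := \sum_a (zc w a k - xstar a 0) * \sum_j Gc w a k j.
have iS : itg P S.
  apply: itg_sum => a; apply: sqitg_mul.
    by apply: sqitgB => //; exact: sqitg_cst.
  by apply: sqitg_sum => j; exact: (grad_sqitg cs iid oa sab).
have pw w : enorm (Zv k.+1 w - xstar) ^+ 2 <=
   (1 + Cd * al k ^+ 2) * enorm (Zv k w - xstar) ^+ 2 - 2 * al k * ga * S w
   + d%:R * dc * al k ^+ 2 * (Gam w k + q w k).
  rewrite !enorm_sqr.
  apply: (@le_trans _ _ (\sum_(a < d) ((1 + Cd * al k ^+ 2) * (zc w a k - xstar a 0) ^+ 2
     - 2 * al k * ga * ((zc w a k - xstar a 0) * \sum_j Gc w a k j)
     + dc * al k ^+ 2 * (Gam w k + q w k)))).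
    apply: ler_sum => a _; rewrite colB mxE.
    exact: (corrected_step pi_sum pi_ge0 piA Bv C0 rho0 rho1 B_geo (Y0 w a)
      (XS w a) (YS w a) (q := q w) (Gam := Gam w) (lexx 0) (fun=> erefl) (GamE w a)
      (fun k => ltW (al_gt0 k))).
  rewrite big_split/= sumrB -!mulr_sumr sumr_const card_ord.
  rewrite le_eqVlt; apply/orP; left; apply/eqP; congr (_ * _ - _ + _).
    by apply: eq_bigr => a _; rewrite colB mxE.
  by rewrite -[_ *+ d]mulr_natl mulrCA !mulrA.
have iGq : itg P (fun w => Gam w k + q w k) by exact: itgD.
apply: le_trans (Ex_le (dist_itg k.+1 xstar) _ pw) _.
  apply: itgD; last exact: itgZ.
  by apply: itgB; exact: itgZ.
rewrite ExD; [|by apply: itgB; exact: itgZ|exact: itgZ].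
rewrite ExB; [|exact: itgZ|exact: itgZ].
rewrite !ExZ// ExD// -/(DD k) -/(GG k) -/(QQ k).
have hS := drift_mean k; rewrite -/(Ex P S) in hS.
have ag0 : 0 <= 2 * al k * ga by rewrite !mulr_ge0// ltW.
exact: drift_combine (ler_wpM2l ag0 hS).
Qed.

Lemma iterates_mean_square_cvg i :
  (fun k => Ex P (fun w => enorm (x i k w - xstar) ^+ 2)) @ \oo --> 0.
Proof.
have DD0 k : 0 <= DD k by apply: Ex_ge0 => w; exact: sqr_ge0.
have WW0 k : 0 <= WW k by apply: Ex_ge0 => w.
have QQ0 k : 0 <= QQ k by apply: Ex_ge0 => w.
have GG0 k : 0 <= GG k by apply: Ex_ge0 => w.
have Kg10 : 0 <= Kg1.
  apply: sumr_ge0 => a _; apply: sumr_ge0 => j _.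
  by apply: mulr_ge0 => //; apply: mulr_ge0 => //; exact: lip_moment_ge0.
have Kg20 : 0 <= Kg2.
  apply: sumr_ge0 => a _; apply: sumr_ge0 => j _.
  by apply: mulr_ge0 => //; exact: grad_moment_ge0.
have gaK0 : 0 <= 2 * ga * Kip.
  by apply: mulr_ge0 => //; apply: mulr_ge0 => //; exact: ltW.
have ddc0 : 0 <= d%:R * dc by exact: mulr_ge0.
(* A sum of nonnegative constants dominates each of them, so one constant serves all four
   recursions. *)
pose K := Cd + 2 * ga * Kip + d%:R * dc + Cw + Kg1 + Kg2.
have [K0 [K1 K2 K3 [K4 K5 K6]]] := six_le_sum (erefl K) Cd0 gaK0 ddc0 Cw0 Kg10 Kg20.
have s0 k : 0 <= al k ^+ 2 * QQ k by rewrite mulr_ge0 ?sqr_ge0.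
have T0 k : 0 <= WW k + al k ^+ 2 * QQ k by rewrite addr_ge0.
have U0 k : 0 <= GG k + QQ k by rewrite addr_ge0.
have cvg : (fun k => DD k + WW k + al k ^+ 2 * QQ k) @ \oo --> 0.
  apply: (@coupled_recursions_cvg0 R DD WW QQ GG al (ga * mu) K rho) => //.
  - exact: mulr_gt0.
  - move=> k; apply: le_trans (DS k) _.
    have a2 : 0 <= al k ^+ 2 by exact: sqr_ge0.
    have a1 := ltW (al_gt0 k).
    apply: lerD; first apply: lerD.
    + by apply: ler_wpM2r => //; rewrite lerD2l; exact: ler_wpM2r.
    + by apply: ler_wpM2r => //; exact: ler_wpM2r.
    + by apply: ler_wpM2r => //; exact: ler_wpM2r.
  - move=> k; have iGq : itg P (fun w => Gam w k + q w k) by exact: itgD.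
    have -> : WW k.+1 = Ex P (fun w => rho * ww w k + Cw * al k ^+ 2 * (Gam w k + q w k)) by [].
    rewrite ExD; [|exact: itgZ|exact: itgZ].
    rewrite !ExZ// ExD// lerD2l; apply: ler_wpM2r; first exact: (U0 k).
    by apply: ler_wpM2r => //; exact: sqr_ge0.
  - move=> k; have -> : QQ k.+1 = Ex P (fun w => rho * q w k + Gam w k) by [].
    by rewrite ExD ?ExZ//; exact: itgZ.
  - move=> k; apply: le_trans (mean_grad k) _.
    have V0 : 0 <= DD k + WW k + al k ^+ 2 * QQ k by rewrite -addrA addr_ge0.
    have -> : 1 + WW k + DD k + al k ^+ 2 * QQ k = 1 + (DD k + WW k + al k ^+ 2 * QQ k) by ring.
    rewrite [leRHS]mulrDr [K * 1]mulr1 [leLHS]addrC; apply: lerD => //; exact: ler_wpM2r.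
apply: (@squeeze_cvgr _ _ _ _ (fun=> 0) (fun k => Kdev * (DD k + WW k + al k ^+ 2 * QQ k))).
- by apply: nearW => k; rewrite mean_deviation andbT Ex_ge0// => w; exact: sqr_ge0.
- exact: cvg_cst.
- by rewrite -(mulr0 Kdev); apply: cvgMr.
Qed.

End mean_square_convergence.

(** * The plug-in estimates *)

Lemma primitive_pow (R : realType) (n : nat) (A : 'M[R]_n) :
  (forall i j, 0 <= A i j) -> (forall i, 0 < A i i) ->
  strongly_connected (induced_graph A) ->
  exists2 m, (0 < m)%N & forall i j, 0 < (A ^+ m) i j.
Proof.
move=> A0 Ad sc.
have ex r : exists m, forall i, 0 < (A ^+ m) i r.
  by have [m _ h] := rooted_pow_gt0 A0 Ad (sc r); exists m.
have [m mP] := choice ex.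
exists (\max_r m r).+1 => // i j; apply: diag_pow_gt0 (mP j i) => //.
by rewrite ltnW// ltnS; apply: leq_bigmax.
Qed.

(** The plug-in recursions divide by these diagonal entries. From time [m] on, [A^l] is a stochastic
    matrix times the positive [A^m]; the finitely many earlier powers have a positive diagonal. *)
Lemma primitive_diag_lbound (R : realType) (n : nat) (A : 'M[R]_n) m :
  row_stochastic A -> (forall i, 0 < A i i) -> (forall i j, 0 < (A ^+ m) i j) ->
  exists2 kap : R, 0 < kap & forall l i, kap <= (A ^+ l) i i.
Proof.
move=> sA Ad Am; have [A0 _] := sA.
have row i : exists e : R, 0 < e /\ forall j, e <= (A ^+ m) i j.
  by have [e /andP[e0 _] h] := fin_pos_lbound (Am i); exists e.
have [f /all_and2[f0 fA]] := choice row.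
have [e1 /andP[e10 _] h1] := fin_pos_lbound f0.
have dl (l : 'I_m) : exists e : R, 0 < e /\ forall i, e <= (A ^+ l) i i.
  have d0 i : 0 < (A ^+ l) i i.
    by apply: (@diag_pow_gt0 _ _ _ _ _ 0 l) => //; rewrite expr0 mxE eqxx.
  by have [e /andP[e0 _] h] := fin_pos_lbound d0; exists e.
have [h /all_and2[h0 hA]] := choice dl.
have [e2 /andP[e20 _] h2] := fin_pos_lbound h0.
exists (Num.min e1 e2); first by rewrite lt_min e10.
move=> l i; rewrite ge_min; have [lm|ml] := ltnP l m.
  by rewrite (le_trans (h2 (Ordinal lm)) (hA _ _)) orbT.
apply/orP; left; rewrite -(subnK ml) exprD mxE.
apply: (@le_trans _ _ (\sum_j (A ^+ (l - m)) i j * e1)).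
  by rewrite -mulr_suml (row_stochastic_sum (row_stochasticX _ sA)) mul1r.
apply: ler_sum => j _; apply: ler_wpM2l; first by case: (row_stochasticX (l - m) sA).
exact: le_trans (h1 j) (fA j i).
Qed.

Section averages.
Context (R : realType) (d : measure_display) (T : measurableType d)
  (P : probability T R).

Lemma cesaro_cvg0 (u : nat -> R) : (forall k, 0 <= u k) -> u @ \oo --> 0 ->
  (fun k => k.+1%:R^-1 * \sum_(l < k) u l) @ \oo --> 0.
Proof.
move=> u0 /cesaro h.
apply: (@squeeze_cvgr _ _ _ _ (fun=> 0) (arithmetic_mean u)) => //; last exact: cvg_cst.
apply: nearW => k; rewrite mulr_ge0 ?invr_ge0 ?sumr_ge0//=.
rewrite /arithmetic_mean/= /series/= ler_wpM2l ?invr_ge0//.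
by rewrite big_mkord big_ord_recr/= lerDl.
Qed.

Lemma avg_close (X Y : nat -> T -> R) (m : R) :
  (forall l, itg P (X l)) -> (forall l, itg P (Y l)) ->
  (fun l => Ex P (fun w => `|X l w - Y l w|)) @ \oo --> 0 ->
  cvg_mean1 P (avg Y) m -> cvg_mean1 P (avg X) m.
Proof.
move=> iX iY XY cY; have iD l := itgB (iX l) (iY l).
apply: (cvg_mean1_le _ cY (e := fun k => k.+1%:R^-1 * \sum_(l < k) Ex P (fun w => `|X l w - Y l w|))).
- by move=> k; exact: itg_avg.
- by apply: (@cesaro_cvg0 (fun l => Ex P (fun w => `|X l w - Y l w|))) => // l; exact: Ex_ge0.
apply: nearW => k; rewrite -Ex_sum; last by move=> l; exact: itg_abs.
rewrite -ExZ; last by apply: itg_sum => l; exact: itg_abs.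
rewrite -ExD; last 2 first.
- by apply: itg_abs; apply: itgBc; exact: itg_avg.
- by apply: itgZ; apply: itg_sum => l; exact: itg_abs.
apply: Ex_le.
- by apply: itg_abs; apply: itgBc; exact: itg_avg.
- apply: itgD; first by apply: itg_abs; apply: itgBc; exact: itg_avg.
  by apply: itgZ; apply: itg_sum => l; exact: itg_abs.
move=> w; have -> : avg X k w - m = (avg Y k w - m) + k.+1%:R^-1 * \sum_(l < k) (X l w - Y l w).
  by rewrite sumrB /avg; ring.
apply: le_trans (ler_normD _ _) _; rewrite lerD2l normrM ger0_norm ?invr_ge0//.
by rewrite ler_wpM2l ?invr_ge0// ler_norm_sum.
Qed.

Lemma Ex_abs_mul_le (X Y : T -> R) (t : R) : 0 < t -> sqitg P X -> sqitg P Y ->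
  Ex P (fun w => `|X w * Y w|) <=
  t^-1 * Ex P (fun w => X w ^+ 2) + t * Ex P (fun w => Y w ^+ 2).
Proof.
move=> t0 sX sY; rewrite -(ExZ _ sX.2) -(ExZ _ sY.2).
rewrite -ExD; [|by apply: itgZ; exact: sX.2|by apply: itgZ; exact: sY.2].
apply: Ex_le; first by apply: itg_abs; exact: sqitg_mul.
  by apply: itgD; apply: itgZ; [exact: sX.2|exact: sY.2].
move=> w; rewrite normrM -[X w ^+ 2]real_normK ?num_real// -[Y w ^+ 2]real_normK ?num_real//.
have t0' : t != 0 by rewrite gt_eqF.
set a := `|X w|; set b := `|Y w|.
have a0 : 0 <= a by exact: normr_ge0.
have b0 : 0 <= b by exact: normr_ge0.
have -> : t^-1 * a ^+ 2 + t * b ^+ 2 = (a ^+ 2 + (t * b) ^+ 2) / t by field.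
rewrite ler_pdivlMr//.
have := sqr_ge0 (a - t * b); have := mulr_ge0 a0 (mulr_ge0 (ltW t0) b0); nra.
Qed.

Lemma product_close (X X' Y Y' : nat -> T -> R) (K : R) :
  (forall l, sqitg P (X l)) -> (forall l, sqitg P (X' l)) ->
  (forall l, sqitg P (Y l)) -> (forall l, sqitg P (Y' l)) ->
  (forall l, Ex P (fun w => X' l w ^+ 2) <= K) ->
  (forall l, Ex P (fun w => Y' l w ^+ 2) <= K) ->
  (fun l => Ex P (fun w => (X l w - X' l w) ^+ 2)) @ \oo --> 0 ->
  (fun l => Ex P (fun w => (Y l w - Y' l w) ^+ 2)) @ \oo --> 0 ->
  (fun l => Ex P (fun w => `|X l w * Y l w - X' l w * Y' l w|)) @ \oo --> 0.
Proof.
move=> sX sX' sY sY' KX KY cX cY.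
have sDX l := sqitgB (sX l) (sX' l); have sDY l := sqitgB (sY l) (sY' l).
have K0 : 0 <= K by apply: le_trans (KX 0%N); apply: Ex_ge0 => w; exact: sqr_ge0.
apply/cvgrPdist_le => eps eps0.
(* Makes [t * K <= eps / 4] in each of the two mixed terms; the summand 1 allows [K = 0]. The
   constant [1 + t^-1] is the total coefficient of each vanishing second moment. *)
pose t := eps / (4 * (K + 1)).
have t0 : 0 < t by rewrite divr_gt0// mulr_gt0// ltr_wpDl.
pose C := 1 + t^-1.
have C0 : 0 < C by rewrite addr_gt0// invr_gt0.
have del0 : 0 < eps / (4 * C) by rewrite divr_gt0// mulr_gt0.
move/cvgrPdist_le : cX => /(_ _ del0) cX; move/cvgrPdist_le : cY => /(_ _ del0) cY.
near=> l.
rewrite sub0r normrN ger0_norm; last by exact: Ex_ge0.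
have hX : Ex P (fun w => (X l w - X' l w) ^+ 2) <= eps / (4 * C).
  near: l; apply: filterS cX => l; rewrite sub0r normrN ger0_norm// Ex_ge0// => w.
  exact: sqr_ge0.
have hY : Ex P (fun w => (Y l w - Y' l w) ^+ 2) <= eps / (4 * C).
  near: l; apply: filterS cY => l; rewrite sub0r normrN ger0_norm// Ex_ge0// => w.
  exact: sqr_ge0.
set EX := Ex P _ in hX; set EY := Ex P _ in hY.
have i1 := itg_abs (sqitg_mul (sDX l) (sDY l)).
have i2 := itg_abs (sqitg_mul (sDX l) (sY' l)).
have i3 := itg_abs (sqitg_mul (sDY l) (sX' l)).
apply: (@le_trans _ _ (Ex P (fun w => `|(X l w - X' l w) * (Y l w - Y' l w)|
  + `|(X l w - X' l w) * Y' l w| + `|(Y l w - Y' l w) * X' l w|))).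
  apply: Ex_le.
  - by apply: itg_abs; apply: itgB; exact: sqitg_mul.
  - by apply: itgD => //; exact: itgD.
  - move=> w; have -> : X l w * Y l w - X' l w * Y' l w =
      (X l w - X' l w) * (Y l w - Y' l w) + (X l w - X' l w) * Y' l w + (Y l w - Y' l w) * X' l w by ring.
    by apply: le_trans (ler_normD _ _) _; rewrite lerD2r ler_normD.
rewrite ExD//; last exact: itgD.
rewrite ExD//.
have h1 := Ex_abs_mul_le ltr01 (sDX l) (sDY l).
have h2 := Ex_abs_mul_le t0 (sDX l) (sY' l).
have h3 := Ex_abs_mul_le t0 (sDY l) (sX' l).
rewrite invr1 !mul1r -/EX -/EY in h1; rewrite -/EX in h2; rewrite -/EY in h3.
have tK : t * K <= eps / 4.
  rewrite /t mulrAC ler_pdivrMr ?mulr_gt0 ?ltr_wpDl//.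
  by have := ltW eps0; nra.
have h2' := ler_wpM2l (ltW t0) (KY l); have h3' := ler_wpM2l (ltW t0) (KX l).
have hC : C * (eps / (4 * C)) = eps / 4 by field; rewrite gt_eqF.
have hX' := ler_wpM2l (ltW C0) hX; have hY' := ler_wpM2l (ltW C0) hY.
rewrite hC /C !mulrDl !mul1r in hX' hY'.
by lra.
Unshelve. all: by end_near. Qed.

Context (n : nat) (A : 'M[R]_n) (pi : 'I_n -> R) (C rho kap : R).
Hypotheses (C0 : 0 <= C) (rho0 : 0 < rho) (rho1 : rho < 1) (kap0 : 0 < kap).
Hypothesis A_geo : forall k i j, `|(A ^+ k) i j - pi j| <= C * rho ^+ k.
Hypothesis A_diag : forall l i, kap <= (A ^+ l) i i.
Context (M X : 'I_n -> nat -> T -> R).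
Hypothesis M0 : forall i w, M i 0%N w = 0.
Hypothesis MS : forall i k w, M i k.+1 w =
  k.+1%:R / k.+2%:R * (\sum_j A i j * M j k w) + (k.+2%:R * (A ^+ k.+1) i i)^-1 * X i k w.

(** [X j l] stands for the sample of time [l + 1]: it entered with divisor [(A ^+ l.+1) j j] and has
    been mixed [k - 1 - l] times by time [k]. *)
Let c (k l : nat) i j := (A ^+ (k.-1 - l)) i j * ((A ^+ l.+1) j j)^-1.

Let M_closed i k w :
  k.+1%:R * M i k w = \sum_(l < k) \sum_j c k l i j * X j l w.
Proof.
elim: k i => [|k IH] i; first by rewrite M0 big_ord0 mulr0.
rewrite MS mulrDr big_ord_recr/=; congr (_ + _).
  rewrite mulrA mulrCA divff ?pnatr_eq0// mulr1 mulr_sumr.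
  transitivity (\sum_j A i j * (\sum_(l < k) \sum_s c k l j s * X s l w)).
    by apply: eq_bigr => j _; rewrite -IH; ring.
  rewrite [LHS](eq_bigr _ (fun j _ => mulr_sumr _ _ _ _)).
  rewrite exchange_big/=; apply: eq_bigr => l _.
  rewrite [LHS](eq_bigr _ (fun j _ => mulr_sumr _ _ _ _)).
  rewrite exchange_big/=; apply: eq_bigr => s _.
  transitivity ((\sum_j A i j * (A ^+ (k.-1 - l)) j s) * ((A ^+ l.+1) s s)^-1 * X s l w).
    by rewrite !mulr_suml; apply: eq_bigr => j _; rewrite /c !mulrA.
  rewrite /c /=; congr (_ * _ * _).
  have -> : (k - l = (k.-1 - l).+1)%N by rewrite -subn1 subnAC subn1 prednK// subn_gt0.
  by rewrite exprS mxE.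
have k0 : k.+2%:R != 0 :> R by rewrite pnatr_eq0.
rewrite invfM !mulrA divff// mul1r.
rewrite (bigD1 i)//= big1 ?addr0.
  by rewrite /c /= subnn expr0 mxE eqxx mul1r.
by move=> j ij; rewrite /c /= subnn expr0 mxE eq_sym (negbTE ij) !mul0r.
Qed.

(** Numerator and denominator approach the same [pi j]; hence the limit weight is 1 for every agent,
    and the deviation is a difference of two geometric errors over a bounded-below denominator. *)
Let c_close k l i j : `|c k l i j - 1| <= kap^-1 * C * (rho ^+ (k.-1 - l) + rho ^+ l.+1).
Proof.
have d0 : 0 < (A ^+ l.+1) j j := lt_le_trans kap0 (A_diag _ _).
have -> : c k l i j - 1 = ((A ^+ l.+1) j j)^-1 *
    (((A ^+ (k.-1 - l)) i j - pi j) - ((A ^+ l.+1) j j - pi j)).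
  by rewrite /c; field; rewrite gt_eqF.
rewrite normrM -mulrA ger0_norm ?invr_ge0 ?(ltW d0)//; apply: ler_pM => //.
- by rewrite invr_ge0 ltW.
- by rewrite lef_pV2.
- by rewrite mulrDr; apply: le_trans (ler_normB _ _) _; apply: lerD.
Qed.

(** The bound does not depend on [k], so the division by [k + 1] makes the weight errors negligible
    for samples bounded in mean. *)
Let c_sum k i j : \sum_(l < k) `|c k l i j - 1| <= kap^-1 * C * (2 / (1 - rho)).
Proof.
have kC : 0 <= kap^-1 * C by rewrite mulr_ge0// invr_ge0 ltW.
apply: (@le_trans _ _ (\sum_(l < k) kap^-1 * C * (rho ^+ (k.-1 - l) + rho ^+ l.+1))).
  by apply: ler_sum => l _; exact: c_close.
rewrite -mulr_sumr ler_wpM2l// big_split/=.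
have geo N : \sum_(l < N) rho ^+ l <= (1 - rho)^-1.
  rewrite -[leRHS]mul1r ler_pdivlMr ?subr_gt0//.
  have -> : (\sum_(l < N) rho ^+ l) * (1 - rho) = 1 - rho ^+ N.
    rewrite mulrC; have := subrX1 rho N => h.
    by rewrite -[RHS]opprB h; ring.
  by rewrite gerBl exprn_ge0// ltW.
have -> : 2 / (1 - rho) = (1 - rho)^-1 + (1 - rho)^-1 by ring.
apply: lerD.
  apply: le_trans (geo k); rewrite [leRHS](reindex_inj rev_ord_inj)/=.
  by apply: ler_sum => l _; rewrite subnS predn_sub.
apply: le_trans (geo k); apply: ler_sum => l _.
by rewrite exprS ler_piMl ?exprn_ge0// ltW.
Qed.

(** With all weights replaced by 1 the estimate is the sum of the agents' plain averages; the weight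
    errors contribute [O(1 / k)] in mean. *)
Lemma plug_in_average (m : 'I_n -> R) (K : R) i :
  (forall j l, itg P (X j l)) -> (forall j l, Ex P (fun w => `|X j l w|) <= K) ->
  (forall j, cvg_mean1 P (avg (X j)) (m j)) ->
  cvg_mean1 P (M i) (\sum_j m j).
Proof.
move=> iX XK cX.
have ME k w : M i k w = \sum_j avg (X j) k w +
    k.+1%:R^-1 * \sum_(l < k) \sum_j (c k l i j - 1) * X j l w.
  have k0 : k.+1%:R != 0 :> R by rewrite pnatr_eq0.
  apply: (mulfI k0); rewrite M_closed mulrDr !mulrA divff// mul1r.
  rewrite mulr_sumr [\sum_j _ * _](_ : _ = \sum_(l < k) \sum_j X j l w).
    rewrite -big_split/=; apply: eq_bigr => l _; rewrite -big_split/=.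
    by apply: eq_bigr => j _; ring.
  by rewrite exchange_big/=; apply: eq_bigr => j _; rewrite /avg mulrA divff// mul1r.
have iS k : itg P (fun w => \sum_(l < k) \sum_j (c k l i j - 1) * X j l w).
  by apply: itg_sum => l; apply: itg_sum => j; exact: itgZ.
have iM k : itg P (M i k).
  rewrite (_ : M i k = (fun w => \sum_j avg (X j) k w +
    k.+1%:R^-1 * \sum_(l < k) \sum_j (c k l i j - 1) * X j l w)); last exact/funext.
  apply: itgD; last exact: itgZ.
  by apply: itg_sum => j; exact: itg_avg.
pose D : R := \sum_(j < n) kap^-1 * C * (2 / (1 - rho)) * K.
have cS : cvg_mean1 P (fun k w => \sum_j avg (X j) k w) (\sum_j m j).
  exact: cvg_mean1_sum.
have [iS' _] := cS.
apply: (cvg_mean1_le iM cS (e := fun k => D * k.+1%:R^-1)).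
  by rewrite -(mulr0 D); apply: cvgMr; exact: cvg_harmonic.
apply: nearW => k.
have iE : itg P (fun w => k.+1%:R^-1 * \sum_(l < k) \sum_j `|c k l i j - 1| * `|X j l w|).
  apply: itgZ; apply: itg_sum => l; apply: itg_sum => j; apply: itgZ; exact: itg_abs.
have EE : Ex P (fun w => k.+1%:R^-1 * \sum_(l < k) \sum_j `|c k l i j - 1| * `|X j l w|) <= D * k.+1%:R^-1.
  rewrite ExZ; last first.
    apply: itg_sum => l; apply: itg_sum => j; apply: itgZ; exact: itg_abs.
  rewrite mulrC; apply: ler_wpM2r; first by rewrite invr_ge0.
  rewrite Ex_sum; last by move=> l; apply: itg_sum => j; apply: itgZ; exact: itg_abs.
  have -> : \sum_(l < k) Ex P (fun w => \sum_j `|c k l i j - 1| * `|X j l w|) =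
      \sum_(l < k) \sum_j `|c k l i j - 1| * Ex P (fun w => `|X j l w|).
    apply: eq_bigr => l _; rewrite Ex_sum; last by move=> j; apply: itgZ; exact: itg_abs.
    by apply: eq_bigr => j _; rewrite ExZ//; exact: itg_abs.
  rewrite exchange_big/=; apply: ler_sum => j _.
  have K0 : 0 <= K by apply: le_trans (XK j 0%N); exact: Ex_ge0.
  apply: (@le_trans _ _ (\sum_(l < k) `|c k l i j - 1| * K)).
    by apply: ler_sum => l _; apply: ler_wpM2l.
  by rewrite -mulr_suml; apply: ler_wpM2r.
apply: le_trans (lerD (lexx _) EE); rewrite -ExD//; last first.
  by apply: itg_abs; exact: itgBc.
apply: Ex_le.
- by apply: itg_abs; exact: itgBc.
- by apply: itgD => //; apply: itg_abs; exact: itgBc.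
move=> w; rewrite ME addrAC; apply: le_trans (ler_normD _ _) _.
rewrite lerD2l normrM ger0_norm ?invr_ge0//; apply: ler_wpM2l; first by rewrite invr_ge0.
apply: le_trans (ler_norm_sum _ _ _) _; apply: ler_sum => l _.
apply: le_trans (ler_norm_sum _ _ _) _; apply: ler_sum => j _.
by rewrite normrM.
Qed.

End averages.

Lemma cvg0_bounded (R : realType) (u : nat -> R) : u @ \oo --> 0 ->
  exists2 K, 0 <= K & forall k, u k <= K.
Proof.
move=> u0; have /cvg_seq_bounded/pinfty_ex_gt0[K K0 uK] : cvgn u by apply/cvg_ex; exists 0.
exists K; first exact: ltW.
by move=> k; apply: le_trans (ler_norm _) _; exact: uK.
Qed.

Lemma cvg0_le (R : realType) (u e : nat -> R) : (forall k, 0 <= u k) ->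
  (forall k, u k <= e k) -> e @ \oo --> 0 -> u @ \oo --> 0.
Proof.
move=> u0 ue e0; apply: (@squeeze_cvgr _ _ _ _ (fun=> 0) e) => //; last exact: cvg_cst.
by apply: nearW => k; rewrite u0 ue.
Qed.

Lemma norm_le_addB (R : realType) (x y : R) : `|x| <= `|x - y| + `|y|.
Proof. by have := ler_normD (x - y) y; rewrite subrK. Qed.

Lemma norm_half_sum (R : realType) (x y z : R) :
  `|x - 2^-1 * y - 2^-1 * z| <= `|x| + `|y| + `|z|.
Proof.
have h (t : R) : `|2^-1 * t| <= `|t|.
  by rewrite normrM ler_piMl// ger0_norm ?invr_ge0// invf_le1 ?ler1n.
apply: le_trans (ler_normB _ _) _; apply: lerD (h z).
by apply: le_trans (ler_normB _ _) _; apply: lerD (h y).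
Qed.

Lemma symmetrized_product (R : realType) (s t a a' b b' : R) :
  (2 * s * t)^-1 * (a * (b - b') + (a - a') * b) =
  (s * t)^-1 * (a * b - 2^-1 * (a * b') - 2^-1 * (b * a')).
Proof. by rewrite -mulrA invfM; move: (s * t)^-1 => c; field. Qed.

Lemma addmxE (R : realType) (m n : nat) (M N : 'M[R]_(m, n)) a b :
  (M + N) a b = M a b + N a b.
Proof. by rewrite mxE. Qed.

Lemma scalemxE (R : realType) (m n : nat) c (M : 'M[R]_(m, n)) a b :
  (c *: M) a b = c * M a b.
Proof. by rewrite mxE. Qed.

Lemma symmetrized_outer_entry (R : realType) (d : nat) (u v : 'cV[R]_d) a b :
  (u *m (u - v)^T + (u - v) *m u^T) a b =
  u a 0 * (u b 0 - v b 0) + (u a 0 - v a 0) * u b 0.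
Proof. by rewrite mxE ![(_ *m _) a b]mxE !big_ord1 !mxE. Qed.

Section covariances.
Context (R : realType) (d : measure_display) (T : measurableType d)
  (P : probability T R).

Lemma covariance_Ex (X Y : T -> R) : sqitg P X -> sqitg P Y ->
  fine (covariance P X Y) = Ex P (fun w => X w * Y w) - Ex P X * Ex P Y.
Proof.
move=> sX sY; rewrite unlock.
have -> : fine 'E_P[X] = Ex P X by rewrite unlock.
have -> : fine 'E_P[Y] = Ex P Y by rewrite unlock.
rewrite unlock.
transitivity (Ex P (fun w => X w * Y w - Ex P Y * X w - Ex P X * Y w + Ex P X * Ex P Y)).
  congr fine; apply: eq_integral => w _; congr EFin.
  by transitivity ((X w - Ex P X) * (Y w - Ex P Y)); [|ring].
have iXY := sqitg_mul sX sY; have iX := sqitg_itg sX; have iY := sqitg_itg sY.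
rewrite ExD; [|by apply: itgB; [apply: itgB => //|]; exact: itgZ|exact: itg_cst].
rewrite ExB; [|by apply: itgB => //; exact: itgZ|exact: itgZ].
rewrite ExB//; last exact: itgZ.
by rewrite Ex_cst (ExZ _ iX) (ExZ _ iY); ring.
Qed.

Lemma avg_lag (U V : nat -> T -> R) (m : R) k w :
  avg (fun l w => U l w * (V (l + 1)%N w - m)) k w + m * avg (fun l w => U (l + 0)%N w) k w =
  avg (fun l w => V (l + 1)%N w * U (l + 0)%N w) k w.
Proof.
rewrite /avg mulrCA -mulrDr mulr_sumr -big_split/=; congr (_ * _).
by apply: eq_bigr => l _; rewrite addn0; ring.
Qed.

Lemma avg_combine (U V W : nat -> T -> R) (s t : R) k w :
  avg U k w - s * avg V k w - t * avg W k w =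
  avg (fun l w => U l w - s * V l w - t * W l w) k w.
Proof. by rewrite /avg !sumrB -!mulr_sumr; ring. Qed.

End covariances.

(** * Averages of gradient and Hessian samples along converging iterates *)

Section samples.
Context (R : realType) (dO : measure_display) (Omega : measurableType dO)
  (P : probability Omega R) (n d : nat) (dZ : 'I_n -> measure_display)
  (Z : forall i, measurableType (dZ i)) (g : forall i, 'cV[R]_d -> Z i -> R)
  (zeta : forall i, {RV P >-> Z i}) (zetas : nat -> forall i, {RV P >-> Z i})
  (xstar : 'cV[R]_d) (mu c p U1 : R) (Lip : forall i, Z i -> R).
Arguments g : clear implicits.
Hypothesis cs : cost_setting P g zeta.
Hypothesis iid : iid_copies P zeta zetas.
Hypothesis oa : objective_assumption P g zeta xstar mu c p U1 Lip.
Context (i : 'I_n) (X : nat -> Omega -> 'cV[R]_d).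
Hypothesis aX : forall k a, adapted zetas k (fun w => X k w a 0).
Hypothesis sX : forall k a, sqitg P (fun w => X k w a 0).
Hypothesis X_cvg : (fun k => Ex P (fun w => enorm (X k w - xstar) ^+ 2)) @ \oo --> 0.

Local Notation F k := (g_sigma_algebraType (past zetas k)).
Local Notation G k a w := (sgrad g (X k w) (zetas k i w) a 0).
Local Notation G' k a w := (sgrad g xstar (zetas k i w) a 0).
Local Notation m a := (Ex P (fun w => sgrad g xstar (zeta i w) a 0)).

Let shift0 (u : nat -> R) s : u @ \oo --> 0 -> (fun l => u (l + s)%N) @ \oo --> 0.
Proof. by rewrite cvg_shiftn. Qed.

Let sG k a : sqitg P (fun w => G k a w).
Proof.
apply: (state_grad_moment cs iid oa i a _ _).1 => b; [exact: aX|exact: sX].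
Qed.

Let sG' k a : sqitg P (fun w => G' k a w).
Proof. exact: (zetas_sqitg iid k (sgrad_measurable cs a xstar) (sgrad_xstar_sqitg cs oa i a)).1. Qed.

Let EG' k a : Ex P (fun w => G' k a w ^+ 2) = grad_moment g zeta xstar i a.
Proof. exact: (zetas_sqitg iid k (sgrad_measurable cs a xstar) (sgrad_xstar_sqitg cs oa i a)).2. Qed.

Let G_cvg a : (fun k => Ex P (fun w => (G k a w - G' k a w) ^+ 2)) @ \oo --> 0.
Proof.
apply: (cvg0_le
  (e := fun k => lip_moment zeta Lip i * Ex P (fun w => enorm (X k w - xstar) ^+ 2))).
- by move=> k; apply: Ex_ge0 => w; exact: sqr_ge0.
- by move=> k; apply: (state_grad_diff cs iid oa i a _ _).2 => b; [exact: aX|exact: sX].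
- by rewrite -(mulr0 (lip_moment zeta Lip i)); apply: cvgMr.
Qed.

Let G_bound a : exists2 K, 0 <= K & forall k, Ex P (fun w => G k a w ^+ 2) <= K.
Proof.
have [K K0 hK] := cvg0_bounded X_cvg.
have L0 := lip_moment_ge0 zeta Lip i.
have g0 := grad_moment_ge0 g zeta xstar i a.
exists (2 * lip_moment zeta Lip i * K + 2 * grad_moment g zeta xstar i a).
  by apply: addr_ge0; [apply: mulr_ge0 => //|]; apply: mulr_ge0.
move=> k; apply: le_trans (_ : _ <= 2 * lip_moment zeta Lip i * Ex P (fun w => enorm (X k w - xstar) ^+ 2)
  + 2 * grad_moment g zeta xstar i a) _.
  by apply: (state_grad_moment cs iid oa i a _ _).2 => b; [exact: aX|exact: sX].
by rewrite lerD2r; apply: ler_wpM2l => //; apply: mulr_ge0.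
Qed.

Lemma grad_product_bound a b s t : exists2 K, 0 <= K & forall l,
  Ex P (fun w => `|G (l + s)%N a w * G (l + t)%N b w|) <= K.
Proof.
have [Ka Ka0 hKa] := G_bound a; have [Kb Kb0 hKb] := G_bound b.
exists (Ka + Kb); first exact: addr_ge0.
move=> l; apply: le_trans (Ex_abs_mul_le ltr01 (sG _ a) (sG _ b)) _.
by rewrite invr1 !mul1r; apply: lerD.
Qed.

Let grad_product_close a b s t :
  (fun l => Ex P (fun w => `|G (l + s)%N a w * G (l + t)%N b w -
     G' (l + s)%N a w * G' (l + t)%N b w|)) @ \oo --> 0.
Proof.
have g0 a' := grad_moment_ge0 g zeta xstar i a'.
apply: (product_close (K := grad_moment g zeta xstar i a + grad_moment g zeta xstar i b)
  (X := fun l w => G (l + s)%N a w) (X' := fun l w => G' (l + s)%N a w)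
  (Y := fun l w => G (l + t)%N b w) (Y' := fun l w => G' (l + t)%N b w)).
- by move=> l; exact: sG.
- by move=> l; exact: sG'.
- by move=> l; exact: sG.
- by move=> l; exact: sG'.
- by move=> l; rewrite EG' lerDl; exact: g0.
- by move=> l; rewrite EG' lerDr; exact: g0.
- exact: (shift0 s (G_cvg a)).
- exact: (shift0 t (G_cvg b)).
Qed.

Lemma grad_product_avg a b :
  cvg_mean1 P (avg (fun l w => G (l + 1)%N a w * G (l + 1)%N b w))
    (Ex P (fun w => sgrad g xstar (zeta i w) a 0 * sgrad g xstar (zeta i w) b 0)).
Proof.
apply: (avg_close (Y := fun l w => G' (l + 1)%N a w * G' (l + 1)%N b w)).
- by move=> l; exact: sqitg_mul.
- by move=> l; exact: sqitg_mul.
- exact: grad_product_close.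
have := @lln _ _ _ P _ _ _ zeta zetas iid 1 i (fun z => sgrad g xstar z a 0 * sgrad g xstar z b 0).
apply.
- by apply: measurable_funM; exact: (sgrad_measurable cs).
- by apply: sqitg_mul; exact: (sgrad_xstar_sqitg cs oa).
Qed.

(** At [xstar] the newer sample is split into its mean and a centred part. The earlier sample is
    known before the centred part, so their products average out by [lln_martingale]; what remains
    is [m a] times the average of the earlier samples. *)
Lemma grad_lag_product_avg a b :
  cvg_mean1 P (avg (fun l w => G (l + 1)%N a w * G (l + 0)%N b w)) (m a * m b).
Proof.
apply: (avg_close (Y := fun l w => G' (l + 1)%N a w * G' (l + 0)%N b w)).
- by move=> l; exact: sqitg_mul.
- by move=> l; exact: sqitg_mul.
- exact: grad_product_close.
have h1 := @lln_martingale _ _ _ P _ _ _ zeta zetas iid 1 i (fun z => sgrad g xstar z a 0)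
  (fun l w => G' l b w) (grad_moment g zeta xstar i b) (sgrad_measurable cs a xstar)
  (sgrad_xstar_sqitg cs oa i a).
have {}h1 : cvg_mean1 P (avg (fun l w => G' l b w * (G' (l + 1)%N a w - m a))) 0.
  apply: h1.
  - by move=> l; rewrite addn1; exact: (adapted_zetas (sgrad_measurable cs b xstar)).
  - by move=> l; exact: sG'.
  - by move=> l; rewrite EG'.
have h2 := @lln _ _ _ P _ _ _ zeta zetas iid 0 i (fun z => sgrad g xstar z b 0)
  (sgrad_measurable cs b xstar) (sqitg_itg (sgrad_xstar_sqitg cs oa i b)).
have := cvg_mean1D h1 (cvg_mean1Z (m a) h2); rewrite add0r.
congr cvg_mean1; apply/funext => k; apply/funext => w.
exact: (avg_lag (fun l w => G' l b w) (fun l w => G' l a w) (m a) k w).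
Qed.

Context (L1 : R).
Hypothesis L10 : 0 < L1.
Hypothesis hess_lip : forall z : 'cV[R]_d,
  ('E_P[fun w => (opnorm (shess g z (zeta i w) - shess g xstar (zeta i w)))%R]
    <= (L1 * enorm (z - xstar))%:E)%E.

Let X_enorm k : sqitg P (fun w => enorm (X k w - xstar)).
Proof.
split; last exact: sqitg_dist.
apply: measurable_enorm => a; under eq_fun do rewrite colB.
apply: measurable_funB => //; exact: (sX k a).1.
Qed.

Let X_cvg1 : (fun k => Ex P (fun w => enorm (X k w - xstar))) @ \oo --> 0.
Proof.
apply: (cvg0_le
  (e := fun k => Num.sqrt (Ex P (fun w => enorm (X k w - xstar) ^+ 2)))).
- by move=> k; apply: Ex_ge0 => w; exact: enorm_ge0.
- move=> k; apply: (@le_trans _ _ (Num.sqrt (Ex P (fun w => `|enorm (X k w - xstar)|) ^+ 2))).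
    rewrite sqrtr_sqr ger0_norm; last by apply: Ex_ge0.
    apply: Ex_le; [exact: (sqitg_itg (X_enorm k))|exact: (itg_abs (sqitg_itg (X_enorm k)))|].
    by move=> w; exact: ler_norm.
  by apply: ler_wsqrtr; exact: (Ex_sqr_abs (X_enorm k)).
- by rewrite -(@sqrtr0 R); apply: (cvg_comp _ (@Num.sqrt R)); [exact: X_cvg|exact: sqrt_continuous].
Qed.

Let h k a b w := shess g (X k w) (zetas k i w) a b.
Let h' k a b w := shess g xstar (zetas k i w) a b.

Let ih' k a b : itg P (h' k a b).
Proof.
exact: (zetas_Ex iid k (shess_measurable cs a b xstar) (shess_xstar_itg cs oa i a b).1).1.
Qed.

(** The Hessian need not be continuous in the state, so its measurability at a random state comes
    from difference quotients of the gradient, which is continuous. The moment bound at fixed points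
    is transferred by [freezing_bound]. *)
Let hess_diff k a b : itg P (fun w => h k a b w - h' k a b w) /\
  Ex P (fun w => `|h k a b w - h' k a b w|) <= L1 * Ex P (fun w => enorm (X k w - xstar)).
Proof.
have iL := itgZ L1 (sqitg_itg (X_enorm k)).
rewrite -(ExZ L1 (sqitg_itg (X_enorm k))).
(* The shift [t] covers both ends of the difference quotient, with [t = 0] at the base point. *)
have adX t e : adapted zetas k (fun w => (X k w + t) e 0).
  by under eq_fun do rewrite addmxE; apply: adaptedD; [exact: aX|exact: adapted_cst].
have mF t e : measurable_fun [set: F k * Z i] (fun x => sgrad g (X k x.1 + t) x.2 e 0).
  apply: (measurable_frozen (Phi := fun x z => sgrad g x z e 0) (X := fun w => X k w + t)).
  - by move=> x; exact: (sgrad_measurable cs).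
  - by move=> z; exact: (sgrad_continuous cs).
  - by move=> e'; exact: adX.
have mO t e : measurable_fun [set: Omega] (fun w => sgrad g (X k w + t) (zetas k i w) e 0).
  apply: (@adapted_measurable _ _ _ P _ _ _ zetas k.+1).
  exact: (state_grad_adapted cs i e (X := fun w => X k w + t)) (adX t).
have eX (T : Type) (f : T -> 'cV[R]_d) : f = (fun x => f x + 0).
  by apply/funext => x; rewrite addr0.
apply: (@freezing_bound _ _ _ P _ _ _ zeta zetas iid d k i
  (fun x z => shess g x z a b - shess g xstar z a b) (X k)
  (fun x => L1 * enorm (x - xstar))) => //.
- apply: measurable_funB.
    apply: (@measurable_fun_cvg _ _ _ _ (fun (N : nat) (x : F k * Z i) => N.+1%:R *
       (sgrad g (X k x.1 + N.+1%:R^-1 *: delta_mx b 0) x.2 a 0 - sgrad g (X k x.1 + 0) x.2 a 0))).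
      by move=> N; apply: measurable_funM => //; apply: measurable_funB; exact: mF.
    by move=> x _; rewrite addr0; exact: (shess_seq_cvg cs).
  exact: (measurableT_comp (shess_measurable cs a b xstar) measurable_snd).
- apply: measurable_funB; last exact: itg_measurable (ih' k a b).
  apply: (@measurable_fun_cvg _ _ _ _ (fun (N : nat) w => N.+1%:R *
       (sgrad g (X k w + N.+1%:R^-1 *: delta_mx b 0) (zetas k i w) a 0 - sgrad g (X k w + 0) (zetas k i w) a 0))).
    by move=> N; apply: measurable_funM => //; apply: measurable_funB; exact: mO.
  by move=> w _; rewrite addr0; exact: (shess_seq_cvg cs).
- move=> x; have := hess_lip x; rewrite unlock; apply: le_trans.
  apply: ge0_le_integral_upper => w; first by rewrite lee_fin.
  rewrite lee_fin.
  have := entry_le_opnorm (shess g x (zeta i w) - shess g xstar (zeta i w)) a b.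
  by rewrite addmxE [X in _ + X]mxE.
Qed.

Let ih k a b : itg P (h k a b).
Proof.
have := itgD (hess_diff k a b).1 (ih' k a b).
by congr itg; apply/funext => w; rewrite subrK.
Qed.

Lemma hess_sample_itg k a b : itg P (fun w => shess g (X k w) (zetas k i w) a b).
Proof. exact: ih. Qed.

Lemma hess_sample_bound a b : exists2 K, 0 <= K & forall k,
  Ex P (fun w => `|shess g (X k w) (zetas k i w) a b|) <= K.
Proof.
have [K K0 hK] := cvg0_bounded X_cvg1.
pose K' := Ex P (fun w => `|shess g xstar (zeta i w) a b|).
have EK' k : Ex P (fun w => `|h' k a b w|) = K'.
  apply: (@zetas_Ex _ _ _ P _ _ _ zeta zetas iid k i (fun z => `|shess g xstar z a b|) _ _).2.
    by apply: measurableT_comp => //; exact: (shess_measurable cs).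
  by apply: itg_abs; exact: (shess_xstar_itg cs oa i a b).1.
exists (L1 * K + K').
  by apply: addr_ge0; [apply: mulr_ge0 => //; exact: ltW|exact: Ex_ge0].
move=> k; rewrite -(EK' k).
have [iD ED] := hess_diff k a b.
apply: le_trans (_ : _ <= Ex P (fun w => `|h k a b w - h' k a b w| + `|h' k a b w|)) _.
  apply: Ex_le.
  - by apply: itg_abs; exact: ih.
  - by apply: itgD; apply: itg_abs => //; exact: ih'.
  - by move=> w; exact: norm_le_addB.
rewrite ExD; [|exact: itg_abs|by apply: itg_abs; exact: ih'].
rewrite lerD2r; apply: le_trans ED _; apply: ler_wpM2l; first exact: ltW.
exact: hK.
Qed.

Lemma hess_sample_avg a b :
  cvg_mean1 P (avg (fun l w => shess g (X (l + 1)%N w) (zetas (l + 1)%N i w) a b))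
    (Ex P (fun w => shess g xstar (zeta i w) a b)).
Proof.
apply: (avg_close (X := fun l w => h (l + 1)%N a b w) (Y := fun l w => h' (l + 1)%N a b w)).
- by move=> l; exact: ih.
- by move=> l; exact: ih'.
- apply: (shift0 1 (u := fun k => Ex P (fun w => `|h k a b w - h' k a b w|))).
  apply: (cvg0_le (e := fun k => L1 * Ex P (fun w => enorm (X k w - xstar)))).
  + by move=> k; exact: Ex_ge0.
  + by move=> k; exact: (hess_diff k a b).2.
  + by rewrite -(mulr0 L1); apply: cvgMr.
apply: (@lln _ _ _ P _ _ _ zeta zetas iid 1 i (fun z => shess g xstar z a b)).
- exact: (shess_measurable cs).
- exact: (shess_xstar_itg cs oa i a b).1.
Qed.

End samples.

Section plug_in.
Context (R : realType) (dO : measure_display) (Omega : measurableType dO)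
  (P : probability Omega R) (n d : nat) (dZ : 'I_n -> measure_display)
  (Z : forall i, measurableType (dZ i)) (g : forall i, 'cV[R]_d -> Z i -> R)
  (zeta : forall i, {RV P >-> Z i}) (zetas : nat -> forall i, {RV P >-> Z i})
  (xstar : 'cV[R]_d) (mu c p U1 : R) (Lip : forall i, Z i -> R).
Arguments g : clear implicits.
Hypothesis cs : cost_setting P g zeta.
Hypothesis iid : iid_copies P zeta zetas.
Hypothesis oa : objective_assumption P g zeta xstar mu c p U1 Lip.
Context (A : 'M[R]_n) (pi : 'I_n -> R) (C rho kap : R).
Hypotheses (C0 : 0 <= C) (rho0 : 0 < rho) (rho1 : rho < 1) (kap0 : 0 < kap).
Hypothesis A_geo : forall k i j, `|(A ^+ k) i j - pi j| <= C * rho ^+ k.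
Hypothesis A_diag : forall l i, kap <= (A ^+ l) i i.
Context (x : 'I_n -> nat -> Omega -> 'cV[R]_d) (uk : 'I_n -> nat -> 'cV[R]_n)
  (H S : 'I_n -> nat -> Omega -> 'M[R]_d).
Hypothesis ax : forall i k a, adapted zetas k (fun w => x i k w a 0).
Hypothesis sx : forall i k a, sqitg P (fun w => x i k w a 0).
Hypothesis x_cvg : forall i,
  (fun k => Ex P (fun w => enorm (x i k w - xstar) ^+ 2)) @ \oo --> 0.
Hypothesis plug : plug_in_method g zetas A x uk H S.

Lemma plug_in_weight i k j : uk i k j 0 = (A ^+ k) i j.
Proof.
elim: k i => [|k IH] i; first by rewrite (plug_u0 plug) expr0 !mxE eqxx andbT eq_sym.
rewrite (plug_u plug)// exprS mxE summxE; apply: eq_bigr => l _.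
by rewrite scalemxE IH.
Qed.

Lemma plug_in_hessian (L1 : R) :
  0 < L1 ->
  (forall i (z : 'cV[R]_d),
    ('E_P[fun w => (opnorm (shess g z (zeta i w) - shess g xstar (zeta i w)))%R]
      <= (L1 * enorm (z - xstar))%:E)%E) ->
  forall i a b, cvg_mean1 P (fun k w => H i k w a b)
    (hess (total_cost P g (fun i => zeta i)) xstar a b).
Proof.
move=> L10 hL i a b; rewrite (hess_total_cost cs oa).
pose X j l w := shess g (x j (l + 1)%N w) (zetas (l + 1)%N j w) a b.
have hb j := hess_sample_bound cs iid oa (@ax j) (@sx j) (x_cvg j) L10 (hL j) a b.
have hb' j : exists K, forall k, Ex P (fun w => `|shess g (x j k w) (zetas k j w) a b|) <= K.
  by have [K _ h] := hb j; exists K.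
have [K hK] := choice hb'.
apply: (@plug_in_average R dO Omega P n A pi C rho kap C0 rho0 rho1 kap0 A_geo A_diag
  (fun j k w => H j k w a b) X _ _ _ (\big[Num.max/0]_j K j)).
- by move=> j w; rewrite (plug_H0 plug) mxE.
- move=> j k w; rewrite (plug_H plug)// addmxE !scalemxE summxE plug_in_weight /X addn1.
  by congr (_ * _ + _); apply: eq_bigr => l _; rewrite scalemxE.
- move=> j l; exact: (hess_sample_itg cs iid oa (@ax j) (@sx j) (hL j)).
- by move=> j l; apply: le_trans (hK j _) _; exact: le_bigmax.
- move=> j; exact: (hess_sample_avg cs iid oa (@ax j) (@sx j) (x_cvg j) (hL j)).
Qed.

(** Each symmetrised increment is [G G^T] minus half of the two lagged products. Its average tends
    to the second moment minus [m m^T], the covariance of one agent, and the covariance hypothesis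
    identifies the sum over agents with [S]. *)
Lemma plug_in_covariance :
  covmx P (fun w => \sum_(j < n) sgrad g xstar (zeta j w))
    = \sum_(j < n) covmx P (fun w => sgrad g xstar (zeta j w)) ->
  forall i a b, cvg_mean1 P (fun k w => S i k w a b)
    (covmx P (fun w => \sum_(j < n) sgrad g xstar (zeta j w)) a b).
Proof.
move=> hcov i a b; rewrite hcov summxE.
pose G j l a w := sgrad g (x j l w) (zetas l j w) a 0.
pose X j l w := G j (l + 1)%N a w * G j (l + 1)%N b w
  - 2^-1 * (G j (l + 1)%N a w * G j (l + 0)%N b w)
  - 2^-1 * (G j (l + 1)%N b w * G j (l + 0)%N a w).
have sG j k e : sqitg P (G j k e).
  by apply: (state_grad_moment cs iid oa j e _ _).1 => b'; [exact: ax|exact: sx].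
have iX j l : itg P (X j l).
  by apply: itgB; [apply: itgB; [|apply: itgZ]|apply: itgZ]; exact: sqitg_mul.
have hb j e f s t : exists K, forall l, Ex P (fun w => `|G j (l + s)%N e w * G j (l + t)%N f w|) <= K.
  by have [K _ h] := grad_product_bound cs iid oa j (@ax j) (@sx j) (x_cvg j) e f s t; exists K.
have [K1 hK1] := choice (fun j => hb j a b 1%N 1%N).
have [K2 hK2] := choice (fun j => hb j a b 1%N 0%N).
have [K3 hK3] := choice (fun j => hb j b a 1%N 0%N).
apply: (@plug_in_average R dO Omega P n A pi C rho kap C0 rho0 rho1 kap0 A_geo A_diag
  (fun j k w => S j k w a b) X _ _ _ (\big[Num.max/0]_j (K1 j + K2 j + K3 j))).
- by move=> j w; rewrite (plug_S0 plug) mxE.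
- move=> j k w; rewrite (plug_S plug)//= addmxE !scalemxE summxE plug_in_weight.
  congr (_ * _ + _); first by apply: eq_bigr => l _; rewrite scalemxE.
  rewrite symmetrized_outer_entry /X addn1 addn0; exact: symmetrized_product.
- exact: iX.
- move=> j l; apply: le_trans _ (le_bigmax _ _ j).
  have i1 s t e f : itg P (fun w => `|G j s e w * G j t f w|) by apply: itg_abs; exact: sqitg_mul.
  apply: le_trans (lerD (lerD (hK1 j l) (hK2 j l)) (hK3 j l)).
  rewrite -ExD// -ExD//; last exact: itgD.
  apply: Ex_le; [exact: itg_abs|by apply: itgD => //; exact: itgD|].
  by move=> w; exact: norm_half_sum.
move=> j.
have cD := grad_product_avg cs iid oa j (@ax j) (@sx j) (x_cvg j) a b.
have cL := grad_lag_product_avg cs iid oa j (@ax j) (@sx j) (x_cvg j).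
have := cvg_mean1B (cvg_mean1B cD (cvg_mean1Z 2^-1 (cL a b))) (cvg_mean1Z 2^-1 (cL b a)).
rewrite mxE covariance_Ex; [|exact: (sgrad_xstar_sqitg cs oa)|exact: (sgrad_xstar_sqitg cs oa)].
set ma := Ex P (fun w => sgrad g xstar (zeta j w) a 0).
set mb := Ex P (fun w => sgrad g xstar (zeta j w) b 0).
have -> (t : R) : t - 2^-1 * (ma * mb) - 2^-1 * (mb * ma) = t - ma * mb by field.
congr cvg_mean1; apply/funext => k; apply/funext => w.
exact: (@avg_combine _ _ _ (fun l w => _) (fun l w => _) (fun l w => _)).
Qed.

End plug_in.

(** * Continuity of the sandwich and convergence in probability *)

Section matrix_limits.
Context (R : realType).

Lemma cvg_fprod (I : Type) (s : seq I) (u : I -> nat -> R) (l : I -> R) :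
  (forall i, u i @ \oo --> l i) ->
  (fun N => \prod_(i <- s) u i N) @ \oo --> \prod_(i <- s) l i.
Proof.
move=> ul; elim: s => [|i s IH].
  by rewrite big_nil; under eq_fun do rewrite big_nil; exact: cvg_cst.
by rewrite big_cons; under eq_fun do rewrite big_cons; apply: cvgM.
Qed.

Lemma det_cvg (d : nat) (M : nat -> 'M[R]_d) (L : 'M[R]_d) :
  (forall a b, (fun N => M N a b) @ \oo --> L a b) ->
  (fun N => \det (M N)) @ \oo --> \det L.
Proof.
move=> h; rewrite /determinant.
apply: (cvg_fsum _ (u := fun (s : 'S_d) N => (-1) ^+ s * \prod_i M N i (s i))) => s.
apply: cvgMr; apply: (cvg_fprod _ (u := fun i N => M N i (s i))) => i.
exact: h.
Qed.

Lemma adj_cvg (d : nat) (M : nat -> 'M[R]_d) (L : 'M[R]_d) a b :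
  (forall a b, (fun N => M N a b) @ \oo --> L a b) ->
  (fun N => (\adj (M N)) a b) @ \oo --> (\adj L) a b.
Proof.
move=> h; under eq_fun do rewrite mxE; rewrite mxE /cofactor.
apply: cvgMr; apply: det_cvg => a' b'.
by under eq_fun do rewrite !mxE; rewrite !mxE; exact: h.
Qed.

Lemma mulmx_cvg (l m d : nat) (M : nat -> 'M[R]_(l, m)) (N : nat -> 'M[R]_(m, d))
    (L : 'M[R]_(l, m)) (L' : 'M[R]_(m, d)) a b :
  (forall a b, (fun k => M k a b) @ \oo --> L a b) ->
  (forall a b, (fun k => N k a b) @ \oo --> L' a b) ->
  (fun k => (M k *m N k) a b) @ \oo --> (L *m L') a b.
Proof.
move=> h h'; under eq_fun do rewrite mxE; rewrite mxE.
apply: (cvg_fsum _ (u := fun c k => M k a c * N k c b)) => c.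
exact: cvgM.
Qed.

(** Proved along a sequence of counterexamples with tolerance [1 / (N + 1)], by convergence of
    determinants and adjugates. Closeness is measured by sums of entries, the form in which
    convergence in mean is available. *)
Lemma sandwich_inverse_continuous (d : nat) (H S : 'M[R]_d) (eps : R) :
  H \in unitmx -> 0 < eps ->
  exists2 del : R, 0 < del & forall H' S' : 'M[R]_d,
    \sum_a \sum_b `|H' a b - H a b| + \sum_a \sum_b `|S' a b - S a b| < del ->
    H' \in unitmx /\
    opnorm (invmx H' *m S' *m invmx H' - invmx H *m S *m invmx H) < eps.
Proof.
move=> uH eps0; set L := invmx H *m S *m invmx H.
apply: contrapT => hn.
have hN (N : nat) : exists HS : 'M[R]_d * 'M[R]_d,
    \sum_a \sum_b `|HS.1 a b - H a b| + \sum_a \sum_b `|HS.2 a b - S a b| < N.+1%:R^-1 /\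
    ~ (HS.1 \in unitmx /\ opnorm (invmx HS.1 *m HS.2 *m invmx HS.1 - L) < eps).
  apply: contrapT => h; apply: hn; exists N.+1%:R^-1; first by rewrite invr_gt0.
  by move=> H' S' hs; apply: contrapT => hc; apply: h; exists (H', S').
have [HS /all_and2[hs hc]] := choice hN.
have sum_ge (M : 'M[R]_d) a b : `|M a b| <= \sum_a \sum_b `|M a b|.
  rewrite (bigD1 a)//= (bigD1 b)//= -addrA lerDl addr_ge0// ?sumr_ge0// => a' _.
  by rewrite sumr_ge0.
have sum0 (M : 'M[R]_d) (M' : 'M[R]_d) : 0 <= \sum_a \sum_b `|M a b - M' a b|.
  by apply: sumr_ge0 => a _; apply: sumr_ge0.
have ent (f : nat -> 'M[R]_d) (f0 : 'M[R]_d) a b :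
    (forall N, \sum_a \sum_b `|f N a b - f0 a b| <= N.+1%:R^-1) ->
    (fun N => f N a b) @ \oo --> f0 a b.
  move=> h; apply/cvgrPdist_le => e e0.
  have := @cvg_harmonic R; move/cvgrPdist_le => /(_ e e0); apply: filterS => N.
  rewrite sub0r normrN ger0_norm ?harmonic_ge0// => hN'; rewrite distrC.
  apply: le_trans hN'; apply: le_trans (h N).
  have := sum_ge (f N - f0) a b.
  by rewrite !mxE; under [X in _ <= X -> _]eq_bigr do under eq_bigr do rewrite !mxE.
have H1 a b : (fun N => (HS N).1 a b) @ \oo --> H a b.
  by apply: ent => N; apply: le_trans (ltW (hs N)); rewrite lerDl.
have S1 a b : (fun N => (HS N).2 a b) @ \oo --> S a b.
  by apply: ent => N; apply: le_trans (ltW (hs N)); rewrite lerDr.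
have dH : \det H != 0 by rewrite -unitfE -unitmxE.
have d1 := det_cvg H1.
(* Cramer's formula is defined for all [N] and agrees with [invmx] as soon as the determinant is
   nonzero. *)
pose J N := (\det (HS N).1)^-1 *: \adj (HS N).1.
have J1 a b : (fun N => J N a b) @ \oo --> (invmx H) a b.
  rewrite /invmx uH /J mxE; under eq_fun do rewrite mxE.
  by apply: cvgM; [exact: cvgV|exact: adj_cvg].
have L1 a b : (fun N => (J N *m (HS N).2 *m J N) a b) @ \oo --> L a b.
  by apply: mulmx_cvg => //; move=> a' b'; exact: mulmx_cvg.
have D0 : (fun N => \sum_a \sum_b `|(J N *m (HS N).2 *m J N) a b - L a b|) @ \oo --> 0.
  have z : \sum_a \sum_b `|L a b - L a b| = 0.
    by rewrite big1// => a _; rewrite big1// => b _; rewrite subrr normr0.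
  rewrite -[X in _ --> X]z.
  apply: (@cvg_fsum R _ _ (fun a N => \sum_b `|(J N *m (HS N).2 *m J N) a b - L a b|)) => a.
  apply: (@cvg_fsum R _ _ (fun b N => `|(J N *m (HS N).2 *m J N) a b - L a b|)) => b.
  by apply: cvg_norm; apply: cvgB => //; exact: cvg_cst.
have near1 : \forall N \near \oo, \det (HS N).1 != 0.
  exact: (cvgr_neq0 _ d1 dH).
move/cvgrPdist_lt : D0 => /(_ _ eps0) near2.
have [N [n1 n2]] := @filter_ex _ \oo _ _ (filterI near1 near2).
have uN : (HS N).1 \in unitmx by rewrite unitmxE unitfE.
apply: (hc N); split => //.
have -> : invmx (HS N).1 = J N by rewrite /invmx uN.
apply: le_lt_trans (opnorm_le_sum _) _.
under eq_bigr do under eq_bigr do rewrite addmxE [X in _ + X]mxE.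
by apply: le_lt_trans n2; rewrite sub0r normrN ger0_norm.
Qed.

End matrix_limits.

Section in_probability.
Context (R : realType) (dd : measure_display) (T : measurableType dd)
  (P : probability T R).

(** The event of an error at least [eps] is contained in the event [del <= D], to which Markov's
    inequality applies. Outside the latter [H] is invertible, so the arbitrary values of [Hinv] on
    singular matrices are never seen. *)
Lemma cvg_in_probability_plug_in (d : nat) (H S Hinv : nat -> T -> 'M[R]_d)
    (H0 S0 : 'M[R]_d) :
  H0 \in unitmx -> (forall k, random_matrix (Hinv k)) ->
  (forall k w, H k w \in unitmx -> Hinv k w = invmx (H k w)) ->
  (forall a b, cvg_mean1 P (fun k w => H k w a b) (H0 a b)) ->
  (forall a b, cvg_mean1 P (fun k w => S k w a b) (S0 a b)) ->
  cvg_in_probability P (fun k w => Hinv k w *m S k w *m Hinv k w)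
    (invmx H0 *m S0 *m invmx H0).
Proof.
move=> uH mI HI cH cS eps eps0; set L := _ *m S0 *m _.
have [del del0 hdel] := sandwich_inverse_continuous S0 uH eps0.
pose D k w := \sum_a \sum_b `|H k w a b - H0 a b| + \sum_a \sum_b `|S k w a b - S0 a b|.
have [iD ED'] : cvg_mean1 P D 0.
  have dist (M : nat -> T -> 'M[R]_d) (M0 : 'M[R]_d) :
      (forall a b, cvg_mean1 P (fun k w => M k w a b) (M0 a b)) ->
      cvg_mean1 P (fun k w => \sum_a \sum_b `|M k w a b - M0 a b|) 0.
    move=> cM; rewrite [X in cvg_mean1 _ _ X](_ : _ = \sum_(a < d) \sum_(b < d) 0).
      by apply: cvg_mean1_sum => a; apply: cvg_mean1_sum => b; exact: cvg_mean1_dist.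
    by rewrite big1// => a _; rewrite big1.
  by rewrite -[0](addr0 0); apply: cvg_mean1D; exact: dist.
have D0 k w : 0 <= D k w.
  by apply: addr_ge0; apply: sumr_ge0 => a _; apply: sumr_ge0.
have ED : (fun k => Ex P (D k)) @ \oo --> 0.
  suff -> : (fun k => Ex P (D k)) = (fun k => Ex P (fun w => `|D k w - 0|)) by [].
  by apply/funext => k; congr Ex; apply/funext => w; rewrite subr0 ger0_norm.
pose Y k w := Hinv k w *m S k w *m Hinv k w.
have mS k a b : measurable_fun [set: T] (fun w => S k w a b).
  exact: itg_measurable ((cS a b).1 k).
have mY k a b : measurable_fun [set: T] (fun w => Y k w a b).
  under eq_fun do rewrite mxE.
  apply: measurable_sum => c; apply: measurable_funM; last exact: mI.
  under eq_fun do rewrite mxE.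
  by apply: measurable_sum => e; apply: measurable_funM => //; exact: mI.
have mo k : measurable_fun [set: T] (fun w => opnorm (Y k w - L)).
  apply: (measurable_caratheodory (F := fun x _ => opnorm x) (X := fun w => Y k w - L)) => //.
    by move=> _; exact: opnorm_continuous.
  move=> a b; under eq_fun do rewrite addmxE.
  exact: measurable_funD.
have mI' (t : R) : measurable `[t, +oo[%classic by exact: measurable_itv.
have m1 k : measurable [set w | eps <= opnorm (Y k w - L)].
  have -> : [set w | eps <= opnorm (Y k w - L)] =
      (fun w => opnorm (Y k w - L)) @^-1` `[eps, +oo[%classic.
    by apply/seteqP; split => w /=; rewrite in_itv/= andbT.
  by rewrite -[X in measurable X]setTI; apply: mo => //; exact: mI'.
have m2 k : measurable [set w | del <= D k w].
  have -> : [set w | del <= D k w] = (D k) @^-1` `[del, +oo[%classic.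
    by apply/seteqP; split => w /=; rewrite in_itv/= andbT.
  by rewrite -[X in measurable X]setTI; apply: (itg_measurable (iD k)) => //; exact: mI'.
have le k : (P [set w | (eps <= opnorm (Y k w - L))%R] <= (Ex P (D k) / del)%R%:E)%E.
  apply: le_trans (Ex_markov (iD k) (D0 k) del0).
  apply: le_measure; [by rewrite inE; exact: m1|by rewrite inE; exact: m2|].
  move=> w /= hw; rewrite leNgt; apply/negP => /hdel[uk ho].
  by move: hw; rewrite /Y HI// leNgt ho.
apply: (@squeeze_cvge _ _ _ _ (fun=> 0%E) (fun k => P [set w | eps <= opnorm (Y k w - L)])
  (fun k => (Ex P (D k) / del)%:E)).
- by apply: nearW => k; rewrite measure_ge0; exact: le.
- exact: cvg_cst.
- apply: cvg_EFin; first exact: nearW.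
  by rewrite -(mul0r del^-1); apply: cvgMl.
Qed.

End in_probability.

Lemma trmxX (R : realType) (n : nat) (W : 'M[R]_n) k : W^T ^+ k = (W ^+ k)^T.
Proof.
elim: k => [|k IH]; first by rewrite !expr0 trmx1.
by rewrite exprSr IH exprS trmx_mul.
Qed.

Lemma geometric_weaken (R : realType) (C C' rho rho' : R) k :
  0 <= C -> 0 <= C' -> 0 < rho -> rho <= rho' ->
  C * rho ^+ k <= (C + C') * rho' ^+ k.
Proof.
move=> C0 C'0 r0 rr; apply: ler_pM => //.
- by rewrite exprn_ge0// ltW.
- by rewrite lerDl.
- by apply: lerXn2r => //; rewrite nnegrE ltW// (lt_le_trans r0).
Qed.

(** * Eigenvectors of the weight matrices *)

Section perron.
Context (R : realType) (n : nat).

(** Positivity of [u] comes from [u^T = u^T A^m] with [A^m] entrywise positive: each [u j] is at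
    least [n] times the least entry of its column. *)
Lemma left_perron_geometric (A : 'M[R]_n) (u : 'cV[R]_n) :
  (0 < n)%N -> row_stochastic A -> (forall i, 0 < A i i) ->
  strongly_connected (induced_graph A) -> left_perron A u ->
  [/\ \sum_i u i 0 / n%:R = 1, forall j, \sum_i u i 0 / n%:R * A i j = u j 0 / n%:R,
      forall i, 0 < u i 0 / n%:R,
      exists C rho : R, [/\ 0 < C, 0 < rho, rho < 1 &
        forall k i j, `|(A ^+ k) i j - u j 0 / n%:R| <= C * rho ^+ k] &
      exists2 kap : R, 0 < kap & forall l i, kap <= (A ^+ l) i i].
Proof.
move=> n0 sA Ad sc [u0 uA u1]; have [A0 _] := sA.
have n0' : 0 < n%:R :> R by rewrite ltr0n.
have us : \sum_i u i 0 = n%:R.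
  by rewrite -u1 dotE; apply: eq_bigr => i _; rewrite mxE mulr1.
have [m m0 Am] := primitive_pow A0 Ad sc.
have uAk k : u^T *m A ^+ k = u^T.
  elim: k => [|k IH]; first by rewrite expr0 mulmx1.
  by rewrite exprS -[A * _]/(A *m _) mulmxA uA.
have uE k j : \sum_i u i 0 * (A ^+ k) i j = u j 0.
  have /matrixP/(_ 0 j) := uAk k; rewrite mxE [RHS]mxE => <-.
  by apply: eq_bigr => i _; rewrite mxE.
have upos j : 0 < u j 0.
  have [e /andP[e0 _] he] := fin_pos_lbound (Am ^~ j).
  rewrite -(uE m); apply: (@lt_le_trans _ _ (n%:R * e)); first exact: mulr_gt0.
  by rewrite -us mulr_suml; apply: ler_sum => i _; apply: ler_wpM2l.
have S1 : \sum_i u i 0 / n%:R = 1 by rewrite -mulr_suml us divff// gt_eqF.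
have S2 j : \sum_i u i 0 / n%:R * A i j = u j 0 / n%:R.
  rewrite -(uE 1%N) mulr_suml; apply: eq_bigr => i _; rewrite expr1; ring.
split => //; first by move=> i; exact: divr_gt0.
- by apply: (row_stochastic_geometric sA S2 S1 m0) (fun i => Am i (Ordinal n0)).
- exact: (primitive_diag_lbound sA Ad Am).
Qed.

(** Transposition makes [B] row stochastic with invariant vector [v / n]. The graph is only rooted,
    so [v] may have zero entries, and a single positive column of a power is used. *)
Lemma right_perron_geometric (B : 'M[R]_n) (v : 'cV[R]_n) r :
  (0 < n)%N -> col_stochastic B -> (forall i, 0 < B i i) ->
  is_root (induced_graph B^T) r -> right_perron B v ->
  exists C rho : R, [/\ 0 < C, 0 < rho, rho < 1 &
        forall k i j, `|(B ^+ k) i j - v i 0 / n%:R| <= C * rho ^+ k].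
Proof.
move=> n0 [B0 B1] Bd [t [te _ _ tr]] [v0 Bv v1].
have n0' : 0 < n%:R :> R by rewrite ltr0n.
have vs : \sum_i v i 0 = n%:R.
  by rewrite -v1 dotE; apply: eq_bigr => i _; rewrite mxE mul1r.
have sB : row_stochastic B^T.
  apply: row_stochasticP => [i j|i]; first by rewrite mxE.
  have /matrixP/(_ 0 i) := B1; rewrite mxE [RHS]mxE => <-.
  by apply: eq_bigr => j _; rewrite !mxE mul1r.
have BT0 i j : 0 <= B^T i j by rewrite mxE.
have BTd i : 0 < B^T i i by rewrite mxE.
have con i : connect (induced_graph B^T) r i.
  by apply: (connect_sub _ (tr i)) => a b ab; apply: connect1; exact: te.
have [m m0 hm] := rooted_pow_gt0 BT0 BTd con.
have S1 : \sum_i v i 0 / n%:R = 1 by rewrite -mulr_suml vs divff// gt_eqF.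
have S2 j : \sum_i v i 0 / n%:R * B^T i j = v j 0 / n%:R.
  rewrite -[in RHS]Bv [in RHS]mxE mulr_suml; apply: eq_bigr => i _; rewrite mxE; ring.
have [C [rho [C0 r0 r1 h]]] := row_stochastic_geometric sB S2 S1 m0 hm.
exists C, rho; split => // k i j.
by have := h k j i; rewrite trmxX mxE.
Qed.

End perron.

Theorem theorem3
  (R : realType) (dO : measure_display) (Omega : measurableType dO)
  (P : probability Omega R) (n d : nat)
  (dZ : 'I_n -> measure_display) (Z : forall i : 'I_n, measurableType (dZ i))
  (g : forall i : 'I_n, 'cV[R]_d -> Z i -> R)
  (zeta : forall i : 'I_n, {RV P >-> Z i})
  (zetas : nat -> forall i : 'I_n, {RV P >-> Z i})
  (xstar : 'cV[R]_d)
  (mu c p U1 : R) (Lip : forall i : 'I_n, Z i -> R)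
  (A B : 'M[R]_n) (u v : 'cV[R]_n)
  (a b alpha : R) (x0 : 'I_n -> 'cV[R]_d)
  (x y : 'I_n -> nat -> Omega -> 'cV[R]_d)
  (uk : 'I_n -> nat -> 'cV[R]_n)
  (H S Hinv : 'I_n -> nat -> Omega -> 'M[R]_d)
  (L1 L2 : R) :
  cost_setting P g zeta ->
  iid_copies P zeta zetas ->
  (forall z : 'cV[R]_d, total_cost P g zeta xstar <= total_cost P g zeta z) ->
  SAB_iteration g zetas A B (fun k => a / (k%:R + b) `^ alpha) x0 x y ->
  plug_in_method g zetas A x uk H S ->
  (* Hinv is any random matrix equal to the inverse of H where H is invertible *)
  (forall i k, random_matrix (Hinv i k)) ->
  (forall i k w, H i k w \in unitmx -> Hinv i k w = invmx (H i k w)) ->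
  (* (a) *)
  objective_assumption P g zeta xstar mu c p U1 Lip ->
  network_assumption A B ->
  left_perron A u ->
  right_perron B v ->
  1 / 2 < alpha -> alpha < 1 ->
  0 < a -> 0 < b ->
  a / b `^ alpha <= Num.min 1 (n%:R / (dot u v * lip_const P zeta Lip)) ->
  (* (b) *)
  strongly_connected (induced_graph A) ->
  row_stochastic A ->
  (forall i, 0 < A i i) ->
  (* (c) *)
  covmx P (fun w => \sum_(j < n) sgrad g xstar (zeta j w))
    = \sum_(j < n) covmx P (fun w => sgrad g xstar (zeta j w)) ->
  (* (d) *)
  0 < L1 -> 0 < L2 ->
  (forall (i : 'I_n) (z : 'cV[R]_d),
     ('E_P[fun w => (opnorm (shess g z (zeta i w)
                             - shess g xstar (zeta i w)))%R]
                 <= (L1 * enorm (z - xstar))%:E)%E) ->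
  (forall i : 'I_n, ('E_P[fun w => (opnorm (shess g xstar (zeta i w)) ^+ 2)%R]
                <= L2%:E)%E) ->
  forall i : 'I_n,
    cvg_in_probability P
      (fun k w => Hinv i k w *m S i k w *m Hinv i k w)
      (invmx (hess (total_cost P g zeta) xstar)
       *m covmx P (fun w => \sum_(j < n) sgrad g xstar (zeta j w))
       *m invmx (hess (total_cost P g zeta) xstar)).
Proof.
move=> cs iid _ sab plug mI HI oa [_ sB _ Bd _ _ [r [_ rB]]] lp rp al12 al1 a0 b0 _ sc sA Ad hcov L10 _ hL _ i.
have n0 : (0 < n)%N by exact: leq_ltn_trans (ltn_ord i).
have n0' : 0 < n%:R :> R by rewrite ltr0n.
have al0 : 0 < alpha by apply: lt_trans al12; rewrite divr_gt0.
have [pi1 piA pi0 [C1 [rho1 [C10 r10 r11 geoA]]] [kap kap0 diagA]] :=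
  left_perron_geometric n0 sA Ad sc lp.
have [C2 [rho2 [C20 r20 r21 geoB]]] := right_perron_geometric n0 sB Bd rB rp.
have [v0 Bv v1] := rp.
(* One pair of constants for both matrices, as the pathwise analysis uses a common kernel bound. *)
pose C := C1 + C2; pose rho := Num.max rho1 rho2.
have C0 : 0 <= C by apply: addr_ge0; exact: ltW.
have rho0 : 0 < rho by rewrite lt_max r10.
have rhol : rho < 1 by rewrite gt_max r11.
have A_geo k s t : `|(A ^+ k) s t - u t 0 / n%:R| <= C * rho ^+ k.
  apply: le_trans (geoA k s t) _; apply: geometric_weaken => //; try exact: ltW.
  by rewrite le_max lexx.
have B_geo k s t : `|(B ^+ k) s t - v s 0 / n%:R| <= C * rho ^+ k.
  apply: le_trans (geoB k s t) _; rewrite /C addrC.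
  apply: geometric_weaken => //; try exact: ltW.
  by rewrite le_max lexx orbT.
(* Strong connectivity bounds every [pi i] below by some [e > 0], so the effective step factor is at
   least [e] times the sum of the [v i / n], which is 1. *)
have ga0 : 0 < \sum_i u i 0 / n%:R * v i 0 / n%:R.
  have [e /andP[e0 _] he] := fin_pos_lbound pi0.
  apply: (@lt_le_trans _ _ (\sum_i e * v i 0 / n%:R)).
    have vs : \sum_i v i 0 = n%:R.
      by rewrite -v1 dotE; apply: eq_bigr => s _; rewrite mxE mul1r.
    by rewrite -mulr_suml -mulr_sumr vs mulfK// gt_eqF.
  apply: ler_sum => s _; rewrite -mulrA -[leRHS]mulrA; apply: ler_wpM2r; last exact: he.
  exact: divr_ge0.
have Bv' s : \sum_j B s j * v j 0 = v s 0 by rewrite -[in RHS]Bv mxE.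
(* The argument [a^-1] is the constant [Cd], supplied by [step_size_diff]. *)
have x_cvg := @iterates_mean_square_cvg R dO Omega P n d dZ Z g zeta zetas xstar mu c p U1 Lip
  cs iid oa A B _ x0 x y sab (fun i => u i 0 / n%:R) (fun i => v i 0) C rho a^-1 n0 pi1
  (fun i => ltW (pi0 i)) piA Bv' C0 rho0 rhol A_geo B_geo ga0
  (step_size_gt0 alpha a0 b0) (step_size_nonincreasing a0 b0 al0)
  (step_size_diff a0 b0 al0 al1).
have ai0 : 0 <= a^-1 by rewrite invr_ge0 ltW.
have {}x_cvg := x_cvg ai0 (step_size_cvg0 a0 b0 al0) (step_size_dvg a0 b0 al0 al1).
have ax s k e : adapted zetas k (fun w => x s k w e 0).
  exact: (iterates_adapted cs sab k).1.
have sx s k e : sqitg P (fun w => x s k w e 0).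
  exact: (iterates_sqitg cs iid oa sab k).1.
apply: cvg_in_probability_plug_in.
- exact: (hess_total_cost_unit cs oa).
- exact: mI.
- exact: HI.
- exact: (plug_in_hessian cs iid oa C0 rho0 rhol kap0 A_geo diagA ax sx x_cvg plug L10 hL).
- exact: (plug_in_covariance cs iid oa C0 rho0 rhol kap0 A_geo diagA ax sx x_cvg plug hcov).
Qed.
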